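(* Let $a,b>0$ be constants and let $u_0, v_0 \colon \mathbb{R}^d \to \mathbb{R}$ be nonnegative, bounded and measurable functions. Let $u$ and $v$ be the solutions of $u_t = a\Delta u$, $v_t = b\Delta v$ in $\mathbb{R}^d\times(0,T)$ with $u(\cdot,0)=u_0$, $v(\cdot,0)=v_0$. Let $\hat{x} \in \mathbb{R}^d$ be such that $u_0$ and $v_0$ are continuous at $\hat{x}$ and $u_0(\hat{x}) = v_0(\hat{x})$. Moreover, assume that (A1) $r\mapsto \bar{u}_0(r;\hat{x})$ and $r\mapsto\bar{v}_0(r;\hat{x})$ are piecewise continuous (with possibly countably many discontinuities having at most finitely many accumulation points), (A2) $\bar{u}_0(r;\hat{x})$ and $\bar{v}_0(r;\hat{x})$ are either left or right continuous at their discontinuities. Set $$\bar{w}_0(r;\hat{x}) = \bar{u}_0(r;\hat{x}) - \bar{v}_0(kr;\hat{x}), \qquad k=\sqrt{b/a}.$$ If the number of changes of sign $Z[\bar{w}_0]$ of $\bar w_0(\cdot;\hat x)$ is locally finite, then $S_D[u_0-v_0](\hat{x})$ is well-defined; in other words, there exists $\hat{t}>0$ such that $u(\hat{x},t)-v(\hat{x},t)$ has the same sign for $0<t<\hat{t}$. Moreover, $S_D[u_0-v_0](\hat{x}) = 0$ if and only if $\bar{w}_0(\cdot;\hat{x})\equiv 0$. Thus, the set $\{x\in\mathbb{R}^d \mid S_D[u_0-v_0](x)=0\}$ is discrete when $d=1$, and is included in an analytic variety when $d\ge 2$.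
   Context: Solutions of the heat equations are the unique bounded solutions (given by convolution of the initial datum with the heat kernel). Sign function: $\mathrm{sgn}(s)=-1$ if $s<0$, $0$ if $s=0$, $1$ if $s>0$. Diffusive sign: $S_D[u_0-v_0](x)=\lim_{t\downarrow 0}\mathrm{sgn}(u(x,t)-v(x,t))$, where $u$ and $v$ are the solutions of the heat equations with diffusion coefficients $a$ and $b$ and initial data $u_0$ and $v_0$, respectively; it is well-defined at $x$ if this limit exists. Radial average: for a measurable function $w\colon\mathbb{R}^d\to\mathbb{R}$ and $\hat{x}\in\mathbb{R}^d$, for $r\in\mathbb{R}$, $$\bar{w}(r;\hat{x})=\frac{w(\hat{x}+r)+w(\hat{x}-r)}{2}\ \text{ if } d=1,\qquad \bar{w}(r;\hat{x})=\frac{1}{\mathcal{H}^{d-1}(\{|\omega|=1\})}\int_{|\omega|=1} w(\hat{x}+|r|\omega)\,d\mathcal{H}^{d-1}(\omega)\ \text{ if } d\ge 2.$$ Sign changing number: for $f\colon\mathbb{R}\to\mathbb{R}$ and an interval $I\subset\mathbb{R}$, $Z_I[f]$ is the supremum of all $m\ge 0$ such that there exist $\xi_0<\xi_1<\cdots<\xi_m$ in $I$ with $f(\xi_{i-1})f(\xi_i)<0$ for $i=1,\ldots,m$; and $Z[f]=Z_{\mathbb{R}}[f]$. One says that $Z[f]$ is locally finite if $Z_I[f]$ is finite for all bounded open intervals $I$.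
   Formalization: ''S_D=0 implies w̄₀≡0'' is stated assuming that where r is a discontinuity of ū₀ and kr one of v̄₀, both are left or both right continuous; discreteness for d=1 assumes u and v are not identical. Both claims fail otherwise. *)

(* Defs.v *)
From HB Require Import structures.
From mathcomp Require Import all_boot all_order all_algebra.
From mathcomp Require Import all_classical all_reals all_analysis.

Set Implicit Arguments.
Unset Strict Implicit.
Unset Printing Implicit Defensive.

Import Order.TTheory GRing.Theory Num.Theory.
Import numFieldNormedType.Exports.

Local Open Scope classical_set_scope.
Local Open Scope ring_scope.

(* The norm that the library puts on ['rV[R]_d] is the sup norm. *)
Definition enorm (R : realType) (d : nat) (x : 'rV[R]_d) : R :=
  Num.sqrt (\sum_(i < d) x ord0 i ^+ 2).

(* The outer measure generated by covering sets [B i] of weight [w i].  The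
   value [None] stands for an unused place, so that finite covers count too. *)
Section cover_outer.
Local Open Scope ereal_scope.
Context (R : realType) (T I : Type) (B : I -> set T) (w : I -> \bar R).

Definition cover_outer (X : set T) : \bar R :=
  ereal_inf [set \sum_(k <oo) oapp w 0 (F k) |
    F in [set F : nat -> option I | X `<=` \bigcup_k oapp B set0 (F k)]].

Hypothesis w_ge0 : forall i, 0 <= w i.

Let w0 (i : option I) : 0 <= oapp w 0 i.
Proof. by case: i => /=. Qed.

Lemma cover_outer_ge0 X : 0 <= cover_outer X.
Proof.
by apply: le_ereal_inf_tmp => _ [F _ <-]; apply: nneseries_ge0 => n _ _.
Qed.

Lemma cover_outer0 : cover_outer set0 = 0.
Proof.
apply/eqP; rewrite eq_le cover_outer_ge0 andbT.
by apply: ereal_inf_lbound; exists (fun=> None) => //=; rewrite eseries0.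
Qed.

Lemma le_cover_outer : {homo cover_outer : X Y / X `<=` Y >-> X <= Y}.
Proof.
move=> X Y XY; apply: ereal_inf_le_tmp => _ [F YF <-].
by exists F => //; exact: subset_trans YF.
Qed.

Lemma cover_outer_sigma_subadditive : sigma_subadditive cover_outer.
Proof.
move=> A; have [[i ioo]|] := pselect (exists i, cover_outer (A i) = +oo).
  rewrite (eseries_pinfty _ _ ioo) ?leey// => n _.
  by rewrite -ltNye (lt_le_trans _ (cover_outer_ge0 _)).
rewrite -forallNE => Aoo.
suff add2e (e : {posnum R}) : cover_outer (\bigcup_n A n) <=
    \sum_(i <oo) cover_outer (A i) + e%:num%:E.
  by apply/lee_addgt0Pr => _/posnumP[].
rewrite (le_trans _ (epsilon_trick _ _ _))//; last first.
  by move=> n; exact: cover_outer_ge0.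
pose P n (F : nat -> option I) := A n `<=` \bigcup_k oapp B set0 (F k) /\
  \sum_(k <oo) oapp w 0 (F k) <=
    cover_outer (A n) + (e%:num / (2 ^ n.+1)%:R)%:E.
have [G PG] : {G : nat -> nat -> option I & forall n, P n (G n)}.
  apply: (@choice _ _ P) => n; rewrite /P.
  have fA : cover_outer (A n) \is a fin_num.
    rewrite ge0_fin_numE ?cover_outer_ge0// ltey; exact/eqP/Aoo.
  have en1 : (0 < e%:num / (2 ^ n.+1)%:R)%R by [].
  have [_ [F AF <-] /ltW ltF] := lb_ereal_inf_adherent en1 fA.
  by exists F.
have /card_esym/ppcard_eqP[f] := card_nat2.
apply: (@le_trans _ _
    (\esum_(i in [set: nat * nat]) oapp w 0 (uncurry G i))).
  apply: ereal_inf_lbound => /=; exists (uncurry G \o f).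
    move=> t [n _ /(PG n).1 [k _ Bt]].
    by exists (f^-1%FUN (n, k)) => //=; rewrite invK ?inE.
  rewrite -(esum_pred_image (fun i => oapp w 0 (uncurry G i)) _ xpredT)
    ?[fun=> _]set_true//.
  by rewrite image_eq.
rewrite (_ : esum _ _ = \sum_(i <oo) \sum_(j <oo) oapp w 0 (G i j)).
  by apply: lee_nneseries => // [n _ _|n _]; [exact: nneseries_ge0 | exact: (PG n).2].
rewrite nneseries_esumT; last by move=> n; exact: nneseries_ge0.
rewrite (eq_esum (fun n _ => nneseries_esumT (fun k => w0 (G n k)))).
rewrite esum_esum//; apply: esym.
rewrite (_ : _ `*`` _ = [set: nat * nat]); last by apply/seteqP; split.
by apply: eq_esum => -[].
Qed.

End cover_outer.

Section lebesgue_measure_Rd.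
Context (R : realType) (d : nat).

Definition box (ab : 'rV[R]_d * 'rV[R]_d) : set 'rV[R]_d :=
  [set x | forall i, ab.1 ord0 i < x ord0 i <= ab.2 ord0 i].

Definition box_volume (ab : 'rV[R]_d * 'rV[R]_d) : \bar R :=
  (\prod_(i < d) Num.max 0 (ab.2 ord0 i - ab.1 ord0 i))%:E.

Definition lebesgue_outer : set 'rV[R]_d -> \bar R :=
  cover_outer box box_volume.

Lemma box_volume_ge0 ab : (0 <= box_volume ab)%E.
Proof. by rewrite lee_fin prodr_ge0// => i _; rewrite le_max lexx. Qed.

HB.instance Definition _ := isOuterMeasure.Build R 'rV[R]_d lebesgue_outer
  (cover_outer0 box box_volume_ge0) (cover_outer_ge0 box box_volume_ge0)
  (le_cover_outer box box_volume)
  (cover_outer_sigma_subadditive box box_volume_ge0).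

Definition lebesgue_outer_measure : {outer_measure set 'rV[R]_d -> \bar R} :=
  lebesgue_outer.

(* [measurable_fun setT] on this type is Lebesgue measurability on R^d. *)
Definition lebesgue_type := caratheodory_type lebesgue_outer_measure.

HB.instance Definition _ := Measurable.on lebesgue_type.

Definition lebesgue_Rd : {measure set lebesgue_type -> \bar R} :=
  [the measure lebesgue_type R of
    lebesgue_outer_measure : set (caratheodory_type lebesgue_outer_measure) -> \bar R].

End lebesgue_measure_Rd.
Arguments lebesgue_Rd : clear implicits.

(* The usual factor [alpha(s) / 2 ^ s] is left out of the weight: it cancels
   in the averages, which are the only use made of the measure here. *)
Section hausdorff_measure.
Context (R : realType) (d s : nat).
Local Open Scope ereal_scope.

Definition diam (U : set 'rV[R]_d) : \bar R :=
  maxe 0 (ereal_sup [set (enorm (z.1 - z.2))%:E | z in U `*` U]).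

Definition hausdorff_delta (delta : R) : set 'rV[R]_d -> \bar R :=
  cover_outer (fun U : {U : set 'rV[R]_d | diam U <= delta%:E} => sval U)
    (fun U => diam (sval U) ^+ s).

Definition hausdorff_outer (X : set 'rV[R]_d) : \bar R :=
  ereal_sup [set hausdorff_delta delta X | delta in [set delta | (0 < delta)%R]].

Lemma diam_expe_ge0 delta (U : {U : set 'rV[R]_d | diam U <= delta%:E}) :
  0 <= diam (sval U) ^+ s.
Proof. by apply: expe_ge0; rewrite le_max lexx. Qed.

Lemma hausdorff_outer_ge0 X : 0 <= hausdorff_outer X.
Proof.
apply: (@le_trans _ _ (hausdorff_delta 1 X)).
  exact/cover_outer_ge0/diam_expe_ge0.
by apply: ereal_sup_ubound; exists 1%R => //=.
Qed.

Lemma hausdorff_outer0 : hausdorff_outer set0 = 0.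
Proof.
apply/eqP; rewrite eq_le hausdorff_outer_ge0 andbT.
apply: ge_ereal_sup => _ [e _ <-].
by rewrite /hausdorff_delta cover_outer0//; exact: diam_expe_ge0.
Qed.

Lemma le_hausdorff_outer : {homo hausdorff_outer : X Y / X `<=` Y >-> X <= Y}.
Proof.
move=> X Y XY; apply: ge_ereal_sup => _ [e e0 <-].
apply: (@le_trans _ _ (hausdorff_delta e Y)); first exact: le_cover_outer.
by apply: ereal_sup_ubound; exists e.
Qed.

Lemma hausdorff_outer_sigma_subadditive : sigma_subadditive hausdorff_outer.
Proof.
move=> F; apply: ge_ereal_sup => _ [e e0 <-].
apply: le_trans (cover_outer_sigma_subadditive _ _ F) _.
  exact: diam_expe_ge0.
apply: lee_nneseries => [n _ _|n _]; first exact/cover_outer_ge0/diam_expe_ge0.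
by apply: ereal_sup_ubound; exists e.
Qed.

HB.instance Definition _ := isOuterMeasure.Build R 'rV[R]_d hausdorff_outer
  hausdorff_outer0 hausdorff_outer_ge0 le_hausdorff_outer
  hausdorff_outer_sigma_subadditive.

Definition hausdorff_outer_measure : {outer_measure set 'rV[R]_d -> \bar R} :=
  hausdorff_outer.

Definition hausdorff_type := caratheodory_type hausdorff_outer_measure.

HB.instance Definition _ := Measurable.on hausdorff_type.

Definition hausdorff : {measure set hausdorff_type -> \bar R} :=
  [the measure hausdorff_type R of
    hausdorff_outer_measure : set (caratheodory_type hausdorff_outer_measure) -> \bar R].

End hausdorff_measure.
Arguments hausdorff : clear implicits.

Section heat.
Context (R : realType) (d : nat).
Implicit Types (c t r : R) (x : 'rV[R]_d) (w : 'rV[R]_d -> R).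

Definition heat_kernel c x t : R :=
  (Num.sqrt (4 * pi * c * t) ^+ d)^-1 * expR (- (enorm x ^+ 2 / (4 * c * t))).

(* The bounded solution of [w_t = c Delta w] for t > 0. *)
Definition heat_sol c w x t : R :=
  (\int[lebesgue_Rd R d]_y (heat_kernel c (x - y) t * w y))%R.

Definition sgn_diff (a b : R) (u0 v0 : 'rV[R]_d -> R) x t : R :=
  Num.sg (heat_sol a u0 x t - heat_sol b v0 x t).

Definition diffusive_sign_well_defined (a b : R) (u0 v0 : 'rV[R]_d -> R) x :=
  cvg (sgn_diff a b u0 v0 x t @[t --> 0^'+]).

Definition diffusive_sign (a b : R) (u0 v0 : 'rV[R]_d -> R) x : R :=
  lim (sgn_diff a b u0 v0 x t @[t --> 0^'+]).

Definition unit_sphere : set 'rV[R]_d := [set omega | enorm omega = 1].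

Definition radial_avg w x r : R :=
  if d == 1%N then (w (x + const_mx r) + w (x - const_mx r)) / 2
  else (fine (hausdorff R d d.-1 unit_sphere))^-1 *
       (\int[hausdorff R d d.-1]_(omega in unit_sphere) w (x + `|r| *: omega))%R.

End heat.

Section sign_changes.
Context (R : realType).
Implicit Types (f : R -> R) (I D : set R).

Definition changes_sign f I (m : nat) := exists xi : nat -> R,
  (forall i, (i <= m)%N -> I (xi i)) /\
  (forall i, (i < m)%N -> xi i < xi i.+1 /\ f (xi i) * f (xi i.+1) < 0).

Definition sign_changes f I : \bar R :=
  ereal_sup [set m%:R%:E | m in changes_sign f I].

Definition sign_changes_locally_finite f :=
  forall p q, p < q -> sign_changes f `]p, q[ \is a fin_num.

Definition discontinuities f : set R := [set r | ~ {for r, continuous f}].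

(* No one-sided limits are required. *)
Definition piecewise_continuous f :=
  countable (discontinuities f) /\ finite_set (limit_point (discontinuities f)).

Definition left_continuous_at f r := f s @[s --> r^'-] --> f r.
Definition right_continuous_at f r := f s @[s --> r^'+] --> f r.

End sign_changes.

Section analytic.
Context (R : realType) (d : nat).
Implicit Types (f : 'rV[R]_d -> R) (U V : set 'rV[R]_d).

Definition monomial (al : {ffun 'I_d -> nat}) (h : 'rV[R]_d) : R :=
  \prod_(i < d) h ord0 i ^+ al i.

(* [f] is, near [x], the sum of an absolutely convergent power series; the sum
   of a summable family is written as positive part minus negative part. *)
Definition analytic_at f (x : 'rV[R]_d) :=
  exists c : {ffun 'I_d -> nat} -> R, \forall y \near x,
    let g al := (c al * monomial al (y - x))%:E in
    summable setT g /\
    (f y)%:E = (\esum_(al in setT) (g^\+ al) - \esum_(al in setT) (g^\- al))%E.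

Definition analytic_variety V := forall p, exists U, open_nbhs p U /\
  exists (m : nat) (f : 'I_m -> 'rV[R]_d -> R),
    (forall i x, U x -> analytic_at (f i) x) /\
    (forall x, U x -> (V x <-> forall i, f i x = 0)).

End analytic.

(* Main.v *)
Require Import Defs.
From HB Require Import structures.
From mathcomp Require Import all_boot all_order all_algebra.
From mathcomp Require Import ring lra zify.
From mathcomp Require Import all_classical all_reals all_analysis measurable_realfun.

(** The solutions are convolutions with the heat kernel, which is radial, so at
    a fixed point [x] they depend on the initial data only through the radial
    averages around [x].  After rescaling the radius by [k = sqrt (b / a)] in the
    second one, the difference of the solutions at [x] is, up to a positive
    factor, the Gaussian transform [gauss_weight W s] of the difference [W] of the
    averages, with [s = 1 / (4 * a * t)] (lemma [heat_diff_radial]).  Small times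
    are large parameters [s], and there the transform is governed by the first
    radii at which [W] is not null.  If the difference of the averages has locally
    finitely many changes of sign, it has a constant weak sign just after these
    radii, and the exponential weight makes this part dominate the rest (lemma
    [gauss_weight_sign]).  Under this assumption the sign is 0 only if [W] is
    null; then the difference of the averages vanishes on a dense
    set of radii, and one-sided continuity on a common side makes it vanish
    everywhere (lemma [dense_zeros_eq0]).

    At a point of diffusive sign 0 the transform vanishes for large parameters.
    Being analytic in its parameter it vanishes for all of them (lemma
    [gauss_weight_zero_extends]), so the two solutions agree at that point for all
    times.  If they differ somewhere, at a time [t], the points of diffusive sign
    0 lie in the zero set of their difference at this time, which is a power
    series around every point with everywhere absolute convergence (lemma
    [heat_sol_entire]): the Gaussian kernel is the generating function of the
    Hermite polynomials.  In dimension 1 the zeros of such a function are isolated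
    (lemma [entire_at_zeros]).

    The reduction to radial averages needs polar coordinates in which the surface
    measure is the normalised Hausdorff measure of the sphere.  Polar coordinates
    hold by scaling for the cone measure, which assigns to a set of directions the
    volume of the corresponding part of the unit ball (lemma [integral_polar]).
    Cone measure and Hausdorff measure are both finite, positive and invariant
    under the reflections that exchange two given points of the sphere, so each
    gives to a ball centred on the sphere a mass depending on the radius only;
    by Christensen's double counting argument they are proportional (lemma
    [hausS_proportional]).  The same argument shows that Lebesgue measure is
    invariant under reflections (lemma [lebB_reflection]). *)

Set Implicit Arguments.
Unset Strict Implicit.
Unset Printing Implicit Defensive.

Import Order.TTheory GRing.Theory Num.Theory.
Import numFieldNormedType.Exports.

Local Open Scope classical_set_scope.
Local Open Scope ring_scope.

(** * Borel sets and Lebesgue outer measure *)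

Section borel.
Context {R : realType} {d : nat}.
Implicit Types x y : 'rV[R]_d.

(** Borel sets are generated by half-spaces rather than by open sets, so that
    measurability for an outer measure is tested one coordinate at a time. *)
Definition halfspaces : set (set 'rV[R]_d) :=
  [set A | exists i c, A = [set x : 'rV[R]_d | c < x ord0 i]].

End borel.
Arguments halfspaces : clear implicits.
Notation borelV R d := (g_sigma_algebraType (halfspaces R d)).

Section borel_theory.
Context {R : realType} {d : nat}.
Implicit Types x y : 'rV[R]_d.

Lemma measurable_coord i :
  measurable_fun [set: borelV R d] (fun x : borelV R d => x ord0 i).
Proof.
apply: (measurability _ (RGenOInfty.measurableE R)) => _ [_ [c ->] <-].
rewrite setTI; apply: sub_sigma_algebra; exists i, c.
by apply/seteqP; split => x /=; rewrite in_itv/= andbT.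
Qed.

Lemma measurable_to_borelV d' (T : measurableType d') (f : T -> borelV R d) :
  (forall i, measurable_fun [set: T] (fun t => f t ord0 i)) ->
  measurable_fun [set: T] f.
Proof.
move=> mf; apply: (@measurability _ _ T (borelV R d) setT f (halfspaces R d) erefl).
move=> _ [_ [i [c ->]] <-].
rewrite [X in measurable X](_ : _ =
  setT `&` (fun t => f t ord0 i) @^-1` `]c, +oo[); first exact: mf.
by apply/seteqP; split => t /= [_]; rewrite in_itv/= andbT.
Qed.

Lemma measurable_enorm : measurable_fun [set: borelV R d] (@enorm R d).
Proof.
apply: (@measurableT_comp _ _ _ _ _ _ (@Num.sqrt R)).
  apply: continuous_measurable_fun; exact: sqrt_continuous.
apply: measurable_sum => i; apply: measurable_funX; exact: measurable_coord.
Qed.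

End borel_theory.

Section cover_outer_image.
Local Open Scope ereal_scope.
Context (R : realType) (T I T' I' : Type).
Variables (B : I -> set T) (w : I -> \bar R).
Variables (B' : I' -> set T') (w' : I' -> \bar R).

(** Pulling a cover back along [psi] gives the behaviour of every covering outer
    measure under translations, dilations and reflections. *)
Lemma le_cover_outer_image (c : R) (psi : T' -> T) (X : set T) (X' : set T') :
  (0 < c)%R -> (forall i, 0 <= w i) -> (forall i, 0 <= w' i) ->
  (forall x, X' x -> X (psi x)) ->
  (forall i, exists j, psi @^-1` (B i) `<=` B' j /\ w' j <= c%:E * w i) ->
  cover_outer B' w' X' <= c%:E * cover_outer B w X.
Proof.
move=> c0 w0 w0' XX' /choice[f fP].
rewrite -lee_pdivrMl//; apply: le_ereal_inf_tmp => _ [F XF <-].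
rewrite lee_pdivrMl//.
rewrite -nneseriesZl; last by move=> n _; case: (F n).
apply: (@le_trans _ _ (\sum_(k <oo) oapp w' 0 (omap f (F k)))).
  apply: ereal_inf_lbound => /=; exists (omap f \o F) => //.
  move=> x /XX' /XF [n _ Fn]; exists n => //=; move: Fn.
  by case: (F n) => //= i Bi; exact: (fP i).1.
apply: lee_nneseries => [n _ _|n _]; first by case: (F n) => /=.
by case: (F n) => [i|] /=; [exact: (fP i).2|rewrite mule0].
Qed.

End cover_outer_image.

Section lebesgue_outer_theory.
Context {R : realType} {d : nat}.
Implicit Types (x y : 'rV[R]_d) (X A : set 'rV[R]_d).
Local Notation lam := (@lebesgue_outer R d).

Lemma le_lebesgue_translate y X : (lam [set x | X (x + y)%R] <= lam X)%E.
Proof.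
rewrite -[leRHS]mul1e; apply: (le_cover_outer_image (psi := +%R^~ y)) => //.
- exact: box_volume_ge0.
- exact: box_volume_ge0.
- move=> [a b]; exists (a - y, b - y); split.
    by move=> x /= h i; have := h i; rewrite !mxE/= ltrBlDr lerBrDr.
  rewrite mul1e lee_fin ler_prod// => i _; rewrite le_max lexx/= !mxE/=.
  by rewrite opprB addrA subrK.
Qed.

Lemma lebesgue_translate y X : lam [set x | X (x + y)] = lam X.
Proof.
apply/eqP; rewrite eq_le le_lebesgue_translate/=.
rewrite [leLHS](_ : _ = lam [set x | [set x | X (x + y)] (x - y)]).
  exact: le_lebesgue_translate.
by congr (lam _); apply/seteqP; split => x /=; rewrite subrK.
Qed.

Lemma le_lebesgue_scale (c : R) X : 0 < c ->
  (lam [set x | X (c *: x)%R] <= (c^-1 ^+ d)%:E * lam X)%E.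
Proof.
move=> c0; apply: (le_cover_outer_image (psi := fun x => c *: x)) => //.
- by rewrite exprn_gt0// invr_gt0.
- exact: box_volume_ge0.
- exact: box_volume_ge0.
- move=> [a b]; exists (c^-1 *: a, c^-1 *: b); split.
    move=> x /= h i; have := h i; rewrite !mxE.
    by rewrite ltr_pdivrMl// ler_pdivlMl.
  rewrite -EFinM lee_fin -[X in _ ^+ X]card_ord -prodr_const -big_split/=.
  apply: ler_prod => i _; rewrite le_max lexx/= !mxE -mulrBr.
  by rewrite maxr_pMr ?mulr0// invr_ge0 ltW.
Qed.

Lemma lebesgue_scale (c : R) X : 0 < c ->
  lam [set x | X (c *: x)] = ((c^-1 ^+ d)%:E * lam X)%E.
Proof.
move=> c0; apply/eqP; rewrite eq_le le_lebesgue_scale//=.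
rewrite exprVn lee_pdivrMl ?exprn_gt0//.
rewrite [leLHS](_ : _ = lam [set x | [set x | X (c *: x)] (c^-1 *: x)]).
  by rewrite -[X in (X ^+ d)%:E](invrK c); apply: le_lebesgue_scale; rewrite invr_gt0.
by congr (lam _); apply/seteqP; split => x /=; rewrite scalerA divff ?scale1r// gt_eqF.
Qed.

End lebesgue_outer_theory.
Section lebesgue_halfspace.
Context {R : realType} {d : nat}.
Local Notation lam := (@lebesgue_outer_measure R d).

(** Cutting every box of a cover by the hyperplane gives two covers whose volumes
    add up exactly, since only the side in direction [i] changes. *)
Lemma lebesgue_halfspace_caratheodory (i : 'I_d) (c : R) :
  lam.-caratheodory [set x : 'rV[R]_d | c < x ord0 i].
Proof.
apply: le_caratheodory_measurable => X.
rewrite {3}/lebesgue_outer_measure /= /lebesgue_outer /cover_outer.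
apply: le_ereal_inf_tmp => _ [F XF <-].
pose up (ab : 'rV[R]_d * 'rV[R]_d) : 'rV[R]_d * 'rV[R]_d :=
  (\row_l (if l == i then Num.max c (ab.1 ord0 l) else ab.1 ord0 l), ab.2).
pose lo (ab : 'rV[R]_d * 'rV[R]_d) : 'rV[R]_d * 'rV[R]_d :=
  (ab.1, \row_l (if l == i then Num.min c (ab.2 ord0 l) else ab.2 ord0 l)).
pose V := fun o : option ('rV[R]_d * 'rV[R]_d) => oapp (@box_volume R d) 0%E o.
have V0 o : (0 <= V o)%E by case: o => //= ab; exact: box_volume_ge0.
have volE o : V o = (V (omap up o) + V (omap lo o))%E.
  case: o => [[a b]|] /=; last by rewrite /V/= adde0.
  rewrite /V/= /box_volume /= -EFinD; congr EFin.
  rewrite (bigD1 i)//= [X in _ = X + _](bigD1 i)//= [X in _ = _ + X](bigD1 i)//=.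
  rewrite !mxE eqxx.
  rewrite [X in _ = _ * X + _](eq_bigr (fun j => Num.max 0 (b ord0 j - a ord0 j))); last first.
    by move=> j /negbTE ji; rewrite mxE ji.
  rewrite [X in _ = _ + _ * X](eq_bigr (fun j => Num.max 0 (b ord0 j - a ord0 j))); last first.
    by move=> j /negbTE ji; rewrite mxE ji.
  rewrite -mulrDl; congr (_ * _).
  move: (a ord0 i) (b ord0 i) => p q.
  rewrite !maxEle minEle; case: (leP c p) => ?; case: (leP c q) => ?;
  repeat case: ifPn => //; rewrite -?ltNge => *; lra.
rewrite (eq_eseriesr (fun k _ => volE (F k))) nneseriesD//.
apply: leeD.
- apply: ereal_inf_lbound; exists (omap up \o F) => // x [/XF [n _ Fx] cx].
  exists n => //=; move: Fx; case: (F n) => //= -[a b] /= h j; have /= := h j.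
  by rewrite mxE; case: eqP => // -> /andP[? ->]; rewrite gt_max cx andbT; apply/andP.
- apply: ereal_inf_lbound; exists (omap lo \o F) => // x [/XF [n _ Fx] /= /negP cx].
  exists n => //=; move: Fx; case: (F n) => //= -[a b] /= h j; have /= := h j.
  rewrite mxE; case: eqP => // -> /andP[-> ?]; rewrite le_min /= leNgt.
  by apply/andP.
Qed.

Lemma measurable_lebesgue (A : set (borelV R d)) : measurable A ->
  measurable (A : set (lebesgue_type R d)).
Proof.
move: A; apply: smallest_sub; first exact: sigma_algebra_measurable.
by move=> _ [i [c ->]]; exact: lebesgue_halfspace_caratheodory.
Qed.

End lebesgue_halfspace.

(** The lower bound for the volume of the unit cube, by induction on the
    dimension: the slices of the boxes cover the slice of the cube at each height
    in the first coordinate, and integrating over that coordinate restores the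
    missing side.  The flag [P k] tells which boxes meet the current slice. *)
Lemma cube_cover (R : realType) (d : nat) (P : nat -> bool)
    (a b : nat -> 'I_d -> R) :
  (forall x : 'I_d -> R, (forall i, 0 < x i <= 1) ->
     exists k, P k /\ forall i, a k i < x i <= b k i) ->
  (1 <= \sum_(k <oo) ((P k)%:R * \prod_i Num.max 0 (b k i - a k i))%:E)%E.
Proof.
elim: d P a b => [|d IH] P a b cov.
  have [|k [Pk _]] := cov (fun=> 0); first by case.
  rewrite (@nneseriesD1 _ _ k)//.
    by rewrite Pk big_ord0 mul1r leeDl// nneseries_ge0// => n _ _; rewrite big_ord0 mulr1 lee_fin.
  by move=> n _; rewrite big_ord0 mulr1 lee_fin.
have key (x0 : R) : (`]0, 1]%classic : set R) x0 ->
    (1 <= \sum_(k <oo) (((P k && (a k ord0 < x0 <= b k ord0)))%:R *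
      \prod_i Num.max 0 (b k (lift ord0 i) - a k (lift ord0 i)))%:E)%E.
  rewrite /= in_itv/= => x01; apply: IH => x x1.
  have [|k [Pk kx]] := cov (fun i => if unlift ord0 i is Some j then x j else x0).
    by move=> i; case: (unlift _ _).
  exists k; split; first by rewrite Pk; have := kx ord0; rewrite unlift_none.
  by move=> i; have := kx (lift ord0 i); rewrite liftK.
pose D := `]0, 1]%classic : set R.
have mD : measurable D by exact: measurable_itv.
pose g k (x : R) := (((P k)%:R * \prod_i Num.max 0 (b k (lift ord0 i) - a k (lift ord0 i))) *
   \1_(`]a k ord0, b k ord0]%classic) x)%:E.
have p0 k : 0 <= (P k)%:R * \prod_i Num.max 0 (b k (lift ord0 i) - a k (lift ord0 i)).
  by rewrite mulr_ge0// prodr_ge0// => i _; rewrite le_max lexx.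
have g0 k x : (0 <= g k x)%E by rewrite lee_fin mulr_ge0.
have mg k : measurable_fun D (g k).
  by apply/measurable_EFinP; apply: measurable_funM => //; exact: measurable_indic.
apply: (@le_trans _ _ (\int[lebesgue_measure]_(x in D) \sum_(k <oo) g k x)%E).
  rewrite -[leLHS](_ : (\int[lebesgue_measure]_(x in D) 1)%E = _); last first.
    have -> := integral_cst (@lebesgue_measure R) mD 1%E.
    have := lebesgue_measure_itv (`]0, 1]%R : interval R).
    by rewrite /= lte_fin ltr01 oppr0 adde0 mul1e.
  apply: ge0_le_integral => //.
  - apply: ge0_emeasurable_sum => [k x _ _|k _]; [exact: g0|exact: mg].
  - move=> x Dx; apply: le_trans (key x Dx) _; apply: lee_nneseries => k.
      by move=> _ _; rewrite lee_fin mulr_ge0// prodr_ge0// => i _; rewrite le_max lexx.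
    move=> _; rewrite /g lee_fin mulrAC indicE mem_setE/= in_itv/=.
    by rewrite -natrM mulnb.
rewrite integral_nneseries//; apply: lee_nneseries => k.
  by move=> _ _; exact: integral_ge0.
move=> _; rewrite big_ord_recl /g.
under eq_integral do rewrite EFinM.
rewrite ge0_integralZl_EFin//; last first.
  by apply/measurable_EFinP; exact: measurable_indic.
rewrite integral_indic// [in leRHS]mulrCA [in leRHS]mulrC [in leRHS]EFinM.
apply: lee_wpmul2l; first by rewrite lee_fin.
rewrite (@le_trans _ _ (lebesgue_measure (`]a k ord0, b k ord0]%classic : set R)))//.
  by apply: le_measure; rewrite ?inE//; exact: measurableI.
have -> := lebesgue_measure_itv `]a k ord0, b k ord0]%R; rewrite /= lte_fin.
case: ifPn => [ab|_].
  by rewrite -EFinD lee_fin le_max lexx orbT.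
by rewrite lee_fin le_max lexx.
Qed.

Section lebesgue_positive.
Context {R : realType} {d : nat}.

Lemma lebesgue_unit_cube :
  (1 <= lebesgue_outer [set x : 'rV[R]_d | forall i, (0 < x ord0 i <= 1)%R])%E.
Proof.
apply: le_ereal_inf_tmp => _ [F QF <-].
have := @cube_cover R d (fun k => isSome (F k))
  (fun k i => oapp (fun ab : 'rV[R]_d * 'rV[R]_d => ab.1 ord0 i) 0 (F k))
  (fun k i => oapp (fun ab : 'rV[R]_d * 'rV[R]_d => ab.2 ord0 i) 0 (F k)).
rewrite [X in _ -> (_ <= X)%E](_ : _ = (\sum_(k <oo) oapp (@box_volume R d) 0 (F k))%E).
  apply => x x01; have [|k _ Fk] := QF (\row_i x i); first by move=> i; rewrite mxE.
  exists k; move: Fk; case: (F k) => //= -[a b] h; split => // i.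
  by have := h i; rewrite mxE.
by apply: eq_eseriesr => k _; case: (F k) => [[a b]|] /=; rewrite ?mul1r ?mul0r.
Qed.

End lebesgue_positive.

(** * Euclidean balls and uniformly distributed measures *)

Section enorm_theory.
Context {R : realType} {d : nat}.
Implicit Types x y : 'rV[R]_d.

Lemma sum_sqr_ge0 x : 0 <= \sum_(i < d) x ord0 i ^+ 2.
Proof. by apply: sumr_ge0 => i _; exact: sqr_ge0. Qed.

Lemma sqr_enorm x : enorm x ^+ 2 = \sum_(i < d) x ord0 i ^+ 2.
Proof. by rewrite sqr_sqrtr// sum_sqr_ge0. Qed.

Lemma enorm_ge0 x : 0 <= enorm x.
Proof. exact: sqrtr_ge0. Qed.

Lemma enorm_le x (m : R) : 0 <= m ->
  (enorm x <= m) = (\sum_(i < d) x ord0 i ^+ 2 <= m ^+ 2).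
Proof. by move=> m0; rewrite -sqr_enorm ler_pXn2r// nnegrE ?enorm_ge0. Qed.

Lemma ler_coord_enorm x i : `|x ord0 i| <= enorm x.
Proof.
rewrite -(@ler_pXn2r _ 2)// ?nnegrE ?enorm_ge0// sqr_enorm (bigD1 i)//=.
by rewrite real_normK ?num_real// lerDl sumr_ge0// => j _; exact: sqr_ge0.
Qed.

Lemma enormZ (c : R) x : enorm (c *: x) = `|c| * enorm x.
Proof.
rewrite /enorm -sqrtr_sqr -sqrtrM ?sqr_ge0// mulr_sumr.
by congr Num.sqrt; apply: eq_bigr => i _; rewrite mxE exprMn.
Qed.

Lemma enormN x : enorm (- x) = enorm x.
Proof. by rewrite -scaleN1r enormZ normrN1 mul1r. Qed.

Lemma enormB x y : enorm (x - y) = enorm (y - x).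
Proof. by rewrite -enormN opprB. Qed.

Lemma enorm0 : enorm (0 : 'rV[R]_d) = 0.
Proof. by rewrite -(scale0r 0) enormZ normr0 mul0r. Qed.

Lemma enorm_eq0 x : (enorm x == 0) = (x == 0).
Proof.
apply/eqP/eqP => [x0|->]; last exact: enorm0.
apply/rowP => i; rewrite mxE; apply/eqP; rewrite -normr_le0.
by rewrite (le_trans (ler_coord_enorm x i))// x0.
Qed.

Lemma cauchy_schwarz x y :
  \sum_(i < d) x ord0 i * y ord0 i <= enorm x * enorm y.
Proof.
have [/eqP|x0] := eqVneq (enorm x) 0.
  rewrite enorm_eq0 => /eqP ->; rewrite enorm0 mul0r big1// => i _.
  by rewrite mxE mul0r.
have [/eqP|y0] := eqVneq (enorm y) 0.
  rewrite enorm_eq0 => /eqP ->; rewrite enorm0 mulr0 big1// => i _.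
  by rewrite mxE mulr0.
have p0 : 0 < enorm x * enorm y by rewrite mulr_gt0// lt_def enorm_ge0 ?x0 ?y0.
have := sum_sqr_ge0 (enorm y *: x - enorm x *: y).
rewrite (eq_bigr (fun i => enorm y ^+ 2 * x ord0 i ^+ 2
  + (- (2 * (enorm x * enorm y)) * (x ord0 i * y ord0 i)
  + enorm x ^+ 2 * y ord0 i ^+ 2))); last by move=> i _; rewrite !mxE; ring.
rewrite !big_split/= -!mulr_sumr -!sqr_enorm => h.
rewrite -(ler_pM2l p0); move: h; move: (enorm x) (enorm y) (\sum_i _) => p q s.
nra.
Qed.

Lemma ler_enormD x y : enorm (x + y) <= enorm x + enorm y.
Proof.
rewrite enorm_le ?addr_ge0 ?enorm_ge0//.
rewrite (eq_bigr (fun i => x ord0 i ^+ 2 + (2 * (x ord0 i * y ord0 i) + y ord0 i ^+ 2))).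
  rewrite !big_split/= -mulr_sumr -!sqr_enorm; have := cauchy_schwarz x y.
  by move: (\sum_i _) (enorm x) (enorm y) => p q s; nra.
by move=> i _; rewrite !mxE; ring.
Qed.

Lemma ler_enorm_dist x y z : enorm (x - z) <= enorm (x - y) + enorm (y - z).
Proof. by rewrite (le_trans _ (ler_enormD _ _))// addrA subrK. Qed.

Lemma ler_dist_enorm x y : `|enorm x - enorm y| <= enorm (x - y).
Proof.
have h (u v : 'rV[R]_d) : enorm u - enorm v <= enorm (u - v).
  by rewrite lerBlDr; have := ler_enormD (u - v) v; rewrite subrK.
by rewrite ler_norml h andbT lerNl opprB enormB h.
Qed.

Lemma enorm_le_coord x (m : R) : 0 <= m -> (forall i, `|x ord0 i| <= m) ->
  enorm x <= d%:R * m.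
Proof.
move=> m0 xm; rewrite enorm_le ?mulr_ge0//.
rewrite (@le_trans _ _ (\sum_(i < d) m ^+ 2))//.
  by apply: ler_sum => i _; rewrite -real_normK ?num_real// ler_pXn2r ?nnegrE.
rewrite sumr_const card_ord exprMn -[leLHS]mulr_natl ler_wpM2r ?sqr_ge0//.
by rewrite -natrX ler_nat; case: (d) => // n; rewrite expnS expn1 leq_pmulr.
Qed.

Definition eball x (r : R) : set 'rV[R]_d := [set y | enorm (x - y) < r].

Definition obox (p q : 'rV[R]_d) : set 'rV[R]_d :=
  [set x | forall i, p ord0 i < x ord0 i < q ord0 i].

End enorm_theory.

Section borel_sets.
Context {R : realType} {d : nat}.
Local Notation V := 'rV[R]_d.
Local Notation BV := (borelV R d).

Lemma measurable_obox (p q : V) : measurable (obox p q : set BV).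
Proof.
rewrite (_ : obox p q = \bigcap_(i in [set: 'I_d])
    ((fun x : BV => x ord0 i) @^-1` `]p ord0 i, q ord0 i[)).
  apply: fin_bigcap_measurable => // i _; rewrite -[X in measurable X]setTI.
  exact: measurable_coord.
apply/seteqP; split => x /= h i; first by move=> _ /=; rewrite in_itv/= h.
by have := h i I; rewrite /= in_itv.
Qed.

Lemma measurable_linear d' (T : measurableType d') (f g : T -> BV) (c : R) :
  measurable_fun [set: T] f -> measurable_fun [set: T] g ->
  measurable_fun [set: T] (fun t => c *: f t + g t : BV).
Proof.
move=> mf mg; apply: measurable_to_borelV => i.
rewrite (_ : (fun _ => _) = (fun t => c * f t ord0 i + g t ord0 i)).
  apply: measurable_funD; last exact: (measurableT_comp (measurable_coord i)).
  by apply: measurable_funM => //; exact: (measurableT_comp (measurable_coord i)).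
by apply/funext => t; rewrite !mxE.
Qed.

Lemma measurable_eball_rel (r : R) :
  measurable [set z : BV * BV | eball z.1 r z.2].
Proof.
rewrite (_ : [set _ | _] = (fun z : BV * BV => enorm (-1 *: z.2 + z.1)) @^-1` `]-oo, r[).
  rewrite -[X in measurable X]setTI.
  have : measurable_fun [set: BV * BV] (fun z : BV * BV => enorm (-1 *: z.2 + z.1)).
    apply: (measurableT_comp measurable_enorm).
    exact: measurable_linear.
  by apply => //; exact: measurable_itv.
by apply/seteqP; split => z; rewrite /eball/= in_itv/= scaleN1r addrC.
Qed.

Lemma measurable_eball (x : V) (r : R) : measurable (eball x r : set BV).
Proof.
have := measurable_xsection (x : BV) (measurable_eball_rel r).
by rewrite /xsection /=; congr measurable; apply/seteqP; split => y /=; rewrite in_setE.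
Qed.

Lemma borelV_generated_obox :
  @measurable _ BV = <<s [set A | exists p q, A = obox p q] >>.
Proof.
apply/seteqP; split; last first.
  apply: smallest_sub; first exact: sigma_algebra_measurable.
  by move=> _ [p [q ->]]; exact: measurable_obox.
apply: smallest_sub; first exact: smallest_sigma_algebra.
move=> _ [i [c ->]].
rewrite (_ : [set _ | _] = \bigcup_n obox (\row_j if j == i then c else - n%:R) (\row_j n%:R)).
  apply: sigma_algebra_bigcup => n; apply: sub_sigma_algebra.
  by exists (\row_j if j == i then c else - n%:R), (\row_j n%:R).
apply/seteqP; split => x /=; last by move=> [n _ /(_ i)]; rewrite mxE eqxx => /andP[].
move=> cx; have [n xn] : exists n : nat, enorm x < n%:R.
  by exists (Num.Def.archi_bound (enorm x)); exact: archi_boundP (enorm_ge0 _).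
exists n => // j; rewrite !mxE; have := ler_coord_enorm x j; rewrite ler_norml => /andP[h1 h2].
rewrite (le_lt_trans h2 xn) andbT; case: eqP => [->//|_].
by rewrite (lt_le_trans _ h1)// ltrN2.
Qed.

Lemma setI_closed_obox : setI_closed [set A : set V | exists p q, A = obox p q].
Proof.
move=> _ _ [p [q ->]] [p' [q' ->]].
exists (\row_i Num.max (p ord0 i) (p' ord0 i)), (\row_i Num.min (q ord0 i) (q' ord0 i)).
apply/seteqP; split => x /=.
  move=> [h h'] i; rewrite !mxE gt_max lt_min.
  by have /andP[-> ->] := h i; have /andP[-> ->] := h' i.
by move=> h; split => i; have := h i; rewrite !mxE gt_max lt_min => /andP[/andP[? ?] /andP[? ?]]; apply/andP.
Qed.

Lemma obox_cover : \bigcup_n obox (\row_j (- n%:R)) (\row_j n%:R) = [set: V].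
Proof.
apply/seteqP; split => // x _.
have [n xn] : exists n : nat, enorm x < n%:R.
  by exists (Num.Def.archi_bound (enorm x)); exact: archi_boundP (enorm_ge0 _).
exists n => // j; rewrite !mxE; have := ler_coord_enorm x j; rewrite ler_norml => /andP[h1 h2].
by rewrite (le_lt_trans h2 xn) andbT (lt_le_trans _ h1)// ltrN2.
Qed.

(** Bounded open boxes form a pi-system generating the Borel sets. *)
Lemma borelV_measure_unique (mu nu : {measure set BV -> \bar R}) :
  (forall p q, mu (obox p q) = nu (obox p q)) ->
  (forall p q, (mu (obox p q) < +oo)%E) ->
  forall A, measurable A -> mu A = nu A.
Proof.
move=> e f A mA.
refine (@measure_unique _ R BV [set A | exists p q, A = obox p q]
  (fun n => obox (\row_j (- n%:R)) (\row_j n%:R)) _ _ _ _ mu nu _ _ A mA).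
- exact: borelV_generated_obox.
- exact: setI_closed_obox.
- by move=> n; exists (\row_j (- n%:R)), (\row_j n%:R).
- exact: obox_cover.
- by move=> _ [p [q ->]].
- by move=> n; exact: f.
Qed.

End borel_sets.

Section shrink_box.
Context {R : realType} {d : nat}.
Implicit Types (p q x : 'rV[R]_d) (e : R).

(** A box shrunk by the radius of a ball contains the centres of balls that stay
    inside the original box. *)
Definition shrunk_obox p q e : set 'rV[R]_d :=
  obox (\row_i (p ord0 i + e)) (\row_i (q ord0 i - e)).

Lemma measurable_shrunk_obox p q e : measurable (shrunk_obox p q e : set (borelV R d)).
Proof. exact: measurable_obox. Qed.

Lemma shrunk_oboxP p q e x :
  shrunk_obox p q e x <-> forall i, p ord0 i + e < x ord0 i < q ord0 i - e.
Proof. by split => h i; have := h i; rewrite !mxE. Qed.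

Lemma eball_sub_obox p q x e : shrunk_obox p q e x -> eball x e `<=` obox p q.
Proof.
move=> /shrunk_oboxP h y xy i; have /andP[h1 h2] := h i.
have := le_lt_trans (ler_coord_enorm (x - y) i) xy.
rewrite !mxE ltr_norml => /andP[h3 h4]; apply/andP; split; lra.
Qed.

Lemma obox_shrink_cvg (mu : {measure set (borelV R d) -> \bar R})
    (E : set (borelV R d)) p q : measurable E ->
  mu (E `&` shrunk_obox p q n.+1%:R^-1) @[n --> \oo] --> mu (E `&` obox p q).
Proof.
move=> mE.
pose F n := E `&` shrunk_obox p q n.+1%:R^-1.
have -> : E `&` obox p q = \bigcup_n F n.
  rewrite -setI_bigcupr; congr (_ `&` _); apply/seteqP; split => x; last first.
    move=> [n _ /shrunk_oboxP h] i; have /andP[h1 h2] := h i; apply/andP; split.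
      by apply: le_lt_trans h1; rewrite lerDl invr_ge0.
    by apply: lt_le_trans h2 _; rewrite gerBl invr_ge0.
  move=> pxq.
  pose e := \big[Num.min/1]_i (Num.min (x ord0 i - p ord0 i) (q ord0 i - x ord0 i)).
  have e0 : 0 < e.
    apply: lt_bigmin; first exact: ltr01.
    move=> i _.
    by rewrite lt_min !subr_gt0; exact: pxq.
  have [n _ /(_ n (leqnn n)) /= ne] := near_infty_natSinv_lt (PosNum e0).
  exists n => //; apply/shrunk_oboxP => i.
  have : n.+1%:R^-1 < Num.min (x ord0 i - p ord0 i) (q ord0 i - x ord0 i).
    by apply: lt_le_trans ne _; exact: bigmin_le_cond.
  move: (n.+1%:R^-1) => t; rewrite lt_min ltrBrDl ltrBrDr => /andP[-> h2].
  by rewrite ltrBrDr addrC.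
apply: nondecreasing_cvg_mu.
- by move=> n; apply: measurableI => //; exact: measurable_obox.
- by apply: bigcup_measurable => n _; apply: measurableI => //; exact: measurable_obox.
- move=> m n mn; apply/subsetPset => x [Ex /shrunk_oboxP h]; split => //.
  apply/shrunk_oboxP => i; have /andP[h1 h2] := h i.
  have le : n.+1%:R^-1 <= m.+1%:R^-1 :> R.
    by rewrite lef_pV2 ?posrE// ler_nat.
  move: (n.+1%:R^-1) (m.+1%:R^-1) le h1 h2 => s t le h1 h2.
  by apply/andP; split; lra.
Qed.

End shrink_box.

Section christensen.
Context {R : realType} {d : nat}.
Local Notation V := 'rV[R]_d.
Local Notation BV := (borelV R d).
Local Open Scope ereal_scope.

(** Both sides bound the product measure of the pairs of points at distance less
    than [r] with first point in [U'], computed in the two orders of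
    integration. *)
Lemma double_count_balls (mu nu : {sigma_finite_measure set BV -> \bar R})
    (E : set BV) (r : R) (g h : \bar R) (U U' : set BV) :
  measurable E -> measurable U -> measurable U' -> 0 <= g ->
  (forall x, E x -> mu (E `&` eball x r) <= g) ->
  (forall x, E x -> nu (E `&` eball x r) = h) ->
  (forall x, U' x -> eball x r `<=` U) ->
  h * mu (E `&` U') <= g * nu (E `&` U).
Proof.
move=> mE mU mU' g0 muE nuE U'U.
pose S : set (BV * BV) := ((E `&` U') `*` E) `&` [set z | eball z.1 r z.2].
have mS : measurable S.
  apply: measurableI; last exact: measurable_eball_rel.
  by apply: measurableX => //; exact: measurableI.
have := @fubini_tonelli _ _ _ _ _ mu nu (EFin \o \1_S).
have mf : measurable_fun setT (EFin \o (\1_S : BV * BV -> R)).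
  by apply/measurable_EFinP; exact: measurable_indic.
move=> /(_ mf (fun x => _)) FT.
have {}FT := FT (fun=> ltac:(by rewrite lee_fin)).
have sxy (x y : BV) : (EFin \o \1_S) (x, y) =
   (\1_(E `&` U') x)%:E * (\1_(E `&` eball x r) y)%:E :> \bar R.
  rewrite /= !indicE -EFinM -natrM mulnb; congr ((nat_of_bool _)%:R%:E).
  apply/idP/andP; rewrite !inE; first by move=> [[/= [? ?] ?] ?].
  by move=> [[? ?] [? ?]].
have syx (x y : BV) : (EFin \o \1_S) (x, y) =
   (\1_E y)%:E * (\1_(E `&` U' `&` eball y r) x)%:E :> \bar R.
  rewrite /= !indicE -EFinM -natrM mulnb; congr ((nat_of_bool _)%:R%:E).
  apply/idP/andP; rewrite !inE /eball/= enormB; first by move=> [[/= [? ?] ?] ?].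
  by move=> [? [[? ?] ?]].
have mEB (x : V) : measurable (E `&` eball x r : set BV).
  by apply: measurableI => //; exact: measurable_eball.
have mEUB (x : V) : measurable (E `&` U' `&` eball x r : set BV).
  by apply: measurableI; [exact: measurableI|exact: measurable_eball].
have mEU' : measurable (E `&` U') by exact: measurableI.
have mEU : measurable (E `&` U) by exact: measurableI.
have indic_ge0 (A : set BV) x : 0 <= (\1_A x)%:E :> \bar R by rewrite lee_fin.
have mindic (A : set BV) : measurable A ->
    measurable_fun setT (fun x => (\1_A x)%:E : \bar R).
  by move=> mA; apply/measurable_EFinP; exact: measurable_indic.
have inner (m : {measure set BV -> \bar R}) (A : set BV) (c : R) :
    (0 <= c)%R -> measurable A -> \int[m]_x (c%:E * (\1_A x)%:E) = c%:E * m A.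
  move=> c0 mA; rewrite ge0_integralZl_EFin//; last exact: mindic.
  by rewrite integral_indic// setIT.
have EU : \int[mu]_x \int[nu]_y (EFin \o \1_S) (x, y) = h * mu (E `&` U').
  transitivity (\int[mu]_x (h * (\1_(E `&` U') x)%:E)); last first.
    have [->|/set0P[x0 [Ex0 _]]] := eqVneq (E `&` U') set0.
      rewrite measure0 mule0; apply: integral0_eq => x _.
      by rewrite indicE in_set0 mule0.
    rewrite ge0_integralZl//; [|exact: mindic|by rewrite -(nuE _ Ex0)].
    by rewrite integral_indic// setIT.
  apply: eq_integral => x _; under eq_integral do rewrite sxy.
  rewrite inner// muleC indicE; case: (boolP (x \in E `&` U')) => [|_].
    by rewrite inE => -[Ex _]; congr (_ * _); exact: nuE.
  by rewrite !mule0.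
rewrite -EU FT.
have -> : g * nu (E `&` U) = \int[nu]_y (g * (\1_(E `&` U) y)%:E).
  rewrite ge0_integralZl//; last exact: mindic.
  by rewrite integral_indic// setIT.
apply: ge0_le_integral => //.
- by move=> y _; apply: integral_ge0 => x _; rewrite lee_fin.
- by apply: measurable_fun_fubini_tonelli_G => // z; rewrite lee_fin.
- by apply: measurable_funeM; exact: mindic.
move=> y _; under eq_integral do rewrite syx.
rewrite inner// [in leLHS]indicE; case: (boolP (y \in E)) => [|_]; last first.
  by rewrite mul0e mule_ge0.
rewrite inE mul1e => Ey.
have [-> |/set0P[x [[Ex U'x] xy]]] := eqVneq (E `&` U' `&` eball y r) set0.
  by rewrite measure0 mule_ge0.
rewrite indicE mem_set ?mule1.
  apply: le_trans (muE _ Ey); apply: le_measure; rewrite ?inE//.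
  by move=> z [[]].
by split => //; apply: U'U U'x _ _; rewrite /eball/= enormB.
Qed.

(** Christensen's argument: two measures for which the mass of a ball centred in
    [E] depends on the radius only are proportional on [E].  Counting pairs at
    distance less than [r] compares the masses of a box and of the box shrunk by
    [r], and [r] is sent to 0. *)
Lemma uniformly_distributed_proportional
    (mu nu : {sigma_finite_measure set BV -> \bar R})
    (E : set BV) (g : R -> R) (c : R) :
  measurable E -> (0 <= c)%R -> (forall r, 0 < r -> 0 < g r)%R ->
  (forall x r, E x -> (0 < r)%R -> mu (E `&` eball x r) = (g r)%:E) ->
  (forall x r, E x -> (0 < r)%R -> nu (E `&` eball x r) = (c * g r)%:E) ->
  (forall p q, mu (obox p q) < +oo) ->
  forall A : set BV, measurable A -> nu (E `&` A) = c%:E * mu (E `&` A).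
Proof.
move=> mE c0 g0 muE nuE muoo.
have fin (A : set BV) : measurable A -> forall p q, mu (A `&` obox p q) < +oo.
  move=> mA p q; apply: le_lt_trans (muoo p q); apply: le_measure; rewrite ?inE//.
  - by apply: measurableI => //; exact: measurable_obox.
  - exact: measurable_obox.
have gr0 n : (0 < g n.+1%:R^-1)%R by apply: g0; rewrite invr_gt0.
have r0 n : (0 < n.+1%:R^-1 :> R)%R by rewrite invr_gt0.
have box p q : nu (E `&` obox p q) = c%:E * mu (E `&` obox p q).
  apply/eqP; rewrite eq_le; apply/andP; split.
    have cv := obox_shrink_cvg (mu := nu) (p := p) (q := q) mE.
    refine (cvge_le _ cv).
    apply: nearW => n.
    have := @double_count_balls nu mu E n.+1%:R^-1 (c * g n.+1%:R^-1)%:E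
      (g n.+1%:R^-1)%:E (obox p q) (shrunk_obox p q n.+1%:R^-1) mE
      (measurable_obox p q) (measurable_shrunk_obox p q _).
    rewrite mulrC EFinM -muleA lee_pmul2l//; last by rewrite lte_fin.
    move=> h; apply: h.
    - by rewrite mule_ge0// lee_fin ltW.
    - by move=> x Ex; rewrite nuE// mulrC EFinM.
    - by move=> x Ex; rewrite muE.
    - by move=> x; exact: eball_sub_obox.
  have cv := cvgeZl (y := c%:E) isT (obox_shrink_cvg (mu := mu) (p := p) (q := q) mE).
  refine (cvge_le _ cv).
  apply: nearW => n.
  have := @double_count_balls mu nu E n.+1%:R^-1 (g n.+1%:R^-1)%:E
      (c * g n.+1%:R^-1)%:E (obox p q) (shrunk_obox p q n.+1%:R^-1) mE
      (measurable_obox p q) (measurable_shrunk_obox p q _).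
  rewrite mulrC EFinM -muleA lee_pmul2l//; last by rewrite lte_fin.
    move=> h; apply: h.
  - by rewrite lee_fin ltW.
  - by move=> x Ex; rewrite muE.
  - by move=> x Ex; rewrite nuE// mulrC EFinM.
  - by move=> x; exact: eball_sub_obox.
move=> A mA.
transitivity (mrestr nu mE A); first by rewrite /mrestr setIC.
transitivity (mscale (NngNum c0) (mrestr mu mE) A); last first.
  by rewrite /mscale /mrestr/= setIC.
apply: borelV_measure_unique => // p q.
  rewrite [LHS](_ : _ = nu (E `&` obox p q)); last by rewrite /= /mrestr setIC.
  by rewrite box /= /mscale /mrestr setIC.
rewrite [X in X < _](_ : _ = nu (E `&` obox p q)); last by rewrite /= /mrestr setIC.
by rewrite box lte_mul_pinfty//; exact: fin.
Qed.

End christensen.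

(** * Reflections and the cone measure of the sphere *)

Section image_measure.
Context d1 d2 (T1 : measurableType d1) (T2 : measurableType d2) (R : realType).
Variables (m : {measure set T1 -> \bar R}) (f : T1 -> T2).

(** The push-forward together with its sigma-finiteness, bundled so that it can be
    used in the Fubini-Tonelli theorem. *)
Definition image_measure (_ : measurable_fun [set: T1] f)
    (_ : sigma_finite [set: T2] (pushforward m f)) : set T2 -> \bar R :=
  pushforward m f.

Hypotheses (mf : measurable_fun [set: T1] f)
  (sf : sigma_finite [set: T2] (pushforward m f)).

Let pushm := measure_function_pushforward__canonical__measure_function_Measure m mf.

HB.instance Definition _ := isMeasure.Build _ _ _ (image_measure mf sf)
  (measure0 pushm) (measure_ge0 pushm) (@measure_semi_sigma_additive _ _ _ pushm).

HB.instance Definition _ := Measure_isSigmaFinite.Build _ _ _ (image_measure mf sf) sf.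

Lemma ge0_integral_image_measure (h : T2 -> \bar R) :
  measurable_fun [set: T2] h -> (forall y, 0 <= h y)%E ->
  (\int[image_measure mf sf]_y h y = \int[m]_x h (f x))%E.
Proof.
move=> mh h0.
have := ge0_integral_pushforward mf m measurableT mh (fun y _ => h0 y).
by rewrite preimage_setT => <-; exact: eq_measure_integral.
Qed.

End image_measure.

Section sigma_finite_balls.
Context {R : realType} {d : nat}.
Local Notation BV := (borelV R d).

Lemma eball_cover : \bigcup_n eball (0 : 'rV[R]_d) n%:R = [set: 'rV[R]_d].
Proof.
apply/seteqP; split => // x _.
exists (Num.Def.archi_bound (enorm x)) => //.
by rewrite /eball/= sub0r enormN; exact: archi_boundP (enorm_ge0 _).
Qed.

Lemma sigma_finite_eball (mu : set BV -> \bar R) :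
  (forall n : nat, (mu (eball 0 n%:R) < +oo)%E) -> sigma_finite [set: BV] mu.
Proof.
move=> muoo; exists (fun n => eball (0 : 'rV[R]_d) n%:R); first by rewrite eball_cover.
by move=> n; split => //; exact: measurable_eball.
Qed.

End sigma_finite_balls.

Section lebB.
Context {R : realType} {d : nat}.
Local Notation V := 'rV[R]_d.
Local Notation BV := (borelV R d).
Implicit Types x y : V.

Lemma measurable_id_lebesgue :
  measurable_fun [set: lebesgue_type R d] (id : lebesgue_type R d -> BV).
Proof. by move=> _ A mA; rewrite setTI; exact: measurable_lebesgue. Qed.

Lemma lebesgue_box_le (ab : V * V) : (lebesgue_outer (box ab) <= box_volume ab)%E.
Proof.
apply: ereal_inf_lbound; exists (fun k => if k == 0%N then Some ab else None).
  by move=> x xab; exists 0%N.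
rewrite (@nneseriesD1 _ _ 0)//=; last first.
  by move=> k _; case: ifPn => //= _; exact: box_volume_ge0.
by rewrite eseries0 ?adde0// => k _ /negbTE ->.
Qed.

Lemma lebesgue_eball_lty x (r : R) : (lebesgue_outer (eball x r) < +oo)%E.
Proof.
apply: (@le_lt_trans _ _ (lebesgue_outer
   (box (\row_i (x ord0 i - r), \row_i (x ord0 i + r))))); last first.
  by apply: le_lt_trans (lebesgue_box_le _) _; rewrite ltry.
apply: le_cover_outer => y xy i /=; rewrite !mxE.
have := le_lt_trans (ler_coord_enorm (x - y) i) xy.
by rewrite !mxE ltr_norml => /andP[h3 h4]; apply/andP; split; lra.
Qed.

Lemma lebB_sigma_finite :
  sigma_finite [set: BV] (pushforward (lebesgue_Rd R d) (id : lebesgue_type R d -> BV)).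
Proof. by apply: sigma_finite_eball => n; exact: lebesgue_eball_lty. Qed.

(** Lebesgue measure restricted to the Borel sets; on this space, unlike on the
    Caratheodory completion, product measures can be formed. *)
Definition lebB := image_measure measurable_id_lebesgue lebB_sigma_finite.
HB.instance Definition _ := SigmaFiniteMeasure.on lebB.

Lemma lebBE (A : set BV) : lebB A = lebesgue_outer A. Proof. by []. Qed.

Lemma lebB_eball_fin x r : lebB (eball x r) \is a fin_num.
Proof.
by rewrite ge0_fin_numE ?measure_ge0//; exact: lebesgue_eball_lty.
Qed.

Definition unit_ball_volume : R := fine (lebB (eball 0 1)).

(** By translation and dilation the volume of a ball is determined by that of the
    unit ball. *)
Lemma lebB_eball x (r : R) : 0 < r ->
  lebB (eball x r) = (r ^+ d * unit_ball_volume)%:E.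
Proof.
move=> r0; rewrite EFinM fineK ?lebB_eball_fin// !lebBE.
rewrite -[X in (X ^+ d)%:E](invrK r) -lebesgue_scale ?invr_gt0//.
rewrite -(lebesgue_translate x); congr lebesgue_outer.
apply/seteqP; split => y; rewrite /eball /= !sub0r !enormN enormZ;
  rewrite ger0_norm ?invr_ge0 ?(ltW r0)// mulrC ltr_pdivrMr// mul1r;
  by rewrite opprD addrCA subrr addr0 enormN.
Qed.

Lemma unit_ball_volume_gt0 : 0 < unit_ball_volume.
Proof.
have d0 : 0 < d.+1%:R + 1 :> R by rewrite ltr_wpDl.
suff : (1 <= lebB (eball 0 (d.+1%:R + 1)))%E.
  rewrite lebB_eball// lee_fin => h; rewrite -(pmulr_rgt0 _ (exprn_gt0 d d0)).
  exact: lt_le_trans h.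
apply: le_trans (@lebesgue_unit_cube R d) _; apply: le_cover_outer => x x1.
rewrite /eball/= sub0r enormN (le_lt_trans (enorm_le_coord (m := 1) _ _))//.
  by move=> i; have /andP[h1 h2] := x1 i; rewrite ger0_norm// ltW.
by rewrite mulr1 -natr1 -addrA ltrDl addr_gt0.
Qed.

Lemma lebB_obox_lty p q : (lebB (obox p q) < +oo)%E.
Proof.
apply: (@le_lt_trans _ _ (lebesgue_outer (box (p, q)))).
  by apply: le_cover_outer => x h i; have /andP[-> /ltW ->] := h i.
by apply: le_lt_trans (lebesgue_box_le _) _; rewrite ltry.
Qed.

Lemma lebB_translate y (A : set V) : lebB [set x | A (x + y)] = lebB A.
Proof. exact: lebesgue_translate. Qed.

Lemma lebB_scale (c : R) (A : set V) : 0 < c ->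
  lebB [set x | A (c *: x)] = ((c^-1 ^+ d)%:E * lebB A)%E.
Proof. exact: lebesgue_scale. Qed.

End lebB.
Arguments lebB : clear implicits.
Arguments unit_ball_volume : clear implicits.

Section reflection.
Context {R : realType} {d : nat}.
Local Notation V := 'rV[R]_d.
Local Notation BV := (borelV R d).
Implicit Types x y n p q : V.

Definition dotp x y : R := \sum_(i < d) x ord0 i * y ord0 i.

Lemma dotpxx x : dotp x x = enorm x ^+ 2.
Proof. by rewrite sqr_enorm; apply: eq_bigr => i _; rewrite expr2. Qed.

Lemma dotpC x y : dotp x y = dotp y x.
Proof. by apply: eq_bigr => i _; rewrite mulrC. Qed.

Lemma dotpDl x y n : dotp (x + y) n = dotp x n + dotp y n.
Proof. by rewrite -big_split/=; apply: eq_bigr => i _; rewrite mxE mulrDl. Qed.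

Lemma dotpZl (c : R) x n : dotp (c *: x) n = c * dotp x n.
Proof. by rewrite mulr_sumr; apply: eq_bigr => i _; rewrite mxE mulrA. Qed.

Lemma dotpNl x n : dotp (- x) n = - dotp x n.
Proof. by rewrite -scaleN1r dotpZl mulN1r. Qed.

Lemma enormD2 x y : enorm (x + y) ^+ 2 = enorm x ^+ 2 + 2 * dotp x y + enorm y ^+ 2.
Proof.
rewrite -!dotpxx dotpDl ![dotp _ (x + y)]dotpC !dotpDl (dotpC y x); ring.
Qed.

(** The reflection in the hyperplane orthogonal to [n].  Reflections are enough
    to move any point of the unit sphere to any other one, so that the full
    orthogonal group is not needed. *)
Definition reflection n x : V := x - (2 * dotp x n / enorm n ^+ 2) *: n.

Lemma reflectionB n x y : reflection n (x - y) = reflection n x - reflection n y.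
Proof.
rewrite /reflection dotpDl dotpNl mulrDr mulrDl scalerDl mulrN mulNr scaleNr.
by rewrite !opprB addrACA [RHS]addrACA [X in _ + X = _]addrC.
Qed.

Lemma reflectionZ n (c : R) x : reflection n (c *: x) = c *: reflection n x.
Proof.
rewrite /reflection dotpZl scalerBr scalerA; congr (_ - _ *: _).
by rewrite !mulrA (mulrC c).
Qed.

Lemma enorm_reflection n x : enorm (reflection n x) = enorm x.
Proof.
apply/eqP; rewrite -(@eqrXn2 _ 2)// ?enorm_ge0//; apply/eqP.
rewrite /reflection -scaleNr enormD2 enormZ exprMn real_normK ?num_real//.
rewrite dotpC dotpZl dotpC.
have [->|n0] := eqVneq n 0.
  by rewrite enorm0 expr0n/= !(invr0, mulr0, oppr0, mul0r, addr0).
have : enorm n != 0 by rewrite enorm_eq0.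
by move=> ?; field.
Qed.

Lemma reflection_dist n x y :
  enorm (reflection n x - reflection n y) = enorm (x - y).
Proof. by rewrite -reflectionB enorm_reflection. Qed.

Lemma reflectionK n : involutive (reflection n).
Proof.
move=> x; rewrite {1}/reflection.
have -> : dotp (reflection n x) n = - dotp x n.
  rewrite /reflection dotpDl dotpNl dotpZl dotpxx.
  have [->|n0] := eqVneq n 0.
    by rewrite dotpC -(scale0r 0) dotpZl !(mul0r, mulr0) oppr0 addr0.
  have : enorm n != 0 by rewrite enorm_eq0.
  by move=> ?; field.
by rewrite mulrN mulNr scaleNr opprK subrK.
Qed.

Lemma reflection_swap p q : enorm p = enorm q -> reflection (p - q) p = q.
Proof.
move=> pq; have [/eqP|n0] := eqVneq (p - q) 0.
  by rewrite subr_eq0 => /eqP <-; rewrite /reflection subrr scaler0 subr0.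
rewrite /reflection (_ : _ / _ = 1) ?scale1r ?subKr//.
have e : enorm (p - q) ^+ 2 = 2 * dotp p (p - q).
  rewrite -dotpxx dotpDl dotpNl ![dotp _ (p - q)]dotpC !dotpDl !dotpNl.
  by rewrite !dotpxx pq (dotpC q p); ring.
by rewrite -e divff// expf_neq0// enorm_eq0.
Qed.

Lemma measurable_reflection n :
  measurable_fun [set: BV] (reflection n : BV -> BV).
Proof.
apply: measurable_to_borelV => i.
rewrite (_ : (fun _ => _) = (fun x : BV => x ord0 i -
    (2 * dotp x n / enorm n ^+ 2) * n ord0 i)); last first.
  by apply/funext => x; rewrite !mxE.
apply: measurable_funB; first exact: measurable_coord.
do 3! apply: measurable_funM => //.
by apply: measurable_sum => j; apply: measurable_funM => //; exact: measurable_coord.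
Qed.

Lemma preimage_reflection_eball n x (r : R) :
  reflection n @^-1` eball x r = eball (reflection n x) r.
Proof.
by apply/seteqP; split => y; rewrite /eball/= -(reflection_dist n) reflectionK.
Qed.

(** The image of Lebesgue measure gives the same mass to every ball as Lebesgue
    measure, hence equals it by Christensen's argument. *)
Lemma lebB_reflection n (A : set BV) : measurable A ->
  lebB R d (reflection n @^-1` A) = lebB R d A.
Proof.
move=> mA.
have sf : sigma_finite [set: BV] (pushforward (lebB R d) (reflection n : BV -> BV)).
  apply: sigma_finite_eball => l.
  by rewrite /pushforward preimage_reflection_eball lebesgue_eball_lty.
have := @uniformly_distributed_proportional R d (lebB R d)
  (image_measure (measurable_reflection n) sf) setT (fun r => r ^+ d * unit_ball_volume R d) 1.
move=> /(_ measurableT ler01) h; have {h} := h _ _ _ _ A mA.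
rewrite !setTI mul1e; apply.
- by move=> r r0; rewrite mulr_gt0 ?exprn_gt0// unit_ball_volume_gt0.
- by move=> x r _ r0; rewrite setTI; exact: lebB_eball.
- move=> x r _ r0; rewrite setTI mul1r.
  transitivity (lebB R d (eball (reflection n x) r)); last exact: lebB_eball.
  by rewrite -preimage_reflection_eball.
- by move=> x y; exact: lebB_obox_lty.
Qed.

End reflection.

Lemma measurable_invr {R : realType} : measurable_fun [set: R] (@GRing.inv R).
Proof.
have -> : [set: R] = ~` [set 0] `|` [set 0] by rewrite setUC setUv.
apply/measurable_funU; [exact: measurableC|exact: measurable_set1|].
split; last exact: measurable_fun_set1.
apply: open_continuous_measurable_fun.
  by apply: closed_openC; exact: closed_eq.
by move=> x; rewrite inE => /eqP x0; exact: inv_continuous.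
Qed.

Section cone_measure.
Context {R : realType} {d : nat}.
Local Notation V := 'rV[R]_d.
Local Notation BV := (borelV R d).
Local Notation S := (@unit_sphere R d).
Local Notation lam := (lebB R d).
Implicit Types x y w : V.
Local Open Scope ereal_scope.

Definition direction y : V := (enorm y)^-1%R *: y.

Lemma measurable_direction : measurable_fun [set: BV] (direction : BV -> BV).
Proof.
apply: measurable_to_borelV => i.
rewrite (_ : (fun _ => _) = (fun y : BV => (enorm y)^-1 * y ord0 i)%R); last first.
  by apply/funext => y; rewrite mxE.
apply: measurable_funM; last exact: measurable_coord.
exact: (measurableT_comp measurable_invr measurable_enorm).
Qed.

Lemma enorm_direction y : y != 0%R -> enorm (direction y) = 1%R.
Proof.
move=> y0; rewrite enormZ ger0_norm ?invr_ge0 ?enorm_ge0// mulVf//.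
by rewrite enorm_eq0.
Qed.

Lemma directionZ (c : R) y : (0 < c)%R -> direction (c *: y) = direction y.
Proof.
move=> c0; rewrite /direction enormZ scalerA gtr0_norm// invfM -mulrA mulrCA mulrA.
by rewrite mulfVK// gt_eqF.
Qed.

Lemma enorm_scale_direction y : y = enorm y *: direction y.
Proof.
have [->|y0] := eqVneq y 0%R; first by rewrite enorm0 scale0r.
by rewrite /direction scalerA divff ?scale1r// enorm_eq0.
Qed.

Lemma measurable_enorm_preimage (A : set R) : measurable A ->
  measurable ((@enorm R d) @^-1` A : set BV).
Proof. by move=> mA; rewrite -[X in measurable X]setTI; exact: measurable_enorm. Qed.

Definition shell (r s : R) : set BV := (@enorm R d) @^-1` `]r, s[.

Lemma measurable_shell r s : measurable (shell r s).
Proof. by apply: measurable_enorm_preimage; exact: measurable_itv. Qed.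

Lemma measurable_sphere : measurable (S : set BV).
Proof. by apply: (measurable_enorm_preimage (A := [set 1%R])); exact: measurable_set1. Qed.

Lemma cone_sigma_finite : sigma_finite [set: BV]
  (pushforward (mrestr lam (measurable_shell 0 1)) (direction : BV -> BV)).
Proof.
apply: sigma_finite_eball => n; rewrite /pushforward/= /mrestr.
apply: le_lt_trans (lebesgue_eball_lty (0 : V) 1); apply: le_cover_outer => y [_].
by rewrite /shell /eball /= in_itv/= sub0r enormN => /andP[].
Qed.

(** The surface measure of the sphere up to a factor: the mass of a set of
    directions is the volume of the part of the unit ball seen in these
    directions. *)
Definition cone_measure := image_measure measurable_direction cone_sigma_finite.
HB.instance Definition _ := SigmaFiniteMeasure.on cone_measure.

Lemma cone_measureE (A : set BV) :
  cone_measure A = lam ((direction @^-1` A) `&` shell 0 1).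
Proof. by []. Qed.

Lemma cone_measure_lty (A : set BV) : measurable A -> cone_measure A < +oo.
Proof.
move=> mA; apply: le_lt_trans (lebesgue_eball_lty (0 : V) 1).
rewrite cone_measureE; apply: le_cover_outer => y [_].
by rewrite /shell /eball /= in_itv/= sub0r enormN => /andP[].
Qed.

Lemma lebB_cone (r : R) (A : set BV) : (0 < r)%R ->
  lam ((direction @^-1` A) `&` shell 0 r) = (r ^+ d)%:E * cone_measure A.
Proof.
move=> r0; rewrite cone_measureE -[X in (X ^+ d)%:E](invrK r) -lebB_scale ?invr_gt0//.
congr (lam _); apply/seteqP; split => y; rewrite /shell/= !in_itv/=.
  rewrite directionZ ?invr_gt0// enormZ gtr0_norm ?invr_gt0// => -[? /andP[? ?]].
  by split => //; rewrite mulr_gt0 ?invr_gt0// mulrC ltr_pdivrMr ?mul1r.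
rewrite directionZ ?invr_gt0// enormZ gtr0_norm ?invr_gt0// => -[? /andP[h1 h2]].
split => //; move: h1 h2; rewrite pmulr_rgt0 ?invr_gt0// => ->.
by rewrite mulrC ltr_pdivrMr ?mul1r.
Qed.

(** The cone over [A] up to radius [s] consists of the cone up to [r] and a part
    of the shell between the two radii. *)
Lemma lebB_shell_cone (r s : R) (A : set BV) : measurable A -> (0 < r < s)%R ->
  (s ^+ d)%:E * cone_measure A <=
  lam ((direction @^-1` A) `&` [set y | (r <= enorm y < s)%R]) + (r ^+ d)%:E * cone_measure A.
Proof.
move=> mA /andP[r0 rs]; rewrite -!lebB_cone//; last exact: lt_trans rs.
have mdA : measurable (direction @^-1` A : set BV).
  by rewrite -[X in measurable X]setTI; exact: measurable_direction.
have m2 : measurable ([set y | (r <= enorm y < s)%R] : set BV).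
  rewrite (_ : [set _ | _] = (@enorm R d) @^-1` `[r, s[).
    by apply: measurable_enorm_preimage; exact: measurable_itv.
  by apply/seteqP; split => y; rewrite /= in_itv.
rewrite -measureU//=.
- apply: le_cover_outer => y [dy]; rewrite /shell/= !in_itv/= => /andP[y0 ys].
  have [ry|yr] := leP r (enorm y); [left|right]; split => //=.
    by rewrite andbT.
- exact: measurableI.
- by apply: measurableI => //; exact: measurable_shell.
- apply/seteqP; split => y //= [[_ /andP[h1 _]] [_]].
  by rewrite /shell/= in_itv/= => /andP[_]; rewrite ltNge h1.
Qed.

Lemma cone_measure_reflection n (A : set BV) : measurable A ->
  cone_measure (reflection n @^-1` A) = cone_measure A.
Proof.
move=> mA; rewrite !cone_measureE -[RHS](lebB_reflection n); last first.
  apply: measurableI; last exact: measurable_shell.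
  by rewrite -[X in measurable X]setTI; exact: measurable_direction.
congr (lam _); apply/seteqP; split => y; rewrite /shell/= !in_itv/=.
  by rewrite /direction reflectionZ enorm_reflection.
by rewrite /direction reflectionZ enorm_reflection.
Qed.

(** A reflection exchanges the two centres. *)
Lemma cone_measure_eball_eq w w' r : S w -> S w' ->
  cone_measure (S `&` eball w r) = cone_measure (S `&` eball w' r).
Proof.
move=> Sw Sw'; rewrite -[RHS](cone_measure_reflection (w - w')); last first.
  by apply: measurableI; [exact: measurable_sphere|exact: measurable_eball].
have e : reflection (w - w') w = w' by apply: reflection_swap; rewrite Sw Sw'.
have {}e : reflection (w - w') w' = w by rewrite -[X in reflection _ X = _]e reflectionK.
rewrite preimage_setI preimage_reflection_eball e; congr (cone_measure (_ `&` _)).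
by apply/seteqP; split => y; rewrite /unit_sphere/= enorm_reflection.
Qed.

Lemma cone_measure_sphereC (A : set BV) : measurable A ->
  cone_measure (S `&` A) = cone_measure A.
Proof.
move=> mA; rewrite !cone_measureE; congr (lam _).
apply/seteqP; split => y; first by move=> [[]].
move=> [dA]; rewrite {1}/shell/= in_itv/= => /andP[y0 y1].
split; last by rewrite /shell/= in_itv/= y0.
by split => //; apply: enorm_direction; rewrite -enorm_eq0 gt_eqF.
Qed.

(** The part of the cone over a small ball that lies between the radii [1] and
    [1 + r] is contained in a ball of radius [2 * r]; the extra power of [r] is
    the thickness of this shell. *)
Lemma cone_measure_eball_le w (r : R) : S w -> (0 < r <= 1)%R -> (0 < d)%N ->
  cone_measure (S `&` eball w r) <= (2 ^+ d * unit_ball_volume R d * r ^+ d.-1)%:E.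
Proof.
move=> Sw /andP[r0 r1] d0.
have mA : measurable (S `&` eball w r : set BV).
  by apply: measurableI; [exact: measurable_sphere|exact: measurable_eball].
have h1 : (0 < (1 : R) < 1 + r)%R by rewrite ltr01 ltrDl.
have := lebB_shell_cone mA h1; rewrite expr1n mul1e.
have fc : cone_measure (S `&` eball w r) \is a fin_num.
  by rewrite ge0_fin_numE ?measure_ge0// cone_measure_lty.
rewrite -(fineK fc); have := fine_ge0 (measure_ge0 cone_measure (S `&` eball w r)).
move: (fine _) => c c0.
have le2 : lam ((direction @^-1` (S `&` eball w r)) `&`
    [set y | (1 <= enorm y < 1 + r)%R]) <= ((2 * r) ^+ d * unit_ball_volume R d)%:E.
  rewrite -(lebB_eball w) ?mulr_gt0//; apply: le_cover_outer => y [[_ wy] /andP[y1 yr]].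
  rewrite /eball/=; apply: le_lt_trans (ler_enorm_dist w (direction y) y) _.
  rewrite mulrDl !mul1r; apply: ltr_leD => //.
  rewrite {2}(enorm_scale_direction y) -{1}(scale1r (direction y)) -scalerBl enormZ.
  rewrite enorm_direction ?mulr1; last by rewrite -enorm_eq0 gt_eqF// (lt_le_trans ltr01).
  by rewrite ler0_norm ?subr_le0// opprB lerBlDl ltW.
move=> /le_trans /(_ (leeD2r _ le2)); rewrite -EFinM -EFinD !lee_fin => h.
have c_r : (c * r <= (2 * r) ^+ d * unit_ball_volume R d)%R.
  have : (1 + r <= (1 + r) ^+ d)%R by rewrite ler_eXnr// lerDl ltW.
  move/(ler_wpM2r c0); nra.
rewrite -(ler_pM2r r0); apply: le_trans c_r _.
by rewrite exprMn -[leRHS]mulrA -exprSr prednK// mulrAC.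
Qed.

Lemma cone_measure_eball_gt0 w (r : R) : S w -> (0 < r)%R ->
  0 < cone_measure (S `&` eball w r).
Proof.
move=> Sw r0; pose e := (Num.min (4^-1) (r / 8))%R.
have e0 : (0 < e)%R by rewrite lt_min divr_gt0// invr_gt0 !ltr0n.
have [e4 er] : (e <= 4^-1 /\ e <= r / 8)%R.
  by split; rewrite /e ge_min lexx ?orbT.
have : 0 < lam (eball (2^-1 *: w)%R e).
  by rewrite lebB_eball// lte_fin mulr_gt0 ?exprn_gt0// unit_ball_volume_gt0.
move=> /lt_le_trans; apply; rewrite cone_measureE; apply: le_cover_outer => y.
rewrite /eball/= => wy.
have hw : enorm (2^-1 *: w)%R = 2^-1%R by rewrite enormZ Sw mulr1 ger0_norm.
have := le_lt_trans (ler_dist_enorm _ _) wy; rewrite hw ltr_norml => /andP[h1 h2].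
have y4 : (4^-1 < enorm y)%R by lra.
have y0 : (0 < enorm y)%R by lra.
split; last by rewrite /shell/= in_itv/= y0/=; lra.
split; first by apply: enorm_direction; rewrite -enorm_eq0 gt_eqF.
rewrite /eball/=.
have -> : (w - direction y = (enorm y)^-1 *: ((enorm y - 2^-1) *: w + (2^-1 *: w - y)))%R.
  rewrite addrA -scalerDl subrK scalerBr scalerA mulVf ?scale1r// gt_eqF//.
rewrite enormZ ger0_norm ?invr_ge0 ?(ltW y0)// mulrC ltr_pdivrMr//.
apply: le_lt_trans (ler_enormD _ _) _; rewrite enormZ Sw mulr1.
have : (`|enorm y - 2^-1| < e)%R by rewrite ltr_norml; apply/andP; split; lra.
have : (r * 4^-1 < r * enorm y)%R by rewrite ltr_pM2l.
lra.
Qed.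

End cone_measure.

(** * Hausdorff measure of the sphere *)

Section hausdorff_metric.
Context {R : realType} {d s : nat}.
Local Notation V := 'rV[R]_d.
Local Notation H := (@hausdorff_outer R d s).
Implicit Types (x y : V) (A B X U : set V).
Local Open Scope ereal_scope.

Lemma enorm_le_diam U x y : U x -> U y -> (enorm (x - y))%:E <= diam U.
Proof.
move=> Ux Uy; rewrite le_max; apply/orP; right.
by apply: ereal_sup_ubound; exists (x, y).
Qed.

Lemma diam_le U (r : R) : (0 <= r)%R ->
  (forall x y, U x -> U y -> enorm (x - y) <= r)%R -> diam U <= r%:E.
Proof.
move=> r0 h; rewrite ge_max lee_fin r0/=; apply: ge_ereal_sup => _ [[x y] [/= Ux Uy] <-].
by rewrite lee_fin; exact: h.
Qed.

Lemma diam_ge0 U : 0 <= diam U.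
Proof. by rewrite le_max lexx. Qed.

Lemma hausdorff_delta_le (e f : R) X : (e <= f)%R ->
  @hausdorff_delta R d s f X <= @hausdorff_delta R d s e X.
Proof.
move=> ef; rewrite -[leRHS]mul1e; apply: (le_cover_outer_image (psi := idfun)) => //.
- by move=> U; exact: diam_expe_ge0.
- by move=> U; exact: diam_expe_ge0.
move=> [U Ue]; have Uf : diam U <= f%:E by apply: le_trans Ue _; rewrite lee_fin.
by exists (exist _ U Uf); split => //=; rewrite mul1e.
Qed.

Lemma hausdorff_delta_le_outer (e : R) X : (0 < e)%R ->
  @hausdorff_delta R d s e X <= H X.
Proof. by move=> e0; apply: ereal_sup_ubound; exists e. Qed.

Lemma hausdorff_delta_ge0 (e : R) X : 0 <= @hausdorff_delta R d s e X.
Proof. by apply: cover_outer_ge0 => U; exact: diam_expe_ge0. Qed.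

(** A set of diameter less than the distance of [A] and [B] cannot meet both,
    so a fine cover of the union splits into covers of the two parts. *)
Lemma hausdorff_delta_separated (e f : R) A B : (e < f)%R ->
  (forall x y, A x -> B y -> f <= enorm (x - y))%R ->
  @hausdorff_delta R d s e A + @hausdorff_delta R d s e B <=
  @hausdorff_delta R d s e (A `|` B).
Proof.
move=> ef AB; apply: le_ereal_inf_tmp => _ [F ABF <-].
pose meets X (o : option {U : set V | diam U <= e%:E}) :=
  if o is Some U then if `[< exists x, X x /\ sval U x >] then o else None else None.
pose wt (o : option {U : set V | diam U <= e%:E}) := oapp (fun U : {U : set V | diam U <= e%:E} => diam (sval U) ^+ s) 0 o.
have wt0 o : 0 <= wt o by case: o => //= U; exact: diam_expe_ge0.
have le_delta X : X `<=` \bigcup_k oapp sval set0 (F k) ->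
    @hausdorff_delta R d s e X <= \sum_(k <oo) wt (meets X (F k)).
  move=> XF; apply: ereal_inf_lbound; exists (meets X \o F) => // x Xx.
  have [n _ Fx] := XF _ Xx; exists n => //=; move: Fx; case: (F n) => //= U Ux.
  by case: ifPn => // /asboolPn nx; exfalso; apply: nx; exists x.
apply: (@le_trans _ _ (\sum_(k <oo) wt (meets A (F k)) + \sum_(k <oo) wt (meets B (F k)))).
  by apply: leeD; apply: le_delta; apply: subset_trans ABF; [left|right].
rewrite -nneseriesD//; apply: lee_nneseries => [k _ _|k _]; first exact: adde_ge0.
case: (F k) => [[U Ue]|] /=; last by rewrite adde0.
have dU0 : 0 <= diam U ^+ s by exact/expe_ge0/diam_ge0.
case: ifPn => [/asboolP[x [Ax Ux]]|_]; last by rewrite add0e; case: ifPn.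
case: ifPn => [/asboolP[y [By Uy]]|_]; last by rewrite adde0.
have := le_trans (enorm_le_diam Ux Uy) Ue; rewrite lee_fin leNgt.
by rewrite (lt_le_trans ef (AB _ _ Ax By)).
Qed.

(** Hausdorff outer measure is a metric outer measure. *)
Lemma hausdorff_separated (f : R) A B X : (0 < f)%R ->
  (forall x y, A x -> B y -> f <= enorm (x - y))%R -> A `|` B `<=` X ->
  H A + H B <= H X.
Proof.
move=> f0 AB ABX; apply: le_trans (@le_hausdorff_outer R d s _ _ ABX).
have [->|Xoo] := eqVneq (H (A `|` B)) +oo; first by rewrite leey.
have Xlt : H (A `|` B) < +oo by rewrite ltey.
have fX : H (A `|` B) \is a fin_num by rewrite ge0_fin_numE ?hausdorff_outer_ge0// ltey.
have fB : H B \is a fin_num.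
  rewrite ge0_fin_numE ?hausdorff_outer_ge0//; apply: le_lt_trans Xlt.
  by apply: le_hausdorff_outer; right.
rewrite -leeBrDr//; apply: ge_ereal_sup => _ [e1 e10 <-].
have fe1 : @hausdorff_delta R d s e1 A \is a fin_num.
  rewrite ge0_fin_numE ?hausdorff_delta_ge0//; apply: le_lt_trans (hausdorff_delta_le_outer _ e10) _.
  by apply: le_lt_trans Xlt; apply: le_hausdorff_outer; left.
rewrite leeBrDr// addeC -leeBrDr//; apply: ge_ereal_sup => _ [e2 e20 <-].
rewrite leeBrDr// addeC; pose e := Num.min (Num.min e1 e2) (f / 2)%R.
have e0 : (0 < e)%R by rewrite !lt_min e10 e20 divr_gt0.
have ef : (e < f)%R.
  by rewrite (@le_lt_trans _ _ (f / 2)%R)// ?ge_min ?lexx ?orbT// ltr_pdivrMr// ltr_pMr// ltr1n.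
apply: (@le_trans _ _ (@hausdorff_delta R d s e A + @hausdorff_delta R d s e B)).
  by apply: leeD; apply: hausdorff_delta_le; rewrite /e !ge_min lexx ?orbT.
exact: le_trans (hausdorff_delta_separated ef AB) (hausdorff_delta_le_outer _ e0).
Qed.

(** Consecutive slices are a positive distance apart, so separated additivity
    peels them off one at a time. *)
Lemma hausdorff_slices (i : 'I_d) (a b : nat -> R) X :
  (forall n, a n < b n)%R -> (forall n, b n.+1 < a n)%R ->
  \sum_(k <oo) H (X `&` [set x | (a k <= x ord0 i < b k)%R]) <= H X.
Proof.
move=> ab ba.
have h n : \sum_(0 <= k < n.+1) H (X `&` [set x | (a k <= x ord0 i < b k)%R]) <=
    H (X `&` [set x | (a n <= x ord0 i)%R]).
  elim: n => [|n IH].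
    by rewrite big_nat1; apply: le_hausdorff_outer => x [? /andP[]].
  rewrite big_nat_recr//=; apply: le_trans (leeD2r _ IH) _.
  apply: (@hausdorff_separated (a n - b n.+1)%R); first by rewrite subr_gt0.
    move=> x y [_ /= xa] [_ /= /andP[_ yb]].
    apply: le_trans (ler_coord_enorm _ i); rewrite !mxE ler_normr.
    by apply/orP; left; rewrite lerB// ltW.
  move=> x [[Xx /= xa]|[Xx /= /andP[]]]; split => //=.
  by apply: le_trans xa; apply/ltW/(lt_trans (ab _))/ba.
apply: lime_le; first by apply: is_cvg_nneseries => n _ _; exact: hausdorff_outer_ge0.
apply: nearW => -[|n]; first by rewrite big_geq// hausdorff_outer_ge0.
by apply: le_trans (h n) _; apply: le_hausdorff_outer => x [].
Qed.

(** Caratheodory's criterion for metric outer measures: the part of the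
    half-space within distance [1 / n] of its boundary is cut into thin slices.
    Every other slice makes a family with gaps, whose masses have a convergent
    sum, so the mass of this part tends to 0, and what remains is at a positive
    distance from the complement. *)
Lemma hausdorff_halfspace_caratheodory (i : 'I_d) (c : R) :
  (hausdorff_outer_measure R d s).-caratheodory [set x : V | (c < x ord0 i)%R].
Proof.
apply: le_caratheodory_measurable => X.
change (H (X `&` [set x : V | (c < x ord0 i)%R]) +
  H (X `&` ~` [set x : V | (c < x ord0 i)%R]) <= H X).
have [->|Xoo] := eqVneq (H X) +oo; first by rewrite leey.
pose a (k : nat) : R := (c + k.+1%:R^-1)%R.
have adec (m n : nat) : (m < n)%N -> (a n < a m)%R.
  by move=> mn; rewrite /a ltrD2l ltf_pV2 ?posrE// ltr_nat.
pose D1 k := X `&` [set x : V | (a k.*2.+1 <= x ord0 i < a k.*2)%R].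
pose D2 k := X `&` [set x : V | (a k.*2.+2 <= x ord0 i < a k.*2.+1)%R].
have sD1 : \sum_(k <oo) H (D1 k) <= H X.
  by apply: (@hausdorff_slices i (fun k => a k.*2.+1) (fun k => a k.*2)) => n; apply: adec; rewrite ?doubleS.
have sD2 : \sum_(k <oo) H (D2 k) <= H X.
  by apply: (@hausdorff_slices i (fun k => a k.*2.+2) (fun k => a k.*2.+1)) => n; apply: adec; rewrite ?doubleS.
have H0 (A : nat -> set V) n : 0 <= H (A n) by exact: hausdorff_outer_ge0.
have split n : H (X `&` [set x | (c < x ord0 i)%R]) <=
    H (X `&` [set x : V | (a n.*2 <= x ord0 i)%R]) +
    (\sum_(n <= k <oo) H (D1 k) + \sum_(n <= k <oo) H (D2 k)).
  apply: (@le_trans _ _ (H ((X `&` [set x : V | (a n.*2 <= x ord0 i)%R]) `|`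
    (\bigcup_(k in ~` `I_n) D1 k `|` \bigcup_(k in ~` `I_n) D2 k)))).
    apply: le_hausdorff_outer => x [Xx /= cx].
    have [ax|xa] := leP (a n.*2) (x ord0 i); [by left|right].
    have exa : exists m, (a m <= x ord0 i)%R.
      have xc0 : (0 < x ord0 i - c)%R by rewrite subr_gt0.
      have [m _ /(_ m (leqnn m)) /= mx] := near_infty_natSinv_lt (PosNum xc0).
      by exists m; rewrite /a -lerBrDl ltW.
    case: (ex_minnP exa) => -[|m] am mmin.
      by move: xa; rewrite ltNge (le_trans _ am)//; case: (n) => // l; apply/ltW/adec.
    have xm : (x ord0 i < a m)%R by rewrite ltNge; apply/negP => /mmin; rewrite ltnn.
    have nm : (n.*2 <= m)%N.
      rewrite leqNgt; apply/negP => mn; move: xa; rewrite ltNge => /negP; apply.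
      by move: mn; rewrite leq_eqVlt => /orP[/eqP <- //|/adec/ltW/le_trans]; apply.
    have [k mE] : exists k, m = k.*2 \/ m = k.*2.+1.
      exists m./2; rewrite -{1 3}(odd_double_half m).
      by case: (odd m); [right|left].
    have nk : ~ (k < n)%N.
      by apply/negP; rewrite -leqNgt; case: mE nm => -> ; rewrite ?leq_double// leq_Sdouble.
    by case: mE => mE; [left|right]; exists k; rewrite // /D1 /D2 -mE; split => //=; rewrite am.
  apply: le_trans (outer_measureU2 (hausdorff_outer_measure R d s) _ _) _.
  apply: leeD2l; apply: le_trans (outer_measureU2 (hausdorff_outer_measure R d s) _ _) _.
  by apply: leeD; exact: (outer_measure_sigma_subadditive_tail (hausdorff_outer_measure R d s)).
have main n : H (X `&` [set x | (c < x ord0 i)%R]) + H (X `&` ~` [set x | (c < x ord0 i)%R])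
    <= H X + (\sum_(n <= k <oo) H (D1 k) + \sum_(n <= k <oo) H (D2 k)).
  apply: le_trans (leeD2r _ (split n)) _; rewrite addeAC leeD2r//.
  apply: (@hausdorff_separated (a n.*2 - c)%R).
  - by rewrite /a addrAC subrr add0r invr_gt0.
  - move=> x y [_ /= xa] [_ /= /negP]; rewrite -leNgt => yc.
    apply: le_trans (ler_coord_enorm _ i); rewrite !mxE ler_normr.
    by apply/orP; left; rewrite lerB.
  - by move=> x [[]|[]].
have cv : H X + (\sum_(n <= k <oo) H (D1 k) + \sum_(n <= k <oo) H (D2 k)) @[n --> \oo]
    --> H X + (0 + 0).
  have fX : H X \is a fin_num by rewrite ge0_fin_numE ?hausdorff_outer_ge0// ltey.
  apply: cvgeD; [by rewrite adde0 fin_num_adde_defl| exact: cvg_cst|].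
  apply: cvgeD => //; apply: nneseries_tail_cvg => //.
    by apply: le_lt_trans sD1 _; rewrite ltey.
  by apply: le_lt_trans sD2 _; rewrite ltey.
rewrite -[leRHS]adde0 -[X in _ <= _ + X]adde0.
by refine (cvge_ge _ cv); apply: nearW.
Qed.

End hausdorff_metric.
Section hausdorff_reflection.
Context {R : realType} {d s : nat}.
Local Notation V := 'rV[R]_d.
Local Notation H := (@hausdorff_outer R d s).
Implicit Types (n x y : V) (X U : set V).
Local Open Scope ereal_scope.

Lemma diam_preimage_reflection n U : diam (reflection n @^-1` U) <= diam U.
Proof.
rewrite ge_max diam_ge0/=; apply: ge_ereal_sup => _ [[x y] [/= Ux Uy] <-].
by rewrite -(reflection_dist n); exact: enorm_le_diam.
Qed.

Lemma lee_expe2 (a b : \bar R) m : 0 <= a -> a <= b -> a ^+ m <= b ^+ m.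
Proof.
move=> a0 ab; elim: m => [|m IH]; first by rewrite !expe0.
by rewrite !expeS; apply: lee_pmul => //; exact: expe_ge0.
Qed.

Lemma hausdorff_reflection_le n X : H (reflection n @^-1` X) <= H X.
Proof.
apply: ge_ereal_sup => _ [e e0 <-].
apply: le_trans (hausdorff_delta_le_outer _ e0).
rewrite -[leRHS]mul1e; apply: (le_cover_outer_image (psi := reflection n)) => //.
- by move=> U; exact: diam_expe_ge0.
- by move=> U; exact: diam_expe_ge0.
move=> [U Ue]; have Ve := le_trans (diam_preimage_reflection n U) Ue.
exists (exist (fun U0 => diam U0 <= e%:E) _ Ve); split => //=; rewrite mul1e.
by apply: lee_expe2; [exact: diam_ge0|exact: diam_preimage_reflection].
Qed.

Lemma hausdorff_reflection n X : H (reflection n @^-1` X) = H X.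
Proof.
apply/eqP; rewrite eq_le hausdorff_reflection_le/=.
rewrite [leLHS](_ : _ = H (reflection n @^-1` (reflection n @^-1` X))).
  exact: hausdorff_reflection_le.
by congr H; apply/seteqP; split => x /=; rewrite reflectionK.
Qed.

End hausdorff_reflection.

Section packing.
Local Open Scope ereal_scope.

Lemma cover_outer_seq (R : realType) (T I : Type) (B : I -> set T) (w : I -> \bar R)
    (r : seq I) (X : set T) : (forall i, 0 <= w i) ->
  (forall x, X x -> exists k, (k < size r)%N /\ oapp B set0 (onth r k) x) ->
  cover_outer B w X <= \sum_(i <- r) w i.
Proof.
move=> w0 Xr; apply: (@le_trans _ _ (\sum_(k <oo) oapp w 0 (onth r k))).
  by apply: ereal_inf_lbound; exists (onth r) => // x /Xr [k [_ kx]]; exists k.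
rewrite (nneseries_split 0 (size r))//; last by move=> k _; case: (onth r k) => /=.
rewrite eseries0 ?adde0; last first.
  by move=> k rk _; rewrite onth_default//= ; move: rk; rewrite add0n.
rewrite add0n big_mkord; elim: r {Xr} => [|i r IH]; first by rewrite big_ord0 big_nil.
by rewrite /= big_ord_recl big_cons /=; apply: leeD.
Qed.

(** Disjoint subsets of [A] of mass at least [m] are at most [mu A / m] many. *)
Lemma packing d (T : measurableType d) (R : realType) (mu : {measure set T -> \bar R})
    (I : eqType) (F : I -> set T) (m : \bar R) (r : seq I) (A : set T) :
  (forall i, measurable (F i)) -> measurable A -> uniq r ->
  (forall i j, i != j -> F i `&` F j = set0) ->
  (forall i, i \in r -> F i `<=` A /\ m <= mu (F i)) ->
  (size r)%:R%:E * m <= mu A.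
Proof.
move=> mF mA ur dF; elim: r A ur mA => [|i r IH] A /=; first by rewrite mul0e.
move=> /andP[ir ur] mA h.
have [iA mi] := h i (mem_head _ _).
rewrite -natr1 EFinD ge0_muleDl// mul1e addeC -(setDUK iA) measureU//; last 2 first.
- exact: measurableD.
- by rewrite setIDA setDE setIC setIA setICl set0I.
apply: leeD => //; apply: IH => //; first exact: measurableD.
move=> j jr; have [jA mj] := h j (mem_behead (s := i :: r) jr); split => // x jx; split; first exact: jA.
move=> ix; have ij : i != j by apply: contraNneq ir => ->.
by have := dF _ _ ij; move/seteqP => [/(_ x) + _]; apply.
Qed.

End packing.

Section grid.
Context {R : realType} {d : nat}.
Local Notation V := 'rV[R]_d.
Local Notation BV := (borelV R d).
Local Notation S := (@unit_sphere R d).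
Variable n : nat.

(** The cells of side [1 / n.+1] of the cube with corners [-2] and [2], half-open
    so as to be disjoint. *)
Definition grid_cell (f : {ffun 'I_d -> 'I_(4 * n.+1)}) : set V :=
  [set x | forall i, (f i)%:R < (x ord0 i + 2) * n.+1%:R <= (f i)%:R + 1].

Lemma measurable_grid_cell f : measurable (grid_cell f : set BV).
Proof.
rewrite (_ : grid_cell f = \bigcap_(i in [set: 'I_d])
    ((fun x : BV => (x ord0 i + 2) * n.+1%:R) @^-1` `](f i)%:R, (f i)%:R + 1])).
  apply: fin_bigcap_measurable => // i _; rewrite -[X in measurable X]setTI.
  have : measurable_fun [set: BV] (fun x : BV => (x ord0 i + 2) * n.+1%:R).
    by apply: measurable_funM => //; apply: measurable_funD => //; exact: measurable_coord.
  by apply => //; exact: measurable_itv.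
apply/seteqP; split => x /= h i; first by move=> _ /=; rewrite in_itv/= h.
by have := h i I; rewrite /= in_itv.
Qed.

Lemma grid_cell_disjoint f g : f != g -> grid_cell f `&` grid_cell g = set0.
Proof.
move=> fg; apply/seteqP; split => // x [xf xg]; move/negP: fg; apply; apply/eqP/ffunP => i.
apply/val_inj/eqP; have /andP[f1 f2] := xf i; have /andP[g1 g2] := xg i.
have := lt_le_trans f1 g2; rewrite natr1 ltr_nat ltnS => fg.
have := lt_le_trans g1 f2; rewrite natr1 ltr_nat ltnS => gf.
by rewrite eqn_leq; apply/andP.
Qed.

Lemma grid_cell_dist f x y : grid_cell f x -> grid_cell f y ->
  enorm (x - y) <= d%:R * n.+1%:R^-1.
Proof.
move=> fx fy; apply: enorm_le_coord; first by rewrite invr_ge0.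
move=> i; rewrite !mxE.
have /andP[f1 f2] := fx i; have /andP[g1 g2] := fy i.
have c0 : 0 < n.+1%:R :> R by [].
rewrite -div1r ler_pdivlMr// -[X in _ * X](ger0_norm (ltW c0)) -normrM ler_norml.
by apply/andP; split; lra.
Qed.

Lemma lebB_grid_cell f : ((n.+1%:R^-1 ^+ d)%:E <= lebB R d (grid_cell f))%E.
Proof.
have c0 : 0 < n.+1%:R :> R by [].
pose z : V := \row_i (2 * n.+1%:R - (f i)%:R).
rewrite (_ : grid_cell f = [set x | [set y | [set w : V | forall i, 0 < w ord0 i <= 1]
    (y + z)] (n.+1%:R *: x)]).
  rewrite lebB_scale// lebB_translate -[leLHS]mule1 lee_pmul2l//.
  exact: lebesgue_unit_cube.
apply/seteqP; split => x /= h i; have := h i; rewrite !mxE => /andP[h1 h2];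
  by apply/andP; split; lra.
Qed.

Lemma sphere_grid_cell x : S x -> exists f, grid_cell f x.
Proof.
move=> Sx; have c0 : 0 < n.+1%:R :> R by [].
have ex i : exists j : 'I_(4 * n.+1), (j%:R : R) < (x ord0 i + 2) * n.+1%:R <= j%:R + 1.
  have := ler_coord_enorm x i; rewrite Sx ler_norml => /andP[x1 x2].
  have y0 : 0 < (x ord0 i + 2) * n.+1%:R by rewrite mulr_gt0//; lra.
  have exm : exists m : nat, (x ord0 i + 2) * n.+1%:R <= m%:R.
    exists (4 * n.+1)%N; rewrite natrM ler_wpM2r//; lra.
  have lem : (x ord0 i + 2) * n.+1%:R <= (4 * n.+1)%:R.
    by rewrite natrM ler_wpM2r//; lra.
  case: (ex_minnP exm) => -[|m] ym mmin; first by move: ym; rewrite leNgt y0.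
  have mlt : (m < 4 * n.+1)%N by exact: mmin.
  exists (Ordinal mlt) => /=; rewrite natr1 ym andbT ltNge.
  by apply/negP => /mmin; rewrite ltnn.
have [f fP] := choice ex; exists [ffun i => f i] => i.
by rewrite ffunE.
Qed.

End grid.

Section hausdorff_sphere_finite.
Context {R : realType} {d : nat}.
Local Notation V := 'rV[R]_d.
Local Notation BV := (borelV R d).
Local Notation S := (@unit_sphere R d).
Local Notation w1 := (unit_ball_volume R d).

(** The volume of the annulus is a difference of two powers, of the order of its
    thickness. *)
Lemma lebB_annulus (e : R) : 0 < e < 1 ->
  (lebB R d [set y : V | (1 - e < enorm y < 1 + e)%R] <= (e * (2 * d%:R * 2 ^+ d * w1))%:E)%E.
Proof.
move=> /andP[e0 e1].
have e1' : 0 < 1 - e by rewrite subr_gt0.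
have e2' : 0 < 1 + e by rewrite addr_gt0.
have ms : measurable ([set y : V | 1 - e < enorm y < 1 + e] : set BV).
  rewrite (_ : [set _ | _] = shell (1 - e) (1 + e)); first exact: measurable_shell.
  by apply/seteqP; split => y; rewrite /shell/= in_itv.
have : (lebB R d [set y : V | (1 - e < enorm y < 1 + e)%R] + lebB R d (eball (0 : V) (1 - e))
    <= lebB R d (eball (0 : V) (1 + e)))%E.
  rewrite -measureU//; last 2 first.
  - exact: measurable_eball.
  - apply/seteqP; split => y // [/= /andP[h1 _]]; rewrite /eball/= sub0r enormN.
    by rewrite ltNge (ltW h1).
  apply: le_cover_outer => y [/= /andP[_]|]; rewrite /eball/= sub0r enormN//.
  by move/lt_trans; apply; lra.
rewrite !lebB_eball// -leeBrDr// => /le_trans; apply.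
rewrite -EFinB lee_fin -mulrBl [X in _ <= X](_ : _ = (2 * e * (d%:R * 2 ^+ d)) * w1); last by ring.
apply: ler_wpM2r; first by rewrite ltW// unit_ball_volume_gt0.
rewrite subrXX.
rewrite (_ : 1 + e - (1 - e) = 2 * e); last by ring.
apply: ler_wpM2l; first by rewrite mulr_ge0// ltW.
apply: (@le_trans _ _ (\sum_(i < d) 2 ^+ d)); last by rewrite sumr_const card_ord mulr_natl.
apply: ler_sum => i _; rewrite -[leRHS]mulr1.
apply: ler_pM; rewrite ?exprn_ge0 ?(ltW e1') ?(ltW e2')//.
  apply: (@le_trans _ _ (2 ^+ (d.-1 - i))).
    by rewrite lerXn2r ?nnegrE ?(ltW e2')//; lra.
  by apply: ler_weXn2l; [lra|rewrite leq_subLR (leq_trans (leq_pred _)) ?leq_addl].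
by apply: exprn_ile1; rewrite ?(ltW e1')//; lra.
Qed.

(** The grid cells meeting the sphere are disjoint subsets of an annulus of
    thickness of the order of their side, so by volume there are at most of the
    order of [n ^ d.-1] of them, each contributing [n ^- d.-1]. *)
Lemma hausdorff_sphere_lty : (0 < d)%N -> (hausdorff_outer d.-1 S < +oo)%E.
Proof.
move=> d0.
pose K := d.+1%:R * (2 * d%:R * 2 ^+ d * w1).
apply: (@le_lt_trans _ _ (d%:R ^+ d.-1 * K)%:E); last by rewrite ltry.
apply: ge_ereal_sup => _ [e /= e0 <-].
have [n ne dn] : exists2 n, d%:R * n.+1%:R^-1 <= e & d.+1%:R * n.+1%:R^-1 < 1 :> R.
  have m0 : 0 < Num.min 1 e / d.+1%:R by rewrite divr_gt0// lt_min ltr01.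
  have [n _ /(_ n (leqnn n)) /=] := near_infty_natSinv_lt (PosNum m0).
  rewrite ltr_pdivlMr// mulrC lt_min => /andP[h1 h2]; exists n => //.
  by apply/ltW/(le_lt_trans _ h2); rewrite ler_wpM2r ?invr_ge0// ler_nat.
have c0 : 0 < n.+1%:R :> R by [].
pose P := [seq f <- enum {ffun 'I_d -> 'I_(4 * n.+1)} | `[< exists x, S x /\ grid_cell f x >]].
have Nle : (size P)%:R * n.+1%:R^-1 ^+ d <= n.+1%:R^-1 * K.
  (* Cells have diameter at most [d / n.+1], which is less than [eps]. *)
  pose eps : R := d.+1%:R * n.+1%:R^-1.
  have eps01 : 0 < eps < 1 by rewrite dn andbT mulr_gt0 ?invr_gt0.
  pose A : set V := [set y : V | 1 - eps < enorm y < 1 + eps].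
  have mA : measurable (A : set BV).
    rewrite (_ : A = shell (1 - eps) (1 + eps)); first exact: measurable_shell.
    by apply/seteqP; split => y; rewrite /shell/= in_itv.
  have uP : uniq P by rewrite filter_uniq ?enum_uniq.
  have := @packing _ _ _ (lebB R d) _ (@grid_cell R d n) (n.+1%:R^-1 ^+ d)%:E P A
    (@measurable_grid_cell R d n) mA uP (@grid_cell_disjoint R d n).
  move=> /(_ _)/le_trans/(_ (lebB_annulus eps01)); rewrite -EFinM lee_fin mulrA (mulrC eps).
  rewrite (_ : _ * eps * _ = n.+1%:R^-1 * K); last by rewrite /K /eps; ring.
  apply=> f; rewrite mem_filter => /andP[/asboolP[z [Sz fz]] _].
  split; last exact: lebB_grid_cell.
  move=> x fx; have := le_trans (ler_dist_enorm _ _) (grid_cell_dist fx fz).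
  rewrite Sz => h; have {h} : `|enorm x - 1| < eps.
    by apply: le_lt_trans h _; rewrite /eps ltr_pM2r ?invr_gt0// ltr_nat.
  by rewrite ltr_norml /A/= => /andP[h1 h2]; apply/andP; split; lra.
have dP (f : {ffun 'I_d -> 'I_(4 * n.+1)}) : (diam (grid_cell f : set V) <= e%:E)%E.
  apply: diam_le; first exact: ltW.
  by move=> x y fx fy; exact: le_trans (grid_cell_dist fx fy) ne.
pose r := [seq exist (fun U : set V => diam U <= e%:E)%E (grid_cell f) (dP f) | f <- P].
apply: (@le_trans _ _ (\sum_(U <- r) diam (sval U) ^+ d.-1)%E).
  apply: cover_outer_seq; first by move=> U; exact: diam_expe_ge0.
  move=> x Sx; have [f fx] := sphere_grid_cell n Sx.
  have fP : f \in P by rewrite mem_filter mem_enum andbT; apply/asboolP; exists x.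
  exists (index f P); rewrite size_map index_mem fP; split => //.
  by rewrite onthE -map_comp (nth_map f) ?index_mem//= nth_index.
rewrite big_map.
pose c : R := (d%:R * n.+1%:R^-1) ^+ d.-1.
have sumle (t : seq {ffun 'I_d -> 'I_(4 * n.+1)}) :
    (\sum_(f <- t) diam (grid_cell f : set V) ^+ d.-1 <= ((size t)%:R * c)%:E)%E.
  elim: t => [|f t IH]; first by rewrite big_nil mul0r.
  rewrite big_cons /= -natr1 mulrDl mul1r addrC EFinD; apply: leeD => //.
  rewrite /c EFin_expe; apply: lee_expe2; first exact: diam_ge0.
  apply: diam_le; first by rewrite mulr_ge0// invr_ge0.
  by move=> x y; exact: grid_cell_dist.
apply: le_trans (sumle P) _; rewrite lee_fin /c exprMn mulrCA ler_wpM2l ?exprn_ge0//.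
have e1 : n.+1%:R^-1 ^+ d = n.+1%:R^-1 ^+ d.-1 * n.+1%:R^-1 :> R.
  by rewrite -exprSr prednK.
by move: Nle; rewrite e1 mulrA mulrC ler_pM2l// invr_gt0.
Qed.

End hausdorff_sphere_finite.

Section hausdorff_sphere_positive.
Context {R : realType} {d : nat}.
Local Notation V := 'rV[R]_d.
Local Notation BV := (borelV R d).
Local Notation S := (@unit_sphere R d).
Local Notation w1 := (unit_ball_volume R d).
Local Notation sigma := (@cone_measure R d).
Local Open Scope ereal_scope.

Lemma measurable_cball (w : V) (r : R) : measurable ([set y | (enorm (w - y) <= r)%R] : set BV).
Proof.
rewrite (_ : [set _ | _] = \bigcap_n eball w (r + n.+1%:R^-1)%R).
  by apply: bigcap_measurable => // n _; exact: measurable_eball.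
apply/seteqP; split => y /=.
  by move=> h n _; rewrite /eball/= (le_lt_trans h)// ltrDl invr_gt0.
move=> h; apply/ler_addgt0Pl => e e0.
have [n _ /(_ n (leqnn n)) /= ne] := near_infty_natSinv_lt (PosNum e0).
by have := h n I; rewrite /eball/= => /ltW/le_trans; apply; rewrite addrC lerD2r ltW.
Qed.

Lemma cone_measure_cball_le (w : V) (r : R) : S w -> (0 <= r <= 2^-1)%R -> (1 < d)%N ->
  sigma (S `&` [set y | (enorm (w - y) <= r)%R]) <=
  (2 ^+ d * w1 * 2 ^+ d.-1)%:E * (r%:E ^+ d.-1).
Proof.
move=> Sw /andP[r0 r2] d1; have d0 : (0 < d)%N by apply: ltnW.
have K0 : (0 < 2 ^+ d * w1)%R by rewrite mulr_gt0 ?exprn_gt0// unit_ball_volume_gt0.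
have mS := @measurable_sphere R d.
have le_ball (t : R) : (r < t)%R ->
    sigma (S `&` [set y | (enorm (w - y) <= r)%R]) <= sigma (S `&` eball w t).
  move=> rt; apply: le_measure; rewrite ?inE.
  - by apply: measurableI => //; exact: measurable_cball.
  - by apply: measurableI => //; exact: measurable_eball.
  - by move=> y [? /= h]; split => //; exact: le_lt_trans rt.
rewrite -EFin_expe -EFinM.
have [r0'|r0'] := ltP 0%R r.
  have r2r : (r < 2 * r)%R by lra.
  apply: le_trans (le_ball _ r2r) _; apply: le_trans (cone_measure_eball_le Sw _ d0) _.
    by apply/andP; split; lra.
  by rewrite lee_fin exprMn mulrA.
have r00 : r = 0%R by apply/eqP; rewrite eq_le r0'.
have d10 : (0 < d.-1)%N by rewrite -ltnS prednK.
move: le_ball; rewrite r00 expr0n (gtn_eqF d10) mulr0 => le_ball.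
apply/lee_addgt0Pr => e e0; rewrite add0e.
pose t : R := (Num.min 1 (e / (2 ^+ d * w1)))%R.
have t0 : (0 < t)%R by rewrite lt_min ltr01 divr_gt0.
apply: le_trans (le_ball _ t0) _; apply: le_trans (cone_measure_eball_le Sw _ d0) _.
  by rewrite t0 ge_min lexx.
rewrite lee_fin mulrC -ler_pdivlMr//.
have t1 : (t <= 1)%R by rewrite ge_min lexx.
apply: (@le_trans _ _ t); last by rewrite ge_min lexx orbT.
by rewrite -[leRHS]expr1; apply: ler_wiXn2l => //; exact: ltW.
Qed.

(** A set of small diameter meeting the sphere lies in a ball centred on it of
    radius its diameter, whose cone measure is at most a multiple of the diameter
    to the power [d.-1]. *)
Lemma cone_measure_le_hausdorff : (1 < d)%N ->
  sigma S <= (2 ^+ d * w1 * 2 ^+ d.-1)%:E * hausdorff_outer d.-1 S.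
Proof.
move=> d1.
have K0 : (0 < 2 ^+ d * w1 * 2 ^+ d.-1)%R by rewrite !mulr_gt0 ?exprn_gt0// unit_ball_volume_gt0.
have h0 : (0 < 2^-1 :> R)%R by rewrite invr_gt0.
apply: (@le_trans _ _ ((2 ^+ d * w1 * 2 ^+ d.-1)%:E * hausdorff_delta d.-1 2^-1 S)); last first.
  by apply: lee_pmul => //; rewrite ?lee_fin ?(ltW K0) ?hausdorff_delta_ge0 ?hausdorff_delta_le_outer.
rewrite -lee_pdivrMl//; apply: le_ereal_inf_tmp => _ [F SF <-].
rewrite lee_pdivrMl// -nneseriesZl; last first.
  by move=> k _; case: (F k) => //= U; exact: diam_expe_ge0.
have mS := @measurable_sphere R d.
have ex k : exists G : set BV, [/\ measurable G, S `&` oapp sval set0 (F k) `<=` G &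
    sigma G <= (2 ^+ d * w1 * 2 ^+ d.-1)%:E *
    oapp (fun U : {U : set V | diam U <= 2^-1%:E} => diam (sval U) ^+ d.-1) 0 (F k)].
  case: (F k) => [[U Ue]|] /=; last first.
    by exists set0; split; rewrite ?setI0 ?measure0 ?mule0.
  have [[w [Sw Uw]]|nw] := pselect (exists w, S w /\ U w); last first.
    exists set0; rewrite measure0; split => //.
      by move=> w h; apply: nw; exists w.
    by rewrite mule_ge0 ?lee_fin ?(ltW K0)// expe_ge0// diam_ge0.
  have fU : diam U \is a fin_num.
    by rewrite ge0_fin_numE ?diam_ge0//; apply: le_lt_trans Ue _; rewrite ltry.
  exists (S `&` [set y | (enorm (w - y) <= fine (diam U))%R]); split.
  - by apply: measurableI => //; exact: measurable_cball.
  - move=> y [Sy Uy]; split => //=; rewrite -lee_fin fineK//; exact: enorm_le_diam.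
  - rewrite -[in leRHS](fineK fU); apply: cone_measure_cball_le => //.
    by rewrite fine_ge0 ?diam_ge0//= -lee_fin fineK.
have [G GP] := choice ex.
apply: (@le_trans _ _ (\sum_(k <oo) sigma (G k))).
  apply: measure_sigma_subadditive => //; first by move=> k; have [] := GP k.
  by move=> w Sw; have [k _ Fw] := SF _ Sw; exists k => //; have [_ + _] := GP k; apply.
by apply: lee_nneseries => // k _; have [] := GP k.
Qed.

End hausdorff_sphere_positive.

Lemma unit_sphere_nonempty (R : realType) (d : nat) : (0 < d)%N ->
  exists w : 'rV[R]_d, unit_sphere w.
Proof.
move=> d0; exists (\row_i (i == Ordinal d0)%:R).
rewrite /unit_sphere/= /enorm (bigD1 (Ordinal d0))//= big1 ?addr0.
  by rewrite !mxE eqxx expr1n sqrtr1.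
by move=> i /negbTE h; rewrite mxE h expr0n.
Qed.

Lemma cone_measure_fin (R : realType) (d : nat) (A : set (borelV R d)) : measurable A ->
  cone_measure A \is a fin_num.
Proof. by move=> mA; rewrite ge0_fin_numE ?measure_ge0// cone_measure_lty. Qed.

Lemma cone_sphere_gt0 (R : realType) (d : nat) : (0 < d)%N ->
  (0 < fine (@cone_measure R d (@unit_sphere R d)))%R.
Proof.
move=> d_gt0.
rewrite -lte_fin fineK ?cone_measure_fin//; last exact: measurable_sphere.
have [w Sw] := unit_sphere_nonempty R d_gt0.
apply: lt_le_trans (cone_measure_eball_gt0 Sw ltr01) _.
apply: le_measure; rewrite ?inE//; first by apply: measurableI; [exact: measurable_sphere|exact: measurable_eball].
exact: measurable_sphere.
Qed.

Section sphere_measures_proportional.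
Context {R : realType} {d : nat}.
Hypothesis d_gt1 : (1 < d)%N.
Local Notation V := 'rV[R]_d.
Local Notation BV := (borelV R d).
Local Notation S := (@unit_sphere R d).
Local Notation sigma := (@cone_measure R d).
Local Notation Hd := (hausdorff R d d.-1).
Local Open Scope ereal_scope.

Let d_gt0 : (0 < d)%N. Proof. exact: ltnW. Qed.

Lemma measurable_hausdorff (A : set BV) : measurable A ->
  measurable (A : set (hausdorff_type R d d.-1)).
Proof.
move: A; apply: smallest_sub; first exact: sigma_algebra_measurable.
by move=> _ [i [c ->]]; exact: hausdorff_halfspace_caratheodory.
Qed.

Lemma measurable_id_hausdorff :
  measurable_fun [set: hausdorff_type R d d.-1] (id : hausdorff_type R d d.-1 -> BV).
Proof. by move=> _ A mA; rewrite setTI; exact: measurable_hausdorff. Qed.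

Definition measurable_sphere_hausdorff := measurable_hausdorff (@measurable_sphere R d).

Lemma hausS_sigma_finite : sigma_finite [set: BV]
  (pushforward (mrestr Hd measurable_sphere_hausdorff) (id : hausdorff_type R d d.-1 -> BV)).
Proof.
apply: sigma_finite_eball => n; rewrite /pushforward/= /mrestr.
apply: le_lt_trans (@hausdorff_sphere_lty R d d_gt0).
by apply: le_hausdorff_outer => x [].
Qed.

Definition hausS := image_measure measurable_id_hausdorff hausS_sigma_finite.
HB.instance Definition _ := SigmaFiniteMeasure.on hausS.

Lemma hausSE (A : set BV) : hausS A = hausdorff_outer d.-1 (A `&` S).
Proof. by []. Qed.

Lemma hausdorff_sphere_fin : hausdorff_outer d.-1 S \is a fin_num.
Proof. by rewrite ge0_fin_numE ?hausdorff_outer_ge0// hausdorff_sphere_lty. Qed.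

Lemma hausdorff_sphere_gt0 : 0 < hausdorff_outer d.-1 S.
Proof.
rewrite lt_def hausdorff_outer_ge0 andbT; apply/eqP => H0.
have := cone_measure_le_hausdorff d_gt1 (R := R); rewrite H0 mule0 leNgt => /negP; apply.
have [w Sw] := unit_sphere_nonempty R d_gt0.
apply: lt_le_trans (cone_measure_eball_gt0 Sw ltr01) _.
apply: le_measure; rewrite ?inE//; first by apply: measurableI; [exact: measurable_sphere|exact: measurable_eball].
exact: measurable_sphere.
Qed.

Definition sphere_ratio : R := (fine (hausdorff_outer d.-1 S) / fine (sigma S))%R.

(** Both measures are invariant under reflections, so Christensen's argument
    applies; double counting over the whole sphere identifies the factor. *)
Lemma hausS_proportional (A : set BV) : measurable A ->
  hausS A = sphere_ratio%:E * sigma A.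
Proof.
move=> mA; have mS := @measurable_sphere R d.
have [w Sw] := unit_sphere_nonempty R d_gt0.
have mSb x r : measurable (S `&` eball x r : set BV).
  by apply: measurableI => //; exact: measurable_eball.
pose g r := fine (sigma (S `&` eball w r)).
have gE x r : S x -> sigma (S `&` eball x r) = (g r)%:E.
  by move=> Sx; rewrite fineK ?cone_measure_fin//; exact: cone_measure_eball_eq.
have hE x r : S x -> hausS (S `&` eball x r) = hausS (S `&` eball w r).
  move=> Sx; rewrite !hausSE -[RHS](hausdorff_reflection (x - w)).
  have e : reflection (x - w) x = w by apply: reflection_swap; rewrite Sx Sw.
  have {}e : reflection (x - w) w = x by rewrite -[X in reflection _ X = _]e reflectionK.
  congr hausdorff_outer; rewrite !preimage_setI preimage_reflection_eball e.
  have -> // : reflection (x - w) @^-1` S = S.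
  by apply/seteqP; split => y; rewrite /unit_sphere/= enorm_reflection.
have hle (B : set BV) : measurable B -> hausS B \is a fin_num.
  move=> mB; rewrite ge0_fin_numE ?measure_ge0//.
  apply: le_lt_trans (@hausdorff_sphere_lty R d d_gt0).
  by apply: le_hausdorff_outer => x [].
have HS : hausS S = hausdorff_outer d.-1 S by rewrite hausSE setIid.
have hg r : hausS (S `&` eball w r) = (sphere_ratio * g r)%:E.
  have h1 := @double_count_balls R d sigma hausS S r (g r)%:E (hausS (S `&` eball w r))
    setT setT mS measurableT measurableT.
  have h2 := @double_count_balls R d hausS sigma S r (hausS (S `&` eball w r)) (g r)%:E
    setT setT mS measurableT measurableT.
  have e : hausS (S `&` eball w r) * sigma (S `&` setT) = (g r)%:E * hausS (S `&` setT).
    apply/eqP; rewrite eq_le; apply/andP; split.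
      apply: h1 => //.
      - by rewrite lee_fin fine_ge0// measure_ge0.
      - by move=> x Sx; rewrite [leLHS](_ : _ = (g r)%:E)//; exact: gE.
      - by move=> x Sx; exact: hE.
    apply: h2 => //.
    - move=> x Sx; rewrite [leLHS](_ : _ = hausS (S `&` eball w r))//; exact: hE.
    - by move=> x Sx; exact: gE.
  move: e; rewrite !setIT HS -(fineK (hle _ (mSb w r))) -(fineK hausdorff_sphere_fin).
  rewrite -(fineK (cone_measure_fin mS)) -!EFinM => -[e]; congr EFin.
  have s0 : fine (sigma S) != 0%R by rewrite gt_eqF ?cone_sphere_gt0.
  by apply: (mulIf s0); rewrite e /sphere_ratio mulrAC divfK// mulrC.
have ratio0 : (0 <= sphere_ratio)%R.
  by rewrite divr_ge0// fine_ge0 ?hausdorff_outer_ge0 ?measure_ge0.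
rewrite -cone_measure_sphereC//; transitivity (hausS (S `&` A)).
  by rewrite !hausSE setIAC setIid setIC.
apply: (@uniformly_distributed_proportional R d sigma hausS S g sphere_ratio mS ratio0 _ _ _ _ A mA).
- by move=> r r0; rewrite -lte_fin -(gE _ _ Sw) cone_measure_eball_gt0.
- by move=> x r Sx r0; exact: gE.
- by move=> x r Sx r0; rewrite -hg; exact: hE.
- by move=> p q; apply: cone_measure_lty; exact: measurable_obox.
Qed.

End sphere_measures_proportional.

(** * Polar coordinates *)

Section polar.
Context {R : realType} {d : nat}.
Hypothesis d_gt0 : (0 < d)%N.
Local Notation V := 'rV[R]_d.
Local Notation BV := (borelV R d).
Local Notation lam := (lebB R d).
Local Notation w1 := (unit_ball_volume R d).
Local Notation sigma := (@cone_measure R d).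
Local Open Scope ereal_scope.

Lemma lebB_set10 : lam [set 0%R] = 0.
Proof.
apply/eqP; rewrite eq_le measure_ge0 andbT; apply/lee_addgt0Pr => e e0; rewrite add0e.
pose t : R := (Num.min 1 (e / w1))%R.
have t0 : (0 < t)%R by rewrite lt_min ltr01 divr_gt0// unit_ball_volume_gt0.
apply: (@le_trans _ _ (lam (eball (0 : V) t))).
  by apply: le_cover_outer => _ ->; rewrite /eball/= subrr enorm0.
rewrite lebB_eball// lee_fin -ler_pdivlMr ?unit_ball_volume_gt0//.
have t1 : (t <= 1)%R by rewrite ge_min lexx.
apply: (@le_trans _ _ t); last by rewrite ge_min lexx orbT.
by rewrite -[leRHS]expr1; apply: ler_wiXn2l => //; exact: ltW.
Qed.

Lemma invw1_ge0 : (0 <= w1^-1)%R.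
Proof. by rewrite invr_ge0 ltW// unit_ball_volume_gt0. Qed.

Lemma rho_sigma_finite : sigma_finite [set: R]
  (pushforward (mscale (NngNum invw1_ge0) lam) (@enorm R d : BV -> R)).
Proof.
exists (fun n => `]-oo, n%:R[%classic : set R).
  apply/seteqP; split => // x _; exists (Num.Def.archi_bound `|x|) => //=.
  by rewrite in_itv/= (le_lt_trans (ler_norm x))// archi_boundP.
move=> n; split; first exact: measurable_itv.
rewrite /pushforward/= /mscale/= lte_mul_pinfty//; first by rewrite lee_fin invw1_ge0.
apply: le_lt_trans (lebesgue_eball_lty (0 : V) n%:R); apply: le_cover_outer => y.
by rewrite /eball/= in_itv/= sub0r enormN.
Qed.

(** The distribution of the Euclidean norm, normalised so that radii less than
    [r] have mass [r ^+ d]: the measure of density [d * r ^+ d.-1]. *)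
Definition rho := image_measure (@measurable_enorm R d) rho_sigma_finite.
HB.instance Definition _ := SigmaFiniteMeasure.on rho.

Lemma rhoE (A : set R) : rho A = w1^-1%:E * lam ((@enorm R d) @^-1` A).
Proof. by []. Qed.

Lemma rho_ray (r : R) : (0 < r)%R -> rho `]-oo, r[ = (r ^+ d)%:E.
Proof.
move=> r0; rewrite rhoE (_ : _ @^-1` _ = eball (0 : V) r).
  rewrite lebB_eball// -EFinM mulrCA mulVf ?mulr1//.
  by rewrite gt_eqF// unit_ball_volume_gt0.
by apply/seteqP; split => y; rewrite /eball/= in_itv/= sub0r enormN.
Qed.

Lemma rho_itv (r s : R) : (0 < r < s)%R -> rho `[r, s[ = (s ^+ d - r ^+ d)%:E.
Proof.
move=> /andP[r0 rs]; have s0 := lt_trans r0 rs.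
have := rho_ray s0; rewrite (_ : `]-oo, s[%classic = `]-oo, r[ `|` `[r, s[ :> set R).
  rewrite measureU//=; last first.
    apply/seteqP; split => x //= [].
    by rewrite !in_itv/= => xr /andP[]; rewrite leNgt xr.
  rewrite [X in X + _]rho_ray// EFinB => <-.
  by rewrite addeAC subee// add0e.
apply/seteqP; split => x /=; rewrite !in_itv/=.
  by move=> xs; case: (ltP x r) => xr; [left|right; rewrite xs].
by move=> [/lt_trans|/andP[]]; [apply|].
Qed.

Lemma rho_neg (A : set R) : (forall r, A r -> r <= 0)%R -> measurable A -> rho A = 0.
Proof.
move=> A0 mA; rewrite rhoE (_ : lam _ = 0) ?mule0//.
apply/eqP; rewrite eq_le measure_ge0 andbT -lebB_set10.
apply: le_cover_outer => y /= /A0 y0; apply/eqP.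
by rewrite -enorm_eq0 eq_le y0 enorm_ge0.
Qed.

Lemma measurable_polar :
  measurable_fun [set: BV] (fun y : BV => (enorm y, direction y) : R * BV).
Proof.
by apply/measurable_fun_pairP; split; [exact: measurable_enorm|exact: measurable_direction].
Qed.

(** In the direction variable the set is arbitrary; in the radial variable it is
    enough to treat rays, where both sides are given by the scaling of cones. *)
Lemma lebB_polar_rect (A : set R) (B : set BV) : measurable A -> measurable B ->
  lam ((@enorm R d) @^-1` A `&` (direction @^-1` B)) = rho A * sigma B.
Proof.
move=> mA mB.
have mdB : measurable (direction @^-1` B : set BV).
  by rewrite -[X in measurable X]setTI; exact: measurable_direction.
have fB : sigma B \is a fin_num by exact: cone_measure_fin.
have sB0 : (0 <= fine (sigma B))%R by rewrite fine_ge0// measure_ge0.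
have sf : sigma_finite [set: R] (pushforward (mrestr lam mdB) (@enorm R d : BV -> R)).
  exists (fun n => `]-oo, n%:R[%classic : set R).
    apply/seteqP; split => // x _; exists (Num.Def.archi_bound `|x|) => //=.
    by rewrite in_itv/= (le_lt_trans (ler_norm x))// archi_boundP.
  move=> n; split; first exact: measurable_itv.
  apply: le_lt_trans (lebesgue_eball_lty (0 : V) n%:R); apply: le_cover_outer => y.
  by rewrite /eball/= in_itv/= sub0r enormN => -[].
pose m1 := image_measure (@measurable_enorm R d) sf.
transitivity (m1 A); first by [].
transitivity (mscale (NngNum sB0) rho A); last by rewrite /mscale/= fineK// muleC.
refine (@measure_unique _ R R (@RGenInftyO.G R)
  (fun n => `]-oo, n%:R[%classic : set R) _ _ _ _ m1 _ _ _ A mA).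
- exact: RGenInftyO.measurableE.
- move=> _ _ [x ->] [y ->]; exists (Num.min x y); apply/seteqP; split => z /=.
    by rewrite !in_itv/= lt_min => -[-> ->].
  by rewrite !in_itv/= lt_min => /andP[].
- by move=> n; exists n%:R.
- apply/seteqP; split => // x _; exists (Num.Def.archi_bound `|x|) => //=.
  by rewrite in_itv/= (le_lt_trans (ler_norm x))// archi_boundP.
- move=> _ [r ->].
  have [r0|r0] := leP r 0%R.
    have e0 : (@enorm R d) @^-1` `]-oo, r[ = set0.
      apply/seteqP; split => y //=; rewrite in_itv/= => yr.
      by have := lt_le_trans yr r0; rewrite ltNge enorm_ge0.
    rewrite [LHS](_ : _ = lam ((@enorm R d) @^-1` `]-oo, r[ `&` direction @^-1` B))//.
    rewrite e0 set0I measure0 [RHS](_ : _ = (fine (sigma B))%:E * rho `]-oo, r[)//.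
    rewrite rho_neg ?mule0// => x; rewrite /= in_itv/= => xr.
    by apply/ltW/(lt_le_trans xr).
  rewrite [RHS](_ : _ = (fine (sigma B))%:E * rho `]-oo, r[)//.
  rewrite rho_ray// fineK// muleC -lebB_cone//.
  rewrite [LHS](_ : _ = lam ((@enorm R d) @^-1` `]-oo, r[ `&` direction @^-1` B))//.
  apply/eqP; rewrite eq_le; apply/andP; split; last first.
    apply: le_cover_outer => y [dy]; rewrite /shell/= !in_itv/= => /andP[_ yr].
    by split.
  rewrite -[leRHS]adde0 -lebB_set10.
  apply: le_trans (outer_measureU2 (@lebesgue_outer_measure R d) _ _).
  apply: le_cover_outer => y; rewrite /shell/= !in_itv/= => -[yr dy].
  have [->|y0] := eqVneq y 0%R; [by right|left]; split => //.
  by rewrite yr andbT lt_def enorm_ge0 enorm_eq0 y0.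
- move=> n; apply: le_lt_trans (lebesgue_eball_lty (0 : V) n%:R); apply: le_cover_outer => y.
  by rewrite /eball/= in_itv/= sub0r enormN => -[].
Qed.

Lemma polar_sigma_finite : sigma_finite [set: R * BV]
  (pushforward lam (fun y : BV => (enorm y, direction y) : R * BV)).
Proof.
exists (fun n => (`]-oo, n%:R[%classic : set R) `*` [set: BV]).
  apply/seteqP; split => // -[x w] _; exists (Num.Def.archi_bound `|x|) => //=.
  by rewrite in_itv/= (le_lt_trans (ler_norm x))// archi_boundP.
move=> n; split; first by apply: measurableX => //; exact: measurable_itv.
apply: le_lt_trans (lebesgue_eball_lty (0 : V) n%:R); apply: le_cover_outer => y.
by rewrite /eball/= in_itv/= sub0r enormN => -[].
Qed.

(** Polar coordinates: the map to norm and direction sends Lebesgue measure to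
    the product of its two marginals. *)
Lemma integral_polar (F : R * BV -> \bar R) :
  measurable_fun [set: R * BV] F -> (forall z, 0 <= F z) ->
  \int[lam]_y F (enorm y, direction y) = \int[rho]_r \int[sigma]_w F (r, w).
Proof.
move=> mF F0; rewrite -(@fubini_tonelli1 _ _ _ _ _ rho sigma F mF F0).
rewrite -(ge0_integral_image_measure measurable_polar polar_sigma_finite mF F0).
apply: eq_measure_integral => A mA _; apply/esym.
refine (@product_measure_unique _ _ _ _ _ rho sigma
  (image_measure measurable_polar polar_sigma_finite) _ A mA) => B C mB mC.
exact: lebB_polar_rect.
Qed.

End polar.

(** * Radial weights and radial averages *)

Lemma ge0_integral_mrestr dd (T : measurableType dd) (R : realType)
    (mu : {measure set T -> \bar R}) (D : set T) (mD : measurable D) (f : T -> \bar R) :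
  measurable_fun [set: T] f -> (forall x, 0 <= f x)%E ->
  (\int[mrestr mu mD]_x f x = \int[mu]_(x in D) f x)%E.
Proof.
move=> mf f0.
rewrite (ge0_negligible_integral (D := setT) (N := ~` D))//.
- rewrite setTD setCK; apply: eq_measure_integral => A mA AD.
  by rewrite /=/mrestr setIidl.
- exact: measurableC.
- by rewrite /=/mrestr setICl measure0.
Qed.

Section lebesgue_borel.
Context {R : realType} {d : nat}.
Local Notation V := 'rV[R]_d.
Local Notation BV := (borelV R d).
Local Notation LV := (lebesgue_type R d).
Local Notation lam := (@lebesgue_outer R d).
Local Open Scope ereal_scope.

Lemma measurable_box (ab : V * V) : measurable (box ab : set BV).
Proof.
rewrite (_ : box ab = \bigcap_(i in [set: 'I_d])
    ((fun x : BV => x ord0 i) @^-1` `]ab.1 ord0 i, ab.2 ord0 i])).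
  apply: fin_bigcap_measurable => // i _; rewrite -[X in measurable X]setTI.
  by apply: measurable_coord => //; exact: measurable_itv.
apply/seteqP; split => x /= h i; first by move=> _ /=; rewrite in_itv/= h.
by have := h i I; rewrite /= in_itv.
Qed.

(** Intersection of countably many covers by boxes that are nearly optimal. *)
Lemma borel_hull (A : set V) : exists B : set BV,
  [/\ measurable B, A `<=` B & lam B = lam A].
Proof.
have [Aoo|Afin] := eqVneq (lam A) +oo.
  exists setT; split => //; apply/eqP; rewrite eq_le Aoo leey/= -Aoo.
  exact: le_cover_outer.
have fA : lam A \is a fin_num.
  by rewrite ge0_fin_numE ?ltey// cover_outer_ge0//; exact: box_volume_ge0.
have ex (n : nat) : exists B : set BV,
    [/\ measurable B, A `<=` B & lam B <= lam A + n.+1%:R^-1%:E].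
  have n0 : (0 < n.+1%:R^-1 :> R)%R by rewrite invr_gt0.
  have [_ [F AF <-] /ltW ltF] := lb_ereal_inf_adherent n0 fA.
  exists (\bigcup_k oapp (@box R d) set0 (F k)); split => //.
    apply: bigcup_measurable => k _; case: (F k) => //= ab; exact: measurable_box.
  apply: le_trans ltF; apply: ereal_inf_lbound; exists F => //.
have [B BP] := choice ex; exists (\bigcap_n B n); split.
- by apply: bigcap_measurable => // n _; have [] := BP n.
- by move=> x Ax n _; have [_ + _] := BP n; apply.
apply/eqP; rewrite eq_le; apply/andP; split; last first.
  by apply: le_cover_outer => x Ax n _; have [_ + _] := BP n; apply.
apply/lee_addgt0Pr => e e0.
have [n _ /(_ n (leqnn n)) /= ne] := near_infty_natSinv_lt (PosNum e0).
apply: (@le_trans _ _ (lam (B n))); first by apply: le_cover_outer => x; apply.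
have [_ _ /le_trans] := BP n; apply.
by apply: leeD2l; rewrite lee_fin ltW.
Qed.

(** On bounded parts the Borel hull exceeds the set by a null set, itself
    contained in a Borel null set. *)
Lemma lebesgue_measurable_borel_ae (E : set V) : measurable (E : set LV) ->
  exists N : set BV, [/\ measurable N, lam N = 0 & measurable (E `&` ~` N : set BV)].
Proof.
move=> mE.
pose En n := E `&` eball (0 : V) n%:R.
have mEn n : measurable (En n : set LV).
  by apply: measurableI => //; apply: measurable_lebesgue; exact: measurable_eball.
have ex n : exists BN : set BV * set BV, [/\ measurable BN.1, measurable BN.2,
    lam BN.2 = 0, En n `<=` BN.1 & BN.1 `\` En n `<=` BN.2].
  have [B [mB EB BE]] := borel_hull (En n).
  have D0 : lam (B `\` En n) = 0.
    have mB' := measurable_lebesgue mB.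
    have Eoo : lam (En n) < +oo.
      by apply: le_lt_trans (lebesgue_eball_lty (0 : V) n%:R); apply: le_cover_outer => x [].
    have := @measureD _ LV _ (lebesgue_Rd R d) _ _ mB' (mEn n).
    rewrite /= BE => /(_ Eoo) ->; rewrite (setIidr EB).
    by rewrite subee// ge0_fin_numE// cover_outer_ge0//; exact: box_volume_ge0.
  have [N [mN DN N0]] := borel_hull (B `\` En n).
  by exists (B, N); split => //=; rewrite N0.
have [BN BNP] := choice ex.
pose N := \bigcup_n (BN n).2.
have mN : measurable N by apply: bigcup_measurable => n _; have [] := BNP n.
exists N; split => //.
  apply/eqP; rewrite eq_le (_ : 0 <= lam N) ?andbT; last first.
    by rewrite cover_outer_ge0//; exact: box_volume_ge0.
  apply: le_trans (outer_measure_sigma_subadditive (@lebesgue_outer_measure R d) _) _.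
  by rewrite eseries0// => n _ _; have [] := BNP n.
rewrite (_ : _ `&` _ = \bigcup_n ((BN n).1 `&` ~` N)).
  apply: bigcup_measurable => n _; have [m1 _ _ _ _] := BNP n.
  by apply: measurableI => //; exact: measurableC.
apply/seteqP; split => x.
  move=> [Ex Nx]; have : (\bigcup_n eball (0 : V) n%:R) x by rewrite eball_cover.
  by move=> [n _ nx]; exists n => //; split => //; have [_ _ _ + _] := BNP n; apply.
move=> [n _ [Bx Nx]]; split => //.
have [_ _ _ _ h] := BNP n.
by have [[]//|nE] := pselect (En n x); exfalso; apply: Nx; exists n => //; apply: h.
Qed.

(** It is enough to remove a null set for each rational superlevel set.  The
    value on the null set is set to 0 rather than left undefined so that
    nonnegativity is kept. *)
Lemma lebesgue_measurable_fun_borel_ae (f : V -> R) :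
  measurable_fun [set: LV] (f : LV -> R) ->
  exists N : set BV, [/\ measurable N, lam N = 0 &
    measurable_fun [set: BV] (fun x : BV => if x \in N then 0%R else f x)].
Proof.
move=> mf.
have ex (q : rat) : exists N : set BV, [/\ measurable N, lam N = 0 &
    measurable ((f @^-1` `]ratr q, +oo[) `&` ~` N : set BV)].
  apply: lebesgue_measurable_borel_ae; rewrite -[X in measurable X]setTI.
  by apply: mf => //; exact: measurable_itv.
have [Nq NqP] := choice ex.
pose F (n : nat) : set BV := if unpickle n is Some q then Nq q else set0.
pose N := \bigcup_n F n.
have mF n : measurable (F n) by rewrite /F; case: unpickle => // q; have [] := NqP q.
have mN : measurable N by apply: bigcup_measurable => n _; exact: mF.
have N0 : lam N = 0.
  apply/eqP; rewrite eq_le (_ : 0 <= lam N) ?andbT; last first.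
    by rewrite cover_outer_ge0//; exact: box_volume_ge0.
  apply: le_trans (outer_measure_sigma_subadditive (@lebesgue_outer_measure R d) _) _.
  rewrite eseries0// => n _ _; rewrite /F; case: unpickle => [q|]; first by have [] := NqP q.
  exact: (outer_measure0 (@lebesgue_outer_measure R d)).
exists N; split => //.
apply: (measurability _ (RGenOInfty.measurableE R)) => _ [_ [c ->] <-].
rewrite setTI.
(* The function is 0 on [N], so [N] is wanted if and only if [c < 0], that is,
   if some rational lies between [c] and 0. *)
pose A (q : rat) : set BV := if (c < ratr q)%R then
  ((f @^-1` `]ratr q, +oo[) `&` ~` N) `|` (if (ratr q < 0 :> R)%R then N else set0) else set0.
rewrite (_ : _ @^-1` _ = \bigcup_(q : rat) A q).
  apply: bigcupT_measurable_rat => q; rewrite /A; case: ifPn => // _.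
  apply: measurableU; last by case: ifPn.
  have [m1 _ m2] := NqP q.
  rewrite (_ : _ `&` _ = (f @^-1` `]ratr q, +oo[) `&` ~` Nq q `&` ~` N).
    by apply: measurableI => //; exact: measurableC.
  apply/seteqP; split => x; last by move=> [[]].
  move=> [fx Nx]; split => //; split => // h; apply: Nx.
  exists (pickle q); first exact: I.
  by rewrite /F pickleK.
apply/seteqP; split => x /=.
  rewrite in_itv/= andbT; case: ifPn => xN cx.
    have [q cq] := rat_in_itvoo cx; exists q => //; rewrite /A.
    move: cq; rewrite in_itv/= => /andP[-> ->]; right; exact/set_mem.
  have [q cq] := rat_in_itvoo cx; exists q => //; rewrite /A.
  move: cq; rewrite in_itv/= => /andP[-> qf]; left; split => /=.
    by rewrite in_itv/= qf.
  by move: xN; rewrite notin_setE.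
move=> [q _]; rewrite /A; case: ifPn => // cq [[/=]|].
  rewrite !in_itv/= !andbT => qf Nx; rewrite (memNset Nx).
  exact: lt_trans cq qf.
by case: ifPn => // q0 /mem_set ->; rewrite in_itv/= andbT (lt_trans cq).
Qed.

End lebesgue_borel.

Section radial_reduction.
Context {R : realType} {d : nat}.
Hypothesis d_gt0 : (0 < d)%N.
Local Notation V := 'rV[R]_d.
Local Notation BV := (borelV R d).
Local Notation LV := (lebesgue_type R d).
Local Notation lam := (lebB R d).
Local Notation sigma := (@cone_measure R d).
Local Notation S := (@unit_sphere R d).
Local Notation rho := (@rho R d).
Local Notation s0 := (fine (sigma S)).
Local Open Scope ereal_scope.

Lemma cone_measureT : sigma setT = s0%:E.
Proof.
rewrite fineK ?cone_measure_fin//; last exact: measurable_sphere.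
by rewrite -(cone_measure_sphereC measurableT) setIT.
Qed.

Lemma s0_gt0 : (0 < s0)%R. Proof. exact: cone_sphere_gt0. Qed.

Lemma measurable_shift (x : V) : measurable_fun [set: BV] (fun y : BV => (x + y)%R : BV).
Proof.
rewrite (_ : (fun _ => _) = (fun y : BV => (1 *: y + x)%R : BV)).
  exact: measurable_linear.
by apply/funext => y; rewrite scale1r addrC.
Qed.

Lemma measurable_shift_scale (x : V) :
  measurable_fun [set: R * BV] (fun z : R * BV => (x + z.1 *: z.2)%R : BV).
Proof.
apply: measurable_to_borelV => i.
rewrite (_ : (fun _ => _) = (fun z : R * BV => x ord0 i + z.1 * z.2 ord0 i))%R; last first.
  by apply/funext => z; rewrite !mxE.
apply: measurable_funD => //; apply: measurable_funM => //.
exact: (measurableT_comp (measurable_coord i)).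
Qed.

Lemma shift_sigma_finite (x : V) : sigma_finite [set: BV]
  (pushforward lam (fun y : BV => (- x + y)%R : BV)).
Proof.
apply: sigma_finite_eball => n.
apply: le_lt_trans (lebesgue_eball_lty x n%:R); apply: le_cover_outer => y.
by rewrite /eball/= sub0r opprD opprK.
Qed.

Lemma integral_lebesgue_polar (g : BV -> R) (G : R -> R) (x : V) :
  measurable_fun [set: BV] g -> measurable_fun [set: R] G ->
  (forall y, 0 <= g y)%R -> (forall r, 0 <= G r)%R ->
  \int[lam]_y (G (enorm (x - y)) * g y)%:E =
  \int[rho]_r \int[sigma]_w (G r * g (x + r *: w))%:E.
Proof.
move=> mg mG g0 G0.
pose F (z : R * BV) : \bar R := (G z.1 * g (x + z.2))%:E.
have mF : measurable_fun [set: R * BV] (fun z : R * BV => (G z.1 * g (x + z.1 *: z.2))%:E).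
  apply/measurable_EFinP; apply: measurable_funM; first exact: (measurableT_comp mG).
  exact: (measurableT_comp mg (measurable_shift_scale x)).
have mh : measurable_fun [set: BV] (fun z : BV => (G (enorm z) * g (x + z)%R)%:E).
  apply/measurable_EFinP; apply: measurable_funM.
    exact: (measurableT_comp mG measurable_enorm).
  exact: (measurableT_comp mg (measurable_shift x)).
have F0 (z : R * BV) : 0 <= (G z.1 * g (x + z.1 *: z.2))%:E by rewrite lee_fin mulr_ge0.
rewrite -(integral_polar d_gt0 mF F0).
under [RHS]eq_integral do rewrite -enorm_scale_direction.
transitivity (\int[lam]_y (G (enorm (- x + y)) * g (x + (- x + y)))%:E).
  by apply: eq_integral => y _; rewrite addrA subrr add0r [(- x + y)%R]addrC enormB.
rewrite -(ge0_integral_image_measure (measurable_shift (- x)) (shift_sigma_finite x) mh); last first.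
  by move=> z; rewrite lee_fin mulr_ge0.
apply: eq_measure_integral => A mA _.
rewrite -[RHS](lebB_translate (- x)).
by congr (lam _); apply/seteqP; split => y /=; rewrite addrC.
Qed.

(** Polar coordinates applied to the indicator of [N]. *)
Lemma sphere_section_null (N : set BV) (x : V) : measurable N -> lam N = 0 ->
  exists A : set R, [/\ measurable A, rho A = 0 &
    forall r, ~ A r -> sigma [set w : V | N (x + r *: w)%R] = 0].
Proof.
move=> mN N0.
have mS r : measurable ([set w : V | N (x + r *: w)%R] : set BV).
  rewrite (_ : [set _ | _] = (fun w : BV => (r *: w + x)%R : BV) @^-1` N).
    by rewrite -[X in measurable X]setTI; apply: measurable_linear.
  by apply/seteqP; split => w /=; rewrite addrC.
have := @integral_lebesgue_polar \1_N (fun=> 1%R) x (measurable_indic mN)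
  (measurable_cst _) (fun=> ltac:(by [])) (fun=> ler01).
rewrite [LHS](_ : _ = 0); last first.
  under eq_integral do rewrite mul1r.
  by rewrite integral_indic// setIT.
move/esym => h.
pose F (r : R) := \int[sigma]_w (1 * \1_N (x + r *: w))%:E.
have FE r : F r = sigma [set w : V | N (x + r *: w)%R].
  rewrite /F -[X in _ = sigma X]setIT -integral_indic//; apply: eq_integral => w _.
  by rewrite mul1r !indicE.
have mF : measurable_fun [set: R] F.
  apply: (@measurable_fun_fubini_tonelli_F _ _ _ _ _ sigma
    (fun z : R * BV => (1 * \1_N (x + z.1 *: z.2))%:E)) => //.
  apply/measurable_EFinP; apply: measurable_funM => //.
  exact: (measurableT_comp (measurable_indic mN) (measurable_shift_scale x)).
have := (@ae_eq_integral_abs _ _ _ rho setT measurableT F mF).1.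
rewrite (eq_integral F); last first.
  by move=> r _; rewrite gee0_abs// FE.
move=> /(_ h) [A [mA A0 hA]]; exists A; split => // r Ar.
rewrite -FE; apply: contrapT => Fr; apply: Ar; apply: hA => /= /(_ I).
exact: Fr.
Qed.

Section section_average.
Variables (f : V -> R) (g : BV -> R) (N : set BV) (x : V) (r : R).
Hypotheses (f0 : forall y, (0 <= f y)%R) (mg : measurable_fun [set: BV] g)
  (g0 : forall y, (0 <= g y)%R) (mN : measurable N)
  (gf : forall y, ~ N y -> g y = f y) (r0 : (0 < r)%R)
  (null : sigma [set w : V | N (x + r *: w)%R] = 0).

Let mrw : measurable_fun [set: BV] (fun w : BV => (x + r *: w)%R : BV).
Proof.
rewrite (_ : (fun _ => _) = (fun w : BV => (r *: w + x)%R : BV)).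
  exact: measurable_linear.
by apply/funext => w; rewrite addrC.
Qed.

Let mh : measurable_fun [set: BV] (fun w : BV => (g (x + r *: w)%R)%:E).
Proof. by apply/measurable_EFinP; exact: (measurableT_comp mg mrw). Qed.

Let mP : measurable ([set w : V | N (x + r *: w)%R] : set BV).
Proof. by rewrite -[X in measurable X]setTI; exact: mrw. Qed.

(** In dimension 1 the sphere has two points, exchanged by a reflection, so each
    carries half of the cone measure. *)
Lemma sphere_average_one : d = 1%N ->
  (((f (x + const_mx r) + f (x - const_mx r)) / 2)%R =
   s0^-1 * fine (\int[sigma]_w (g (x + r *: w)%R)%:E))%R.
Proof.
move=> d1; pose p : V := const_mx 1%R.
have i0 : 'I_d by exact: Ordinal d_gt0.
have Vi (i : 'I_d) : i = i0.
  suff h n (i1 j1 : 'I_n) : n = 1%N -> i1 = j1 by exact: h.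
  by move=> n1; subst n; rewrite [i1]ord1 [j1]ord1.
have enE (w : V) : enorm w = `|w ord0 i0|%R.
  rewrite /enorm (bigD1 i0)//= big1 ?addr0 ?sqrtr_sqr// => i /negP[]; exact/eqP/Vi.
have pE i : p ord0 i = 1%R by rewrite mxE.
have SE : S = [set p] `|` [set - p]%R.
  apply/seteqP; split => w; rewrite /unit_sphere/= enE.
    move=> /eqP; rewrite eqr_norml ler01 andbT => /orP[] /eqP e; [left|right].
      by apply/rowP => i; rewrite (Vi i) e !mxE.
    by apply/rowP => i; rewrite (Vi i) e !mxE.
  by move=> [->|->]; rewrite !mxE ?normrN normr1.
have m1 : measurable ([set p] : set BV).
  rewrite (_ : [set p] = S `&` (fun y : BV => y ord0 i0) @^-1` `]0%R, +oo[).
    apply: measurableI; first exact: measurable_sphere.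
    by rewrite -[X in measurable X]setTI; apply: measurable_coord => //; exact: measurable_itv.
  apply/seteqP; split => w; rewrite SE /=.
    by move=> ->; split; [left|rewrite in_itv/= mxE ltr01].
  by move=> [[->//|->]]; rewrite in_itv/= !mxE oppr_gt0 ltr10.
have m2 : measurable ([set - p]%R : set BV).
  rewrite (_ : [set - p]%R = S `&` (fun y : BV => y ord0 i0) @^-1` `]-oo, 0%R[).
    apply: measurableI; first exact: measurable_sphere.
    by rewrite -[X in measurable X]setTI; apply: measurable_coord => //; exact: measurable_itv.
  apply/seteqP; split => w; rewrite SE /=.
    by move=> ->; split; [right|rewrite in_itv/= !mxE oppr_lt0 ltr01].
  by move=> [[->|->//]]; rewrite in_itv/= !mxE ltr10.
have pNp : (p != - p)%R.
  apply/negP => /eqP/rowP/(_ i0); rewrite !mxE => /eqP.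
  by rewrite -subr_eq0 opprK -mulr2n pnatr_eq0.
have enp : enorm p = 1%R by rewrite enE pE normr1.
have rp : reflection p p = (- p)%R.
  by rewrite /reflection dotpxx enp expr1n divr1 mulr1 scaler_nat mulr2n opprD addNKr.
have e12 : sigma [set - p]%R = sigma [set p].
  rewrite -(cone_measure_reflection p)//; congr (sigma _).
  apply/seteqP; split => w /=; last by move=> ->.
  by move=> /(congr1 (reflection p)); rewrite reflectionK -rp reflectionK.
have disj : [set p] `&` [set - p]%R = set0 :> set V.
  by apply/seteqP; split => w //= [-> /eqP]; rewrite (negbTE pNp).
have half : sigma [set p] = (s0 / 2)%:E.
  have f1 : sigma [set p] \is a fin_num by exact: cone_measure_fin.
  have hS : s0%:E = sigma [set p] + sigma [set p].
    transitivity (sigma S); last by rewrite -[X in _ = _ + X]e12 SE; exact: measureU.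
    by rewrite fineK// cone_measure_fin//; exact: measurable_sphere.
  by move: hS; rewrite -(fineK f1) -EFinD => -[->]; congr EFin; field.
have [c cE] : {c | c = s0 / 2}%R by eexists.
rewrite -cE in half.
have c0 : (0 < c)%R by rewrite cE divr_gt0// s0_gt0.
pose nu : {measure set BV -> \bar R} := mscale (NngNum (ltW c0)) (measure_add (@dirac _ BV p R) (@dirac _ BV (- p)%R R)).
have -> : \int[sigma]_w (g (x + r *: w)%R)%:E = \int[nu]_w (g (x + r *: w)%R)%:E.
  apply: eq_measure_integral => A mA _.
  have nuA : nu A = c%:E * ((p \in A)%:R%:E + ((- p)%R \in A)%:R%:E).
    transitivity (c%:E * measure_add (@dirac _ BV p R) (@dirac _ BV (- p)%R R) A); first by [].
    by rewrite (measure_addE (@dirac _ BV p R) (@dirac _ BV (- p)%R R))/= !diracE.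
  rewrite [RHS](_ : _ = c%:E * ((p \in A)%:R%:E + ((- p)%R \in A)%:R%:E))//.
  rewrite [LHS](_ : _ = sigma (S `&` A)); last by rewrite cone_measure_sphereC.
  rewrite SE setIUl measureU; [|exact: measurableI|exact: measurableI|]; last first.
    by rewrite setIACA disj set0I.
  have h q : sigma [set q] = (c)%:E -> sigma ([set q] `&` A) = (c * (q \in A)%:R)%:E.
    move=> hq; have [qA|qA] := boolP (q \in A).
      rewrite mulr1 -hq; congr (sigma _); apply/seteqP; split => w /=; first by case.
      by move=> ->; split => //; exact/set_mem.
    rewrite mulr0 (_ : _ `&` _ = set0) ?measure0//.
    by apply/seteqP; split => w //= [-> /mem_set]; rewrite (negbTE qA).
  transitivity (sigma ([set p] `&` A) + sigma ([set - p]%R `&` A)); first by [].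
  by rewrite (h p)// (h (- p)%R) ?e12// -!EFinD -EFinM mulrDr.
rewrite ge0_integral_mscale//; last by move=> w _; rewrite lee_fin.
rewrite ge0_integral_measure_add//; last by move=> w _; rewrite lee_fin.
have dE q : \int[@dirac _ BV q R]_y (g (x + r *: y)%R)%:E = (g (x + r *: q)%R)%:E.
  by rewrite (integral_dirac q measurableT mh) diracT mul1e.
rewrite (dE p) (dE (- p)%R).
have offN q : sigma [set q] = (c)%:E -> g (x + r *: q)%R = f (x + r *: q)%R.
  move=> hq; apply: gf => Nq.
  have := @le_measure _ _ _ sigma [set q] [set w : V | N (x + r *: w)%R].
  rewrite !inE => /(_ _ mP) h.
  have : (c)%:E <= 0%E.
    rewrite -hq -null; apply: le_cover_outer => w [h1 h2]; split => //.
    by move: h1; rewrite /=/direction => ->.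
  by rewrite lee_fin leNgt c0.
rewrite offN// offN ?e12//=.
have -> : (r *: p)%R = const_mx r by apply/rowP => i; rewrite !mxE mulr1.
have -> : (r *: - p)%R = (- const_mx r)%R by apply/rowP => i; rewrite !mxE mulrN1.
rewrite cE; have := s0_gt0; set s := s0 => ss; field; exact: lt0r_neq0.
Qed.

(** The Hausdorff measure of the sphere is proportional to the cone measure, so
    the normalised averages agree.  The function [f] is measurable on the sphere
    because the Caratheodory measure is complete. *)
Lemma sphere_average_gt1 : (1 < d)%N ->
  ((fine (hausdorff R d d.-1 S))^-1 *
     \int[hausdorff R d d.-1]_(w in S) f (x + `|r| *: w) =
   s0^-1 * fine (\int[sigma]_w (g (x + r *: w)%R)%:E))%R.
Proof.
move=> d1; rewrite gtr0_norm//.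
have mS := @measurable_sphere_hausdorff R d.
have HP : hausdorff R d d.-1 ([set w : V | N (x + r *: w)%R] `&` S) = 0.
  transitivity (hausS d1 [set w : V | N (x + r *: w)%R]); first by [].
  by rewrite hausS_proportional// [X in _ * X](_ : _ = 0) ?mule0.
have ae : ae_eq (hausdorff R d d.-1) S (fun w => (g (x + r *: w)%R)%:E)
    (fun w => (f (x + r *: w)%R)%:E).
  exists ([set w : V | N (x + r *: w)%R] `&` S); split => //.
    by apply: measurableI => //; exact: measurable_hausdorff.
  move=> w /= h; split.
    by apply: contrapT => Nw; apply: h => _; rewrite gf.
  by apply: contrapT => Sw; apply: h => /Sw.
have mgH : measurable_fun (S : set (hausdorff_type R d d.-1)) (fun w => (g (x + r *: w)%R)%:E).
  apply: measurable_funTS.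
  exact: (measurableT_comp mh (@measurable_id_hausdorff R d)).
have mfH := ae_measurable_fun (@measure_is_complete_caratheodory _ _ _) ae mgH.
rewrite /Rintegral -(ge0_ae_eq_integral mS mgH mfH _ _ ae); first last.
- by move=> w _; rewrite lee_fin.
- by move=> w _; rewrite lee_fin.
have <- : \int[hausS d1]_w (g (x + r *: w)%R)%:E =
    \int[hausdorff R d d.-1]_(w in S) (g (x + r *: w)%R)%:E.
  rewrite (ge0_integral_image_measure (@measurable_id_hausdorff R d) (hausS_sigma_finite d1) mh); last first.
    by move=> w; rewrite lee_fin.
  have mgT : measurable_fun [set: hausdorff_type R d d.-1] (fun w => (g (x + r *: w)%R)%:E).
    exact: (measurableT_comp mh (@measurable_id_hausdorff R d)).
  have g0T (w : hausdorff_type R d d.-1) : 0 <= (g (x + r *: w)%R)%:E by rewrite lee_fin.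
  exact: (ge0_integral_mrestr (hausdorff R d d.-1) measurable_sphere_hausdorff mgT g0T).
have q0 : (0 <= @sphere_ratio R d)%R.
  by rewrite /sphere_ratio divr_ge0// fine_ge0// hausdorff_outer_ge0.
have -> : \int[hausS d1]_w (g (x + r *: w)%R)%:E =
    (@sphere_ratio R d)%:E * \int[sigma]_w (g (x + r *: w)%R)%:E.
  rewrite -(ge0_integral_mscale _ measurableT (NngNum q0))//; last first.
    by move=> w _; rewrite lee_fin.
  apply: eq_measure_integral => A mA _; rewrite [LHS]hausS_proportional//.
have H0 : fine (hausdorff R d d.-1 S) != 0%R.
  apply: lt0r_neq0; rewrite -lte_fin fineK; last exact: hausdorff_sphere_fin.
  exact: hausdorff_sphere_gt0.
have s0' : s0 != 0%R by rewrite gt_eqF// s0_gt0.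
have : 0 <= \int[sigma]_w (g (x + r *: w)%R)%:E.
  by apply: integral_ge0 => w _; rewrite lee_fin.
case: (\int[sigma]_w _) => [I|_|//] /=.
  move=> _; rewrite mulrA; congr (_ * _)%R.
  by rewrite /sphere_ratio mulKf.
rewrite gt0_muley ?mulr0//= lte_fin divr_gt0//; last exact: s0_gt0.
rewrite -lte_fin fineK; last exact: hausdorff_sphere_fin.
exact: hausdorff_sphere_gt0.
Qed.

End section_average.

(** Integrals of a radial weight against [f] see [f] only through its radial
    average.  The average agrees with the Borel function [fbar] for almost every
    radius only, since a Lebesgue measurable function is Borel off a null set. *)
Lemma radial_reduction (f : V -> R) (M : R) (x : V) :
  measurable_fun [set: LV] (f : LV -> R) -> (forall y, 0 <= f y <= M)%R ->
  exists (fbar : R -> R) (A : set R),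
    [/\ measurable_fun [set: R] fbar, forall r, (0 <= fbar r <= M)%R,
        measurable A /\ rho A = 0,
        forall r, (0 < r)%R -> ~ A r -> radial_avg f x r = fbar r &
        forall G : R -> R, measurable_fun [set: R] G -> (forall r, 0 <= G r)%R ->
          \int[lebesgue_Rd R d]_y (G (enorm (x - y)) * f y)%:E =
          s0%:E * \int[rho]_r (G r * fbar r)%:E].
Proof.
move=> mf f0M; have f0 y : (0 <= f y)%R by have /andP[] := f0M y.
have [N [mN N0 mg]] := lebesgue_measurable_fun_borel_ae mf.
set g := (fun _ => _) in mg.
have gf y : ~ N y -> g y = f y by move=> Ny; rewrite /g memNset.
have gM y : (0 <= g y <= M)%R.
  by rewrite /g; case: ifP => // _; rewrite lexx/=; have /andP[/le_trans] := f0M y; exact.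
have g0 y : (0 <= g y)%R by have /andP[] := gM y.
have [A [mA A0 hA]] := sphere_section_null x mN N0.
pose I r := \int[sigma]_w (g (x + r *: w)%R)%:E.
have mrw r : measurable_fun [set: BV] (fun w : BV => (g (x + r *: w)%R)%:E).
  apply/measurable_EFinP; apply: (measurableT_comp mg).
  rewrite (_ : (fun _ => _) = (fun w : BV => (r *: w + x)%R : BV)).
    exact: measurable_linear.
  by apply/funext => w; rewrite addrC.
have I0 r : 0 <= I r by apply: integral_ge0 => w _; rewrite lee_fin.
have IM r : I r <= (M * s0)%:E.
  rewrite EFinM -cone_measureT -integral_cst//.
  apply: ge0_le_integral => //.
  - by move=> w _; rewrite lee_fin.
  by move=> w _; rewrite lee_fin; have /andP[] := gM (x + r *: w)%R.
have IF r : I r \is a fin_num.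
  by rewrite ge0_fin_numE// (le_lt_trans (IM r))// ltry.
have ss := s0_gt0.
have mI : measurable_fun [set: R] (fun r => s0^-1 * fine (I r))%R.
  apply: measurable_funM => //; apply/measurable_EFinP.
  rewrite (_ : _ \o _ = I); last by apply/funext => r /=; rewrite fineK.
  apply: (@measurable_fun_fubini_tonelli_F _ _ _ _ _ sigma
    (fun z : R * BV => (g (x + z.1 *: z.2))%:E)) => //.
    by apply/measurable_EFinP; exact: (measurableT_comp mg (measurable_shift_scale x)).
  by move=> z; rewrite lee_fin.
exists (fun r => s0^-1 * fine (I r))%R, A; split => //.
- move=> r; rewrite mulr_ge0 ?invr_ge0 ?(ltW ss) ?fine_ge0//=.
  by rewrite mulrC ler_pdivrMr// -lee_fin fineK.
- move=> r r0 Ar; rewrite /radial_avg; case: ifP => [/eqP d1|d1].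
    apply: (@sphere_average_one f g N x r) => //; exact: hA.
  apply: (@sphere_average_gt1 f g N x r) => //; first exact: hA.
  by move: d1 d_gt0; case: (d) => [|[]].
move=> G mG G0.
have mid : measurable_fun [set: LV] (id : LV -> BV) by exact: measurable_id_lebesgue.
have mGB : measurable_fun [set: BV] (fun y : BV => G (enorm (x - y))).
  apply: (measurableT_comp mG).
  rewrite (_ : (fun _ => _) = @enorm R d \o (fun y : BV => ((-1) *: y + x)%R : BV)).
    apply: (measurableT_comp measurable_enorm); exact: measurable_linear.
  by apply/funext => y; rewrite /= scaleN1r addrC.
have mGL : measurable_fun [set: LV] (fun y : LV => G (enorm (x - y))).
  exact: (measurableT_comp mGB mid).
rewrite (ge0_ae_eq_integral (g := fun y : LV => (G (enorm (x - y)) * g y)%:E) measurableT); first last.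
- exists N; split => //; first exact: measurable_lebesgue.
  move=> y /= h; apply: contrapT => Ny; apply: h => _; by rewrite gf.
- by move=> y _; rewrite lee_fin mulr_ge0.
- by move=> y _; rewrite lee_fin mulr_ge0.
- apply/measurable_EFinP; apply: measurable_funM => //.
  exact: (measurableT_comp mg mid).
- by apply/measurable_EFinP; exact: measurable_funM.
transitivity (\int[lam]_y (G (enorm (x - y)) * g y)%:E).
  rewrite (ge0_integral_image_measure (@measurable_id_lebesgue R d) (@lebB_sigma_finite R d))//.
    by apply/measurable_EFinP; exact: measurable_funM.
  by move=> y; rewrite lee_fin mulr_ge0.
rewrite (integral_lebesgue_polar x mg mG g0 G0) -ge0_integralZl//; first last.
- by rewrite lee_fin ltW.
- by move=> r _; rewrite lee_fin !mulr_ge0 ?invr_ge0 ?(ltW ss) ?fine_ge0.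
- apply/measurable_EFinP; apply: measurable_funM => //.
apply: eq_integral => r _.
under eq_integral do rewrite EFinM.
rewrite ge0_integralZl//; last 2 first.
- by move=> w _; rewrite lee_fin.
- by rewrite lee_fin.
rewrite -EFinM [(s0 * _)%R]mulrCA mulVKf ?gt_eqF// EFinM fineK//.
Qed.

End radial_reduction.

(** * Heat solutions as Gaussian transforms *)

Section radial_measure.
Context {R : realType} {d : nat}.
Local Notation rho := (@rho R d).
Local Notation lam := (lebB R d).
Local Open Scope ereal_scope.

Lemma ler_pow_fact_expR (x : R) (n : nat) : (0 <= x)%R ->
  (x ^+ n <= n`!%:R * expR x)%R.
Proof.
move=> x0; case: n => [|n]; first by rewrite expr0 fact0 mul1r (le_trans _ (expR_ge1Dx x))// lerDl.
rewrite -ler_pdivrMl ?ltr0n ?fact_gt0// mulrC; apply: le_trans (expR_ge1Dxn n x0).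
by rewrite lerDr.
Qed.

Lemma measurable_gauss (s : R) :
  measurable_fun [set: R] (fun r : R => expR (- (s * r ^+ 2)))%R.
Proof.
apply: measurableT_comp => //; apply: measurableT_comp => //.
by apply: measurable_funM => //; exact: measurable_funX.
Qed.

(** On [[n, n + 1[] the integrand is at most [expR (- (s * n ^+ 2))], the mass at
    most [n.+1 ^+ d], and the product decays geometrically. *)
Lemma rho_gauss_lty (s : R) : (0 < s)%R -> \int[rho]_r (expR (- (s * r ^+ 2)))%:E < +oo.
Proof.
move=> s0.
pose A (n : nat) : set R := if n is 0%N then `]-oo, 1%R[%classic else `[n%:R, n.+1%:R[%classic.
have mA n : measurable (A n) by case: n => [|n]; exact: measurable_itv.
have rA n : rho (A n) <= (n.+1%:R ^+ d)%:E.
  rewrite -rho_ray ?ltr0n//; apply: le_measure; rewrite ?inE//.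
  by case: n => [|n] r //=; rewrite !in_itv/= => /andP[].
pose f n (r : R) := (expR (- (s * n%:R ^+ 2)) * \1_(A n) r)%:E.
have f0 n r : 0 <= f n r by rewrite lee_fin mulr_ge0// expR_ge0.
have mf n : measurable_fun [set: R] (f n).
  by apply/measurable_EFinP; apply: measurable_funM => //; exact: measurable_indic.
apply: (@le_lt_trans _ _ (\int[rho]_r (\sum_(n <oo) f n r))).
  apply: ge0_le_integral => //.
  - apply/measurable_EFinP; apply: measurableT_comp => //.
    by apply: measurableT_comp => //; apply: measurable_funM => //; exact: measurable_funX.
  - exact: ge0_emeasurable_sum.
  move=> r _.
  have [n [nr ns]] : exists n, A n r /\ (expR (- (s * r ^+ 2)) <= expR (- (s * n%:R ^+ 2)))%R.
    have [r1|r1] := ltP r 1%R.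
      exists 0%N; split; first by rewrite /A/= in_itv.
      by rewrite ler_expR expr0n/= mulr0 oppr0 oppr_le0 mulr_ge0// ?sqr_ge0// ltW.
    have r0 : (0 <= r)%R by apply: le_trans r1.
    have /andP[h1 h2] := truncn_itv r0.
    exists (Num.truncn r); split.
      rewrite /A; case: (Num.truncn r) h1 h2 => [|n] h1 h2 /=; rewrite in_itv/= ?h2//.
      by rewrite h1.
    by rewrite ler_expR lerN2 ler_pM2l// ler_sqr ?nnegrE.
  apply: le_trans (nneseries_lim_ge n.+1 _) => //; rewrite big_nat_recr//=.
  rewrite -[leLHS]add0e; apply: leeD; first by apply: sume_ge0.
  by rewrite lee_fin indicE mem_set// mulr1.
rewrite integral_nneseries//.
pose C := (d`!%:R * expR (1 + s^-1))%R.
apply: (@le_lt_trans _ _ (\sum_(n <oo) (C * 2 / (2 ^ (n + 1))%:R)%:E)); last first.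
  have := @cvg_geometric_eseries_half R (C * 2) 0.
  by move=> /cvg_lim => ->//; rewrite ltry.
apply: lee_nneseries => [n _ _|n _]; first exact: integral_ge0.
rewrite /f; under eq_integral do rewrite EFinM.
rewrite ge0_integralZl//; last first.
  by apply/measurable_EFinP; exact: measurable_indic.
rewrite integral_indic// setIT.
apply: (@le_trans _ _ ((expR (- (s * n%:R ^+ 2)))%:E * (n.+1%:R ^+ d)%:E)).
  by apply: lee_pmul => //; rewrite ?lee_fin ?expR_ge0//; exact: rA.
rewrite -EFinM lee_fin.
apply: (@le_trans _ _ (expR (- (s * n%:R ^+ 2)) * (d`!%:R * expR n.+1%:R)))%R.
  by rewrite ler_pM2l ?expR_gt0// ler_pow_fact_expR.
rewrite mulrCA -expRD -mulrA -mulrA ler_pM2l ?ltr0n ?fact_gt0//.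
rewrite addn1 expnS natrM invfM mulVKf//.
(* completing the square in [n] *)
have h : (- (s * n%:R ^+ 2) + n.+1%:R <= 1 + s^-1 - n%:R :> R)%R.
  rewrite -natr1; move: (n%:R : R)%R => x.
  have : (0 <= s * (x - s^-1) ^+ 2)%R by rewrite mulr_ge0 ?sqr_ge0// ltW.
  have -> : (s * (x - s^-1) ^+ 2 = s * x ^+ 2 - 2 * x + s^-1)%R by field; rewrite gt_eqF.
  lra.
apply: (@le_trans _ _ (expR (1 + s^-1 - n%:R)))%R; first by rewrite ler_expR.
rewrite expRD ler_pM2l ?expR_gt0// expRN lef_pV2 ?posrE ?expR_gt0 ?ltr0n ?expn_gt0//.
have e2 : (2 <= expR 1 :> R)%R by apply: le_trans (expR_ge1Dx 1); rewrite -natr1.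
rewrite natrX (_ : expR n%:R = expR 1 ^+ n)%R; last by rewrite -expRM_natr mul1r.
by apply: lerXn2r; rewrite ?nnegrE// ltW ?expR_gt0.
Qed.

(** This is how the two diffusion coefficients are brought to a common one. *)
Lemma rho_scale (k : R) (F : R -> \bar R) : (0 < k)%R ->
  measurable_fun [set: R] F -> (forall r, 0 <= F r) ->
  \int[rho]_r F r = (k ^+ d)%:E * \int[rho]_r F (k * r)%R.
Proof.
move=> k0 mF F0.
have mk : measurable_fun [set: R] (fun r => k * r)%R by exact: measurable_funM.
have kd : (0 <= k^-1 ^+ d)%R by rewrite exprn_ge0// invr_ge0 ltW.
have := ge0_integral_pushforward mk rho measurableT mF (fun y _ => F0 y).
rewrite preimage_setT => <-.
rewrite [X in _ = _ * X](_ : _ = \int[mscale (NngNum kd) rho]_r F r); last first.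
  apply: eq_measure_integral => A mA _.
  rewrite /pushforward/= /mscale/= !rhoE muleCA -lebB_scale//; congr (_ * lam _).
  apply/seteqP; split => y /=; by rewrite enormZ gtr0_norm.
rewrite ge0_integral_mscale//= muleA -EFinM -exprMn mulfV ?gt_eqF// expr1n mul1e//.
Qed.

Lemma gauss_integrable (W : R -> R) (M s : R) : measurable_fun [set: R] W ->
  (forall r, `|W r| <= M)%R -> (0 < s)%R ->
  rho.-integrable setT (fun r => (expR (- (s * r ^+ 2)) * W r)%:E).
Proof.
move=> mW WM s0.
have mg : measurable_fun [set: R] (fun r : R => expR (- (s * r ^+ 2)))%R.
  exact: measurable_gauss.
have M0 : (0 <= M)%R by apply: le_trans (WM 0%R).
apply: (@le_integrable _ _ R rho setT measurableT _ (fun r => M%:E * (expR (- (s * r ^+ 2)))%:E)).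
- by apply/measurable_EFinP; exact: measurable_funM.
- move=> r _; rewrite -EFinM !abse_EFin lee_fin normrM mulrC normrM (ger0_norm M0) (ger0_norm (expR_ge0 _)).
  by rewrite ler_wpM2r ?expR_ge0.
apply: integrableZl => //; apply/integrableP; split; first exact/measurable_EFinP.
under eq_integral do rewrite gee0_abs ?lee_fin ?expR_ge0//.
exact: rho_gauss_lty.
Qed.

End radial_measure.

Section heat_radial.
Context {R : realType} {d : nat}.
Hypothesis d_gt0 : (0 < d)%N.
Local Notation V := 'rV[R]_d.
Local Notation LV := (lebesgue_type R d).
Local Notation rho := (@rho R d).
Local Notation s0 := (fine (@cone_measure R d (@unit_sphere R d))).

(** A Laplace transform in the variable [r ^+ 2]; the parameter [s] plays the role
    of an inverse time. *)
Definition gauss_weight (W : R -> R) (s : R) : R :=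
  (\int[rho]_r (expR (- (s * r ^+ 2)) * W r))%R.

Lemma heat_sol_radial (f : V -> R) (M : R) (x : V) :
  measurable_fun [set: LV] (f : LV -> R) -> (forall y, 0 <= f y <= M) ->
  exists (fbar : R -> R) (A : set R),
    [/\ measurable_fun [set: R] fbar, forall r, 0 <= fbar r <= M,
        measurable A /\ rho A = 0,
        forall r, 0 < r -> ~ A r -> radial_avg f x r = fbar r &
        forall c t, 0 < c -> 0 < t -> heat_sol c f x t =
          (Num.sqrt (4 * pi * c * t) ^+ d)^-1 * s0 *
          gauss_weight fbar (4 * c * t)^-1].
Proof.
move=> mf fM; have [fbar [A [mfbar fbarM A0 Af fG]]] := radial_reduction d_gt0 x mf fM.
exists fbar, A; split => // c t c0 t0.
pose K := (Num.sqrt (4 * pi * c * t) ^+ d)^-1.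
have K0 : 0 <= K by rewrite invr_ge0 exprn_ge0// sqrtr_ge0.
pose G (r : R) := K * expR (- ((4 * c * t)^-1 * r ^+ 2)).
have mg : measurable_fun [set: R] (fun r : R => expR (- ((4 * c * t)^-1 * r ^+ 2))).
  exact: measurable_gauss.
have mG : measurable_fun [set: R] G by exact: measurable_funM.
have G0 r : 0 <= G r by rewrite mulr_ge0// expR_ge0.
have fb r : `|fbar r| <= M by have /andP[h1 h2] := fbarM r; rewrite ger0_norm.
have ct : 0 < (4 * c * t)^-1 by rewrite invr_gt0 !mulr_gt0.
have int := @gauss_integrable R d _ _ _ mfbar fb ct.
rewrite /heat_sol /Rintegral.
under eq_integral => y _ do rewrite /heat_kernel [_ ^+ 2 / _]mulrC -/K.
rewrite (fG G mG G0) -(@fineK _ (\int[rho]_r _)%E); last first.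
  rewrite /G; under eq_integral do rewrite -(mulrA K) EFinM.
  by rewrite integralZl// fin_numM//; exact: integrable_fin_num.
rewrite -EFinM/= mulrAC mulrC; congr (_ * _); rewrite /gauss_weight.
rewrite -RintegralZl//; congr fine; apply: eq_integral => r _.
by rewrite /G mulrA.
Qed.

(** The radius in the second solution is rescaled by [k = sqrt (b / a)], which
    turns both Gaussian factors into the same one; the powers of [k] from the
    kernel and from the measure cancel. *)
Lemma heat_diff_radial (a b k Mu Mv : R) (u0 v0 : V -> R) (x : V) :
  0 < a -> 0 < k -> b = a * k ^+ 2 ->
  measurable_fun [set: LV] (u0 : LV -> R) -> (forall y, 0 <= u0 y <= Mu) ->
  measurable_fun [set: LV] (v0 : LV -> R) -> (forall y, 0 <= v0 y <= Mv) ->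
  exists (W : R -> R) (A : set R),
    [/\ measurable_fun [set: R] W, forall r, `|W r| <= Mu + Mv,
        measurable A /\ rho A = 0,
        forall r, 0 < r -> ~ A r ->
          W r = radial_avg u0 x r - radial_avg v0 x (k * r) &
        forall t, 0 < t -> heat_sol a u0 x t - heat_sol b v0 x t =
          (Num.sqrt (4 * pi * a * t) ^+ d)^-1 * s0 * gauss_weight W (4 * a * t)^-1].
Proof.
move=> a0 k0 bE mu uM mv vM.
have [ub [A [mub ubM [mA A0] Au uE]]] := heat_sol_radial x mu uM.
have [vb [B [mvb vbM [mB B0] Bv vE]]] := heat_sol_radial x mv vM.
have mk : measurable_fun [set: R] (fun r => k * r) by exact: measurable_funM.
have b0 : 0 < b by rewrite bE mulr_gt0// exprn_gt0.
have mvk : measurable_fun [set: R] (fun r => vb (k * r)) by exact: (measurableT_comp mvb mk).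
have mkB : measurable [set r | B (k * r)] by rewrite -[X in measurable X]setTI; exact: mk.
exists (fun r => ub r - vb (k * r)), (A `|` [set r | B (k * r)]); split.
- exact: measurable_funB.
- move=> r; have /andP[h1 h2] := ubM r; have /andP[h3 h4] := vbM (k * r).
  by rewrite (le_trans (ler_normB _ _))// !ger0_norm// lerD.
- split; first exact: measurableU.
  have : (rho B = (k ^+ d)%:E * rho [set r | B (k * r)%R])%E.
    rewrite -[B in LHS]setIT -integral_indic// (rho_scale k0)//.
      by congr (_ * _)%E; rewrite -[X in rho X]setIT -integral_indic.
    by apply/measurable_EFinP; exact: measurable_indic.
  rewrite B0 => /esym/eqP; rewrite mule_eq0 eqe expf_eq0 (gt_eqF k0) andbF/= => /eqP h.
  apply/eqP; rewrite eq_le measure_ge0 andbT.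
  apply: (@le_trans _ _ (rho A + rho [set r | B (k * r)%R])%E); first exact: measureU2.
  by rewrite A0 h adde0.
- move=> r r0 ABr; rewrite Au//; last by move=> ?; apply: ABr; left.
  by rewrite Bv ?mulr_gt0//; move=> ?; apply: ABr; right.
move=> t t0; rewrite (uE a t)// (vE b t)//.
have at0 : 0 < (4 * a * t)^-1 by rewrite invr_gt0 !mulr_gt0.
have bt0 : 0 < (4 * b * t)^-1 by rewrite invr_gt0 !mulr_gt0.
have vkb r : `|vb (k * r)| <= Mv by have /andP[h1 h2] := vbM (k * r); rewrite ger0_norm.
have ubb r : `|ub r| <= Mu by have /andP[h1 h2] := ubM r; rewrite ger0_norm.
have intv := @gauss_integrable R d _ _ _ mvk vkb at0.
have intu := @gauss_integrable R d _ _ _ mub ubb at0.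
have vs : gauss_weight vb (4 * b * t)^-1 = k ^+ d * gauss_weight (fun r => vb (k * r)) (4 * a * t)^-1.
  rewrite /gauss_weight /Rintegral (rho_scale k0).
  - have eI : (\int[rho]_r (expR (- ((4 * b * t)^-1 * (k * r) ^+ 2)) * vb (k * r))%:E =
        \int[rho]_r (expR (- ((4 * a * t)^-1 * r ^+ 2)) * vb (k * r))%:E)%E.
      apply: eq_integral => r _; congr (expR (- _) * _)%:E.
      by rewrite bE; field; rewrite !gt_eqF.
    rewrite eI fineM; [by []|by []|exact: integrable_fin_num].
  - apply/measurable_EFinP; apply: measurable_funM => //.
    exact: measurable_gauss.
  - by move=> r; rewrite lee_fin mulr_ge0 ?expR_ge0//; have /andP[] := vbM r.
rewrite vs /gauss_weight.
have -> : Num.sqrt (4 * pi * b * t) = k * Num.sqrt (4 * pi * a * t).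
  rewrite bE (_ : _ * t = k ^+ 2 * (4 * pi * a * t)); last by ring.
  by rewrite sqrtrM ?sqr_ge0// sqrtr_sqr gtr0_norm.
have -> (X Y Z : R) : ((k * X) ^+ d)^-1 * Y * (k ^+ d * Z) = (X ^+ d)^-1 * Y * Z.
  rewrite exprMn invfM; have : k ^+ d != 0 by rewrite expf_neq0// gt_eqF.
  by set kd := k ^+ d; move=> kd0; set Xi := (X ^+ d)^-1; field.
rewrite -mulrBr; congr (_ * _); rewrite -RintegralB//.
by apply: eq_Rintegral => r _; rewrite mulrBr.
Qed.

End heat_radial.

(** * Sign of the Gaussian transform at large parameters *)

Section sign_chains.
Context {R : realType}.
Implicit Types (w : R -> R) (p : R).

(** Both signs occurring arbitrarily close to [p] on its right, a chain is built
    from right to left: each new point is put between [p] and the leftmost point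
    found so far. *)
Lemma alternating_chain w p :
  (forall e, 0 < e -> (exists2 r, p < r < p + e & 0 < w r) /\
                      (exists2 r, p < r < p + e & w r < 0)) ->
  forall m (positive : bool) e, 0 < e -> exists xi : nat -> R,
    [/\ forall i, (i <= m)%N -> p < xi i < p + e,
        forall i, (i < m)%N -> xi i < xi i.+1 /\ w (xi i) * w (xi i.+1) < 0 &
        if positive then 0 < w (xi 0%N) else w (xi 0%N) < 0].
Proof.
move=> both; elim => [|m IH] positive e e0.
  have [[r rpe wr] [q qpe wq]] := both _ e0.
  by case: positive; [exists (fun=> r)|exists (fun=> q)].
have [xi [xiI xiS xi0]] := IH (~~ positive) e e0.
have /andP[px xpe] := xiI 0%N isT.
have xp : 0 < xi 0%N - p by rewrite subr_gt0.
have [r /andP[pr rx] wr] : exists2 r, p < r < xi 0%N & if positive then 0 < w r else w r < 0.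
  have [[r + wr] [q + wq]] := both _ xp.
  rewrite addrC subrK => ? ?.
  by case: positive {xi0}; [exists r|exists q].
exists (fun i => if i is j.+1 then xi j else r); split.
- by case=> [_|i im]; [rewrite pr (lt_trans rx)|exact: xiI].
- case=> [_|i im] /=; last exact: xiS.
  split => //; case: positive xi0 wr => /= x0 wr.
    by rewrite pmulr_rlt0.
  by rewrite nmulr_rlt0.
- by case: positive wr {xi0}.
Qed.

(** Otherwise there are alternating chains of every length just after [p]. *)
Lemma one_signed_right w p : sign_changes_locally_finite w ->
  exists2 e, 0 < e & (forall r, p < r < p + e -> 0 <= w r) \/
                     (forall r, p < r < p + e -> w r <= 0).
Proof.
move=> fin; apply: contrapT => none.
have both e : 0 < e -> (exists2 r, p < r < p + e & 0 < w r) /\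
                      (exists2 r, p < r < p + e & w r < 0).
  move=> e0; split; apply: contrapT => h; apply: none; exists e => //.
    by right=> r rpe; rewrite leNgt; apply/negP => wr; apply: h; exists r.
  by left=> r rpe; rewrite leNgt; apply/negP => wr; apply: h; exists r.
have p1 : p < p + 1 by rewrite ltrDl.
have fn := fin _ _ p1.
have ub (m : nat) : m%:R <= fine (sign_changes w `]p, p + 1[).
  rewrite -lee_fin fineK//; apply: ereal_sup_ubound; exists m => //.
  have [xi [xiI xiS _]] := alternating_chain both m true ltr01.
  by exists xi; split => // i im; rewrite /= in_itv/= xiI.
have := ub (Num.Def.archi_bound (fine (sign_changes w `]p, p + 1[))).
rewrite leNgt => /negP; apply; apply: archi_boundP.
by have := ub 0%N.
Qed.

End sign_chains.

Section dominance.
Context {R : realType} {d : nat}.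
Hypothesis d_gt0 : (0 < d)%N.
Local Notation rho := (@rho R d).
Local Notation gw := (@gauss_weight R d).

(** The masses [(r + h) ^+ d - r ^+ d] of half-open intervals starting at [r] tend
    to 0 with [h]. *)
Lemma rho_set1 (r : R) : rho [set r] = 0%E.
Proof.
have [r0|r0] := leP r 0.
  by apply: rho_neg => //; move=> _ ->.
apply/eqP; rewrite eq_le measure_ge0 andbT; apply/lee_addgt0Pr => e e0; rewrite add0e.
have : (r + h) ^+ d @[h --> (0 : R)] --> (r + 0) ^+ d.
  apply: (@cvg_comp _ _ _ (fun h => r + h) (fun x => x ^+ d) _ (nbhs (r + 0))).
    by apply: cvgD; [exact: cvg_cst|exact: cvg_id].
  exact: exprn_continuous.
move=> /cvgrPdist_lt /(_ _ e0)/nbhs_ballP[h /= h0 hh].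
have h2 : 0 < h / 2 by rewrite divr_gt0.
have := hh (h / 2); rewrite /ball/= sub0r normrN gtr0_norm// ltr_pdivrMr// => /(_ _)/wrap[].
  by rewrite ltr_pMr// ltr1n.
rewrite addr0 distrC => hd.
apply: (@le_trans _ _ (rho `[r, r + h / 2[)).
  apply: le_measure; rewrite ?inE// => _ -> /=; by rewrite in_itv/= lexx ltrDl.
rewrite rho_itv ?r0 ?ltrDl// lee_fin.
exact: le_trans (ler_norm _) (ltW hd).
Qed.

Lemma gw_linear (W1 W2 : R -> R) (M1 M2 c1 c2 s : R) :
  measurable_fun setT W1 -> measurable_fun setT W2 ->
  (forall r, `|W1 r| <= M1) -> (forall r, `|W2 r| <= M2) -> 0 < s ->
  gw (fun r => c1 * W1 r + c2 * W2 r) s = c1 * gw W1 s + c2 * gw W2 s.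
Proof.
move=> mW1 mW2 W1M W2M s0; rewrite /gauss_weight.
have i1 := @gauss_integrable R d _ _ _ mW1 W1M s0.
have i2 := @gauss_integrable R d _ _ _ mW2 W2M s0.
rewrite -RintegralZl// -RintegralZl// -RintegralD//; first last.
- exact: (integrableZl measurableT c2 i2).
- exact: (integrableZl measurableT c1 i1).
by apply: eq_Rintegral => r _; rewrite mulrDr !(mulrCA (expR _)).
Qed.

Lemma le_gw (W1 W2 : R -> R) (M1 M2 s1 s2 : R) :
  measurable_fun setT W1 -> measurable_fun setT W2 ->
  (forall r, `|W1 r| <= M1) -> (forall r, `|W2 r| <= M2) -> 0 < s1 -> 0 < s2 ->
  (forall r, expR (- (s1 * r ^+ 2)) * W1 r <= expR (- (s2 * r ^+ 2)) * W2 r) ->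
  gw W1 s1 <= gw W2 s2.
Proof.
move=> mW1 mW2 W1M W2M s10 s20 le; apply: le_Rintegral => //.
- exact: gauss_integrable mW1 W1M s10.
- exact: gauss_integrable mW2 W2M s20.
Qed.

Lemma gw_ae_eq (W1 W2 : R -> R) (N : set R) (s : R) :
  measurable_fun setT W1 -> measurable_fun setT W2 -> measurable N -> rho N = 0%E ->
  (forall r, ~ N r -> W1 r = W2 r) -> gw W1 s = gw W2 s.
Proof.
move=> m1 m2 mN N0 eq; rewrite /gauss_weight /Rintegral; congr fine.
have mg : measurable_fun [set: R] (fun r : R => expR (- (s * r ^+ 2))).
  exact: measurable_gauss.
apply: ae_eq_integral => //.
- by apply/measurable_EFinP; exact: measurable_funM.
- by apply/measurable_EFinP; exact: measurable_funM.
- exists N; split => // r /= h; apply: contrapT => Nr; apply: h => _.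
  by rewrite eq.
Qed.

Lemma gw_gt0 (W : R -> R) (M s : R) : measurable_fun setT W ->
  (forall r, 0 <= W r <= M) -> 0 < s -> rho [set r | W r != 0] != 0%E ->
  0 < gw W s.
Proof.
move=> mW WM s0 nz.
have WM' r : `|W r| <= M by have /andP[? ?] := WM r; rewrite ger0_norm.
have int := @gauss_integrable R d _ _ _ mW WM' s0.
have f0 r : 0 <= expR (- (s * r ^+ 2)) * W r.
  by rewrite mulr_ge0 ?expR_ge0//; have /andP[] := WM r.
rewrite lt_def; apply/andP; split; last first.
  by apply: fine_ge0; apply: integral_ge0 => r _; rewrite lee_fin.
apply: contra nz => /eqP g0.
have i0 : (\int[rho]_r (expR (- (s * r ^+ 2)) * W r)%:E = 0)%E.
  rewrite -[LHS]fineK; last exact: integrable_fin_num.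
  by rewrite -/(Rintegral _ _ _) [X in X%:E]g0.
have mi := measurable_int _ int.
have [/= + _] := ae_eq_integral_abs rho measurableT mi.
under [X in X = _ -> _]eq_integral do rewrite ger0_norm//.
move=> /(_ i0) [N [mN N0 hN]].
apply/eqP/eqP; rewrite eq_le measure_ge0 andbT -N0.
have mnz : measurable [set r | W r != 0].
  rewrite (_ : [set _ | _] = W @^-1` (~` [set 0])).
    by rewrite -[X in measurable X]setTI; apply: mW => //; exact: measurableC.
  by apply/seteqP; split => r /=; [move/eqP|move=> h; apply/eqP].
apply: le_measure; rewrite ?inE// => r /= Wr; apply: hN => /= /(_ I) /eqP.
by rewrite eqe mulf_eq0 (negbTE Wr) orbF gt_eqF ?expR_gt0.
Qed.

Lemma measurable_nz (W : R -> R) (I : set R) : measurable_fun setT W -> measurable I ->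
  measurable (I `&` [set r | W r != 0]).
Proof.
move=> mW mI; apply: measurableI => //.
rewrite (_ : [set _ | _] = W @^-1` (~` [set 0])).
  by rewrite -[X in measurable X]setTI; apply: mW => //; exact: measurableC.
by apply/seteqP; split => r /=; [move/eqP|move=> h; apply/eqP].
Qed.

Lemma rho_sub_eq0 (A B : set R) : measurable A -> measurable B -> A `<=` B ->
  rho B = 0%E -> rho A = 0%E.
Proof.
move=> mA mB AB B0; apply/eqP; rewrite eq_le measure_ge0 andbT -B0.
by apply: le_measure; rewrite ?inE.
Qed.

Lemma rho_setU_eq0 (A B : set R) : measurable A -> measurable B ->
  rho A = 0%E -> rho B = 0%E -> rho (A `|` B) = 0%E.
Proof.
move=> mA mB A0 B0; apply/eqP; rewrite eq_le measure_ge0 andbT.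
apply: (@le_trans _ _ (rho A + rho B)%E); first exact: measureU2.
by rewrite A0 B0 adde0.
Qed.

Lemma rho_bigcup_eq0 (F : nat -> set R) : (forall n, measurable (F n)) ->
  (forall n, rho (F n) = 0%E) -> rho (\bigcup_n F n) = 0%E.
Proof.
move=> mF F0; apply/eqP; rewrite eq_le measure_ge0 andbT.
apply: le_trans (generalized_Boole_inequality rho mF (bigcup_measurable _)) _ => //.
by rewrite eseries0// => n _ _; exact: F0.
Qed.

(** The point [p] is the supremum of the radii up to which [W] vanishes almost
    everywhere. *)
Lemma first_nonzero (W : R -> R) : measurable_fun setT W ->
  rho [set r | W r != 0] = 0%E \/
  exists2 p, 0 <= p & rho (`]-oo, p[ `&` [set r | W r != 0]) = 0%E /\
    forall e, 0 < e -> rho (`[p, p + e[ `&` [set r | W r != 0]) != 0%E.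
Proof.
move=> mW; pose P := [set q | rho (`]-oo, q[ `&` [set r | W r != 0]) = 0%E].
have mn q : measurable (`]-oo, q[ `&` [set r | W r != 0]).
  by apply: measurable_nz => //; exact: measurable_itv.
have mI q e : measurable (`[q, e[ `&` [set r | W r != 0]).
  by apply: measurable_nz => //; exact: measurable_itv.
have [|nz] := pselect (rho [set r | W r != 0] = 0%E); first by left.
right.
have P0 : P 0.
  apply: rho_neg => // r [/=]; rewrite in_itv/= => /ltW//.
have Pmono q r : q <= r -> P r -> P q.
  move=> qr; apply: rho_sub_eq0 => // x [/=]; rewrite !in_itv/= => xq Wx.
  by split => //; exact: lt_le_trans qr.
have ubP : has_ubound P.
  apply: contrapT => nub; apply: nz.
  rewrite (_ : [set _ | _] = \bigcup_(n : nat) (`]-oo, n%:R[ `&` [set r | W r != 0])).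
    apply: rho_bigcup_eq0 => // n.
    have [q Pq nq] : exists2 q, P q & n%:R < q.
      apply: contrapT => h; apply: nub; exists n%:R => q Pq.
      by rewrite leNgt; apply/negP => nq; apply: h; exists q.
    by apply: Pmono Pq; exact: ltW.
  apply/seteqP; split => r /=; last by move=> [n _ []].
  move=> Wr; exists (Num.Def.archi_bound `|r|) => //; split => //=.
  by rewrite in_itv/= (le_lt_trans (ler_norm r))// archi_boundP.
have hs : has_sup P by split => //; exists 0.
pose p := sup P.
have Pp : P p.
  rewrite /P/= (_ : _ `&` _ = \bigcup_(n : nat) (`]-oo, p - n.+1%:R^-1[ `&` [set r | W r != 0])).
    apply: rho_bigcup_eq0 => // n.
    have n0 : 0 < n.+1%:R^-1 :> R by rewrite invr_gt0.
    have [q Pq nq] := sup_adherent n0 hs.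
    by apply: Pmono Pq; exact: ltW.
  apply/seteqP; split => r /=; rewrite in_itv/=.
    move=> [rp Wr].
    have rp0 : 0 < p - r by rewrite subr_gt0.
    have [n _ /(_ n (leqnn n)) /= ne] := near_infty_natSinv_lt (PosNum rp0).
    exists n => //; split => //=; rewrite in_itv/=.
    by move: ne; move: (n.+1%:R^-1) => x; lra.
  move=> [n _ [/=]]; rewrite in_itv/= => rp Wr; split => //.
  apply: lt_le_trans rp _; rewrite lerBlDr lerDl; by rewrite invr_ge0.
exists p; first exact: sup_ubound.
split => // e e0; apply/eqP => h.
have : P (p + e).
  rewrite /P/=; apply/eqP; rewrite eq_le measure_ge0 andbT.
  pose X := `]-oo, p[ `&` [set r | W r != 0]; pose Y := `[p, p + e[ `&` [set r | W r != 0].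
  apply: (@le_trans _ _ (rho X + rho Y)%E); last by rewrite /X /Y Pp h adde0.
  apply: le_trans (measureU2 _ (mn p) (mI p (p + e))).
  apply: le_measure; rewrite ?inE//.
    by apply: measurableU; [exact: mn|exact: mI].
  move=> r [/=]; rewrite in_itv/= => re Wr; have [rp|pr] := ltP r p.
    by left; split => //=; rewrite in_itv.
  by right; split => //=; rewrite in_itv/= pr.
move=> h'; have := ub_le_sup ubP h'; rewrite leNgt => /negP; apply.
by rewrite ltrDl.
Qed.

(** For large [s] the transform is governed by the first interval on which [W] is
    not null: it contributes at least a multiple of
    [expR (- (s * (p + e / 2) ^+ 2))], whereas what lies beyond [p + e], where the
    sign of [W] is unknown, is at most of the order of
    [expR (- (s * (p + e) ^+ 2))]. *)
Lemma gauss_dominance (W : R -> R) (M p e : R) (N : set R) :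
  measurable_fun setT W -> (forall r, `|W r| <= M) -> 0 <= p -> 0 < e ->
  measurable N -> rho N = 0%E ->
  (forall r, ~ N r -> r < p -> W r = 0) ->
  (forall r, ~ N r -> p <= r < p + e -> 0 <= W r) ->
  rho (`[p, p + e / 2[ `&` [set r | W r != 0]) != 0%E ->
  exists2 s1, 0 < s1 & forall s, s1 <= s -> 0 < gw W s.
Proof.
move=> mW0 W0M p0 e0 mN N0 Wlt Wge Wnz.
pose W' := fun r => W r * \1_(~` N) r.
have mW : measurable_fun setT W'.
  by apply: measurable_funM => //; apply: measurable_indic; exact: measurableC.
have WE r : ~ N r -> W' r = W r by move=> Nr; rewrite /W' indicE mem_set// mulr1.
have WN r : N r -> W' r = 0 by move=> Nr; rewrite /W' indicE memNset ?mulr0// => /(_ Nr).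
have M0 : 0 <= M by apply: le_trans (W0M 0).
have WM r : `|W' r| <= M.
  by have [Nr|Nr] := pselect (N r); [rewrite WN// normr0|rewrite WE].
have gwE s : gw W s = gw W' s by apply: gw_ae_eq mN N0 _ => // r Nr; rewrite WE.
have {Wlt}Wlt r : r < p -> W' r = 0.
  by move=> rp; have [Nr|Nr] := pselect (N r); [rewrite WN|rewrite WE// Wlt].
have {Wge}Wge r : p <= r < p + e -> 0 <= W' r.
  by move=> rp; have [Nr|Nr] := pselect (N r); [rewrite WN|rewrite WE// Wge].
pose U := fun r => W' r * \1_(`[p, p + e / 2[) r.
have mU : measurable_fun setT U.
  by apply: measurable_funM => //; exact: measurable_indic.
have e2 : 0 < e / 2 by rewrite divr_gt0.
have ee2 : e / 2 < e by rewrite ltr_pdivrMr// ltr_pMr// ltr1n.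
have U0M r : 0 <= U r <= M.
  rewrite /U indicE; have [/set_mem/=|] := boolP (r \in _); last by rewrite mulr0 lexx.
  rewrite in_itv/= => /andP[pr re]; rewrite mulr1 Wge ?pr//=.
    exact: le_trans (ler_norm _) (WM r).
  by apply: lt_trans re _; rewrite ltrD2l.
have UM r : `|U r| <= M by have /andP[? ?] := U0M r; rewrite ger0_norm.
have P0 : 0 < gw U 1.
  apply: gw_gt0 U0M _ _ => //; apply: contra Wnz => /eqP U0.
  apply/eqP; apply/eqP; rewrite eq_le measure_ge0 andbT.
  have mUnz := measurable_nz mU measurableT; rewrite setTI in mUnz.
  apply: (@le_trans _ _ (rho N + rho [set r | U r != 0%R])%E); last by rewrite N0 U0 adde0.
  apply: le_trans (measureU2 _ _ _) => //.
  apply: le_measure; rewrite ?inE//.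
  - by apply: measurable_nz => //; exact: measurable_itv.
  - exact: measurableU.
  move=> r [/= rI Wr]; have [Nr|Nr] := pselect (N r); [by left|right].
  by rewrite /= /U indicE mem_set// mulr1 WE.
pose one : R -> R := cst 1.
pose C := gw one 1.
have C0 : 0 <= C.
  apply: fine_ge0; apply: integral_ge0 => r _; by rewrite lee_fin mulr1 expR_ge0.
pose Q := (p + e / 2) ^+ 2; pose Q' := (p + e) ^+ 2.
have QQ : 0 < Q' - Q.
  rewrite subr_gt0 ltr_sqr ?nnegrE ?ltrD2l// addr_ge0//; exact: ltW.
(* One factor [expR (- r ^+ 2)] is kept apart, which makes the tail integrable
   with a bound uniform in [s]. *)
have low s : 1 <= s -> expR (- ((s - 1) * Q)) * gw U 1 - M * expR (- ((s - 1) * Q')) * C <= gw W' s.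
  move=> s1; have s0 : 0 < s by apply: lt_le_trans s1.
  have m1 : measurable_fun [set: R] one by exact: measurable_cst.
  have b1 r : `|one r| <= 1 by rewrite /one normr1.
  rewrite /C -[- (_ * gw one 1)]mulNr -(gw_linear _ _ mU m1 UM b1 ltr01).
  apply: (@le_gw _ _ (expR (- ((s - 1) * Q)) * M + M * expR (- ((s - 1) * Q'))) M) => //.
  - by apply: measurable_funD; apply: measurable_funM.
  - move=> r; rewrite (le_trans (ler_normD _ _))// lerD//.
      by rewrite normrM ger0_norm ?expR_ge0// ler_wpM2l ?expR_ge0.
    by rewrite mulr1 normrN normrM !ger0_norm ?expR_ge0.
  move=> r; have -> : expR (- (1 * r ^+ 2)) * (expR (- ((s - 1) * Q)) * U r +
      - (M * expR (- ((s - 1) * Q'))) * one r) =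
      expR (- r ^+ 2) * expR (- ((s - 1) * Q)) * U r -
      expR (- r ^+ 2) * (M * expR (- ((s - 1) * Q'))).
    by rewrite /one mul1r /cst; ring.
  have X0 : 0 <= expR (- r ^+ 2) * (M * expR (- ((s - 1) * Q'))).
    by rewrite !mulr_ge0 ?expR_ge0.
  have [rp|pr] := ltP r p.
    by rewrite /U Wlt// mul0r !mulr0 add0r oppr_le0.
  have r0 : 0 <= r by apply: le_trans pr.
  have [re|er] := ltP r (p + e / 2).
    rewrite /U indicE mem_set/= ?in_itv/= ?pr// mulr1.
    apply: (@le_trans _ _ (expR (- r ^+ 2) * expR (- ((s - 1) * Q)) * W' r)); first by rewrite gerBl.
    apply: ler_wpM2r; first by rewrite Wge// pr (lt_trans re)// ltrD2l.
    rewrite -expRD ler_expR -opprD lerN2 -lerBlDr.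
    have -> : s * r ^+ 2 - (s - 1) * Q = r ^+ 2 - (s - 1) * (Q - r ^+ 2) by ring.
    by rewrite lerBlDr lerDl mulr_ge0 ?subr_ge0// ler_sqr ?nnegrE ?(ltW re)// addr_ge0// ltW.
  rewrite /U indicE memNset/= ?mulr0 ?add0r; last by rewrite in_itv/= pr/= ltNge er.
  have [re|{}er] := ltP r (p + e).
    apply: (@le_trans _ _ 0); first by rewrite oppr_le0.
    by rewrite mulr_ge0 ?expR_ge0// Wge// pr.
  apply: (@le_trans _ _ (- (expR (- (s * r ^+ 2)) * M))); last first.
    rewrite -mulrN ler_wpM2l ?expR_ge0//.
    by have := WM r; rewrite ler_norml => /andP[].
  rewrite lerN2 [leRHS]mulrCA [leLHS]mulrC ler_wpM2l// -expRD ler_expR -opprD lerN2.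
  have -> : s * r ^+ 2 = r ^+ 2 + (s - 1) * r ^+ 2 by ring.
  rewrite lerD2l ler_wpM2l ?subr_ge0// ler_sqr ?nnegrE// addr_ge0//; exact: ltW.
(* With this [s1], [1 + x <= expR x] already gives the inequality wanted. *)
pose s1 := 1 + M * C / (gw U 1 * (Q' - Q)).
have s11 : 1 <= s1 by rewrite lerDl divr_ge0 ?mulr_ge0// ltW.
exists s1; first exact: lt_le_trans s11.
move=> s ss; rewrite gwE; apply: lt_le_trans (low s (le_trans s11 ss)).
rewrite subr_gt0.
have -> : expR (- ((s - 1) * Q)) = expR (- ((s - 1) * Q')) * expR ((s - 1) * (Q' - Q)).
  by rewrite -expRD; congr expR; ring.
rewrite mulrAC mulrC -mulrA ltr_pM2l ?expR_gt0//.
apply: (@lt_le_trans _ _ ((1 + (s - 1) * (Q' - Q)) * gw U 1)); last first.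
  by rewrite ler_wpM2r ?expR_ge1Dx// ltW.
have : M * C <= (s - 1) * (Q' - Q) * gw U 1.
  by rewrite -mulrA -ler_pdivrMr ?mulr_gt0// lerBrDl [(Q' - Q) * _]mulrC.
by move/le_lt_trans; apply; rewrite ltr_pM2r// ltrDr.
Qed.

(** Finitely many sign changes give [w] a constant weak sign just after the first
    radius at which it is not null, and this part dominates. *)
Lemma gauss_weight_sign (W w : R -> R) (M : R) (A : set R) :
  measurable_fun setT W -> (forall r, `|W r| <= M) -> measurable A -> rho A = 0%E ->
  (forall r, 0 < r -> ~ A r -> W r = w r) -> sign_changes_locally_finite w ->
  rho [set r | W r != 0] = 0%E \/
  exists sg, sg != 0 /\ exists2 s1, 0 < s1 & forall s, s1 <= s -> Num.sg (gw W s) = sg.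
Proof.
move=> mW WM mA A0 Ww fin; have [|[p p0 [plt pge]]] := first_nonzero mW; first by left.
right; have [e e0 eW] := one_signed_right p fin.
have e20 : 0 < e / 2 by rewrite divr_gt0.
pose N := A `|` (`]-oo, p[ `&` [set r | W r != 0]) `|` [set p].
have mz : measurable (`]-oo, p[ `&` [set r | W r != 0]).
  by apply: measurable_nz => //; exact: measurable_itv.
have mN : measurable N by apply: measurableU => //; exact: measurableU.
have N0 : rho N = 0%E.
  exact: (rho_setU_eq0 (measurableU _ _ mA mz) (measurable_set1 p)
    (rho_setU_eq0 mA mz A0 plt) (rho_set1 p)).
have Nlt r : ~ N r -> r < p -> W r = 0.
  move=> Nr rp; apply: contrapT => Wr; apply: Nr; left; right; split => /=; last exact/eqP.
  by rewrite in_itv.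
have Nw r : ~ N r -> p <= r < p + e -> W r = w r /\ p < r < p + e.
  move=> Nr /andP[pr re]; have {pr}pr : p < r.
    by rewrite lt_neqAle pr andbT; apply/eqP => pr'; apply: Nr; right.
  split; last by rewrite pr.
  by apply: Ww; [exact: le_lt_trans pr|move=> Ar; apply: Nr; left; left].
have [wge|wle] := eW.
  have [|s1 s10 h] := gauss_dominance mW WM p0 e0 mN N0 Nlt _ (pge _ e20).
    by move=> r Nr /(Nw r Nr)[-> /wge].
  exists 1; split; first exact: oner_neq0.
  by exists s1 => // s ss; rewrite gtr0_sg// h.
have mNW : measurable_fun setT (fun r => - W r) by exact: measurable_funN.
have NWM r : `|- W r| <= M by rewrite normrN.
have [||| s1 s10 h] := gauss_dominance mNW NWM p0 e0 mN N0.
- by move=> r Nr rp; rewrite Nlt// oppr0.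
- by move=> r Nr /(Nw r Nr)[-> /wle]; rewrite oppr_ge0.
- rewrite (_ : [set r | - W r != 0] = [set r | W r != 0]) ?pge//.
  by apply/seteqP; split => r /=; rewrite oppr_eq0.
exists (-1); split; first by rewrite oppr_eq0 oner_neq0.
exists s1 => // s ss; apply: ltr0_sg.
have := h s ss; rewrite (_ : (fun r => - W r) = (fun r => (-1) * W r + 0 * W r)).
  rewrite (gw_linear _ _ mW mW WM WM); last exact: lt_le_trans ss.
  by rewrite mul0r addr0 mulN1r oppr_gt0.
by apply/funext => r; rewrite mul0r addr0 mulN1r.
Qed.

Lemma gauss_weight_null (W : R -> R) s : measurable_fun setT W ->
  rho [set r | W r != 0] = 0%E -> gw W s = 0.
Proof.
move=> mW W0; have mnz := measurable_nz mW measurableT; rewrite setTI in mnz.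
rewrite (@gw_ae_eq W (cst 0) _ s mW _ mnz W0) //.
  by rewrite /gauss_weight /Rintegral integral0_eq// => r _; rewrite mulr0.
by move=> r /= /negP; rewrite negbK => /eqP.
Qed.

End dominance.

(** * Power series and uniqueness of the transform *)

Section real_integrals.
Context dd (T : measurableType dd) (R : realType).
Variable mu : {measure set T -> \bar R}.

(** Dominated convergence for real-valued integrals. *)
Lemma Rintegral_dominated (f_ : nat -> T -> R) (f g : T -> R) :
  (forall n, measurable_fun setT (f_ n)) ->
  (forall x, f_ n x @[n --> \oo] --> f x) ->
  mu.-integrable setT (EFin \o g) -> (forall n x, `|f_ n x| <= g x) ->
  (\int[mu]_x f_ n x)%R @[n --> \oo] --> (\int[mu]_x f x)%R.
Proof.
move=> mf ff ig fg.
have mF : measurable_fun setT f by apply: (measurable_fun_cvg mf) => x _; exact: ff.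
have fgx x : `|f x| <= g x.
  apply: (cvgr_to_le (cvg_norm (ff x))); exact/nearW.
have int : mu.-integrable setT (EFin \o f).
  apply: (le_integrable measurableT _ _ ig); first exact/measurable_EFinP.
  by move=> x _; rewrite /= lee_fin (le_trans (fgx x)) ?ler_norm.
have h : (\int[mu]_x (f_ n x)%:E)%E @[n --> \oo] --> (\int[mu]_x (f x)%:E)%E.
  apply: (dominated_cvg measurableT (g := EFin \o g)) => //.
  - by move=> n; apply/measurable_EFinP.
  - by move=> x _; apply: cvg_EFin; [exact: nearW|exact: ff].
  - by move=> n x _; rewrite /= lee_fin.
apply: fine_cvg; rewrite fineK//; exact: integrable_fin_num int.
Qed.

Lemma Rintegral_sum (I : eqType) (s : seq I) (f : I -> T -> R) :
  (forall i, mu.-integrable setT (EFin \o f i)) ->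
  (\int[mu]_x \sum_(i <- s) f i x = \sum_(i <- s) \int[mu]_x f i x)%R.
Proof.
move=> int; rewrite /Rintegral; under eq_integral do rewrite -sumEFin.
rewrite (@integral_sum _ _ _ mu setT measurableT _ (fun i => EFin \o f i) int s xpredT).
rewrite -[RHS]/(fine (_)%:E) -sumEFin; congr fine; apply: eq_bigr => i _.
by rewrite fineK//; exact: integrable_fin_num (int i).
Qed.

End real_integrals.

Section power_series.
Context {R : realType}.

Lemma cvg_series_expR (x : R) : series (exp_coeff x) n @[n --> \oo] --> expR x.
Proof. exact: is_cvg_series_exp_coeff. Qed.

Lemma ler_series_expR (x : R) n : 0 <= x -> series (exp_coeff x) n <= expR x.
Proof.
move=> x0; apply: nondecreasing_cvgn_le; last exact: is_cvg_series_exp_coeff.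
by apply/nondecreasing_series => i _ _; exact: exp_coeff_ge0.
Qed.

Lemma norm_series_expR (x : R) n : `|series (exp_coeff x) n| <= expR `|x|.
Proof.
apply: le_trans (ler_series_expR n (normr_ge0 x)).
rewrite /series/=; apply: le_trans (ler_norm_sum _ _ _) _.
by apply: ler_sum => i _; rewrite /exp_coeff/= normrM normrX normfV [`|i`!%:R|]ger0_norm.
Qed.

Lemma geometric_half_le (q : R) N : 0 <= q <= 1 / 2 -> \sum_(0 <= i < N) q ^+ i <= 2.
Proof.
move=> /andP[q0 q1]; suff : \sum_(0 <= i < N) q ^+ i <= 2 - 2 * q ^+ N.
  by move/le_trans; apply; rewrite gerBl mulr_ge0// exprn_ge0.
elim: N => [|N IH]; first by rewrite big_geq// expr0; lra.
rewrite big_nat_recr//=; apply: (le_trans (lerD IH (lexx _))).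
have qN : 0 <= q ^+ N by rewrite exprn_ge0.
have : q ^+ N.+1 <= 1 / 2 * q ^+ N by rewrite exprS ler_wpM2r.
by move: (q ^+ N) (q ^+ N.+1) qN => x y; lra.
Qed.

(** Near 0 a power series is comparable to its first nonzero term. *)
Lemma pseries_zeros (c : nat -> R) (f : R -> R) (r : R) : 0 < r ->
  (forall z, `|z| <= r -> \sum_(0 <= n < N) c n * z ^+ n @[N --> \oo] --> f z) ->
  (forall n, c n = 0) \/ exists2 e, 0 < e & forall z, 0 < `|z| < e -> f z != 0.
Proof.
move=> r0 fE; have [|nz] := pselect (forall n, c n = 0); first by left.
right; have /existsNP[m0 cm0] := nz.
have exm : exists n, c n != 0 by exists m0; exact/eqP.
have [m cm min] := ex_minnP exm.
have [B B0 cB] : exists2 B, 0 < B & forall n, `|c n| * r ^+ n <= B.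
  have h : cvgn (series (fun n => c n * r ^+ n)).
    by apply/cvg_ex; exists (f r); apply: fE; rewrite gtr0_norm.
  have := cvg_seq_bounded (cvgP _ (cvg_series_cvg_0 h)).
  move=> [M [_ hM]].
  exists (`|M| + 1); first by rewrite ltr_wpDl.
  move=> n; have : M < `|M| + 1 by rewrite (le_lt_trans (ler_norm M))// ltrDl.
  move=> /hM/(_ n I) /=; rewrite normrM normrX (gtr0_norm r0).
  by [].
have e0 : 0 < `|c m| * r ^+ m / (2 * B).
  by rewrite divr_gt0 ?mulr_gt0 ?exprn_gt0// normr_gt0.
exists (Num.min (r / 2) (r * (`|c m| * r ^+ m / (2 * B)))).
  by rewrite lt_min divr_gt0// mulr_gt0.
move=> z /andP[z0]; rewrite lt_min => /andP[z1 z2].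
have zr : `|z| <= r by apply/ltW; apply: lt_trans z1 _; rewrite ltr_pdivrMr// ltr_pMr// ltr1n.
pose q := `|z| / r.
have q0 : 0 < q by rewrite divr_gt0.
have q1 : q <= 1 / 2 by rewrite ler_pdivrMr// mulrC mul1r ltW.
have term n : `|c n * z ^+ n| <= B * q ^+ n.
  rewrite normrM normrX /q exprMn mulrCA [B * _]mulrC.
  rewrite exprVn [leRHS]mulrA mulrC -mulrA ler_wpM2l ?exprn_ge0//.
  by rewrite ler_pdivlMl ?exprn_gt0// mulrC.
have part N : `|\sum_(0 <= n < m.+1 + N) c n * z ^+ n - c m * z ^+ m| <= 2 * B * q ^+ m.+1.
  rewrite (big_cat_nat (n := m.+1))//= ?leq_addr// big_nat_recr//=.
  rewrite big_nat big1 ?add0r; last first.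
    move=> i /andP[_ im]; apply/eqP; rewrite mulf_eq0; apply/orP; left.
    by apply: contraTT im => ci; rewrite -leqNgt min.
  rewrite addrAC subrr add0r.
  rewrite -[X in \sum_(X <= _ < _) _]add0n big_addn addKn.
  apply: (le_trans (ler_norm_sum _ _ _)).
  apply: (@le_trans _ _ (\sum_(0 <= i < N) B * q ^+ m.+1 * q ^+ i)).
    by apply: ler_sum => i _; rewrite -mulrA -exprD addnC term.
  rewrite -mulr_sumr mulrC mulrA mulrAC [leLHS]mulrAC.
  rewrite ler_wpM2r ?exprn_ge0 ?(ltW q0)// ler_wpM2r ?(ltW B0)//.
  by apply: geometric_half_le; rewrite (ltW q0).
have lim : `|f z - c m * z ^+ m| <= 2 * B * q ^+ m.+1.
  have h : \sum_(0 <= n < m.+1 + N) c n * z ^+ n - c m * z ^+ m @[N --> \oo] --> f z - c m * z ^+ m.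
    apply: cvgB; last exact: cvg_cst.
    have := fE _ zr; rewrite -(cvg_shiftn m.+1).
    by under eq_fun do rewrite addnC.
  by apply: (cvgr_to_le (cvg_norm h)); exact/nearW.
apply/negP => /eqP fz; move: lim; rewrite fz sub0r normrN normrM normrX.
rewrite leNgt => /negP; apply.
have -> : `|z| = q * r by rewrite /q divfK// gt_eqF.
have -> : 2 * B * q ^+ m.+1 = q ^+ m * (2 * B * q) by rewrite exprS; ring.
have -> : `|c m| * (q * r) ^+ m = q ^+ m * (`|c m| * r ^+ m) by rewrite exprMn; ring.
rewrite ltr_pM2l ?exprn_gt0//.
move: z2; rewrite mulrC -ltr_pdivrMr// -/q ltr_pdivlMr ?mulr_gt0//.
by rewrite mulrC.
Qed.

End power_series.

Section laplace.
Context {R : realType} {d : nat}.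
Local Notation rho := (@rho R d).
Local Notation gw := (@gauss_weight R d).

(** The exponential series in [z * r ^+ 2] is dominated by
    [expR (`|z| * r ^+ 2)], which the Gaussian factor absorbs. *)
Lemma gauss_weight_series (W : R -> R) (M s z : R) : measurable_fun setT W ->
  (forall r, `|W r| <= M) -> `|z| < s ->
  \sum_(0 <= n < N) (\int[rho]_r ((r ^+ 2) ^+ n / n`!%:R * (expR (- (s * r ^+ 2)) * W r)))%R * z ^+ n
    @[N --> \oo] --> gw W (s - z).
Proof.
move=> mW WM zs.
pose g r := expR (- ((s - `|z|) * r ^+ 2)) * M.
pose c n r := (r ^+ 2) ^+ n / n`!%:R * (expR (- (s * r ^+ 2)) * W r).
have s0 : 0 < s by apply: le_lt_trans zs.
have ms t : measurable_fun [set: R] (fun r : R => expR (- (t * r ^+ 2))).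
  exact: measurable_gauss.
have mc n : measurable_fun setT (c n).
  apply: measurable_funM; last exact: measurable_funM.
  by apply: measurable_funM => //; apply: measurable_funX; exact: measurable_funX.
have M0 : 0 <= M by apply: le_trans (WM 0).
have ig t : 0 < t -> rho.-integrable setT (EFin \o (fun r => expR (- (t * r ^+ 2)) * M)).
  by move=> t0; apply: (@gauss_integrable _ _ (cst M) `|M|).
have ic n : rho.-integrable setT (EFin \o c n).
  have t0 : 0 < s / 2 by rewrite divr_gt0.
  have ih := integrableZl measurableT ((s / 2)^-1 ^+ n) (ig _ t0).
  apply: (le_integrable measurableT _ _ ih); first exact/measurable_EFinP.
  move=> r _; rewrite /= lee_fin /c normrM [`|expR _ * _|]normrM ger0_norm; last first.
    by rewrite mulr_ge0// exprn_ge0// sqr_ge0.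
  rewrite [leRHS]ger0_norm; last first.
    by rewrite !mulr_ge0 ?expR_ge0// exprn_ge0// invr_ge0 ltW.
  rewrite (ger0_norm (expR_ge0 _)) mulrA [leRHS]mulrA.
  apply: ler_pM => //; first by rewrite mulr_ge0 ?expR_ge0// mulr_ge0// exprn_ge0// sqr_ge0.
  have -> : expR (- (s * r ^+ 2)) = expR (- (s / 2 * r ^+ 2)) * expR (- (s / 2 * r ^+ 2)).
    by rewrite -expRD; congr expR; field.
  rewrite mulrA ler_wpM2r ?expR_ge0//.
  rewrite expRN ler_pdivrMr ?expR_gt0// ler_pdivrMr ?ltr0n ?fact_gt0//.
  rewrite -mulrA [_ * n`!%:R]mulrC exprVn ler_pdivlMl ?exprn_gt0// -exprMn.
  by apply: ler_pow_fact_expR; rewrite mulr_ge0 ?sqr_ge0// ltW.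
have h : (\int[rho]_r \sum_(0 <= n < N) z ^+ n * c n r)%R @[N --> \oo] --> gw W (s - z).
  apply: (@Rintegral_dominated _ _ _ _ _ _ g).
  - move=> n; apply: measurable_sum => i; exact: measurable_funM.
  - move=> r; rewrite (_ : (fun _ => _) = (fun N => series (exp_coeff (z * r ^+ 2)) N *
        (expR (- (s * r ^+ 2)) * W r))).
      have -> : expR (- ((s - z) * r ^+ 2)) * W r = expR (z * r ^+ 2) * (expR (- (s * r ^+ 2)) * W r).
        by rewrite mulrA -expRD; congr (expR _ * _); ring.
      by apply: cvgMl; exact: cvg_series_expR.
    apply/funext => N; rewrite /series/= mulr_suml; apply: eq_bigr => i _.
    by rewrite /c /exp_coeff/= [(z * _) ^+ i]exprMn !mulrA.
  - by apply: ig; rewrite subr_gt0.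
  move=> N r.
  have -> : \sum_(0 <= n < N) z ^+ n * c n r = series (exp_coeff (z * r ^+ 2)) N * (expR (- (s * r ^+ 2)) * W r).
    rewrite /series/= mulr_suml; apply: eq_bigr => i _.
    by rewrite /c /exp_coeff/= [(z * _) ^+ i]exprMn !mulrA.
  rewrite normrM [`|expR _ * _|]normrM (ger0_norm (expR_ge0 _)) mulrA; apply: ler_pM => //.
  have -> : expR (- ((s - `|z|) * r ^+ 2)) = expR `|z * r ^+ 2| * expR (- (s * r ^+ 2)).
    rewrite -expRD normrM [`|r ^+ 2|]ger0_norm ?sqr_ge0//; congr expR; ring.
  by rewrite ler_wpM2r ?expR_ge0// norm_series_expR.
rewrite [X in fmap X](_ : _ = (fun N => \int[rho]_r \sum_(0 <= n < N) z ^+ n * c n r)%R)//.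
apply/funext => N; rewrite Rintegral_sum; last first.
  by move=> n; exact: (integrableZl measurableT (z ^+ n) (ic n)).
by apply: eq_bigr => n _; rewrite RintegralZl// mulrC.
Qed.

(** The transform is analytic: around a large parameter [s2] it vanishes on an
    interval, so all its coefficients there vanish, and the series converges down
    to any positive parameter. *)
Lemma gauss_weight_zero_extends (W : R -> R) (M s1 : R) : measurable_fun setT W ->
  (forall r, `|W r| <= M) -> (forall s, s1 <= s -> gw W s = 0) ->
  forall s, 0 < s -> gw W s = 0.
Proof.
move=> mW WM zero s s0.
(* The radius [s2 - s / 2] reaches [s2 - s] and stays below [s2]. *)
pose s2 := Num.max s1 s + 1.
have s12 : s1 < s2 by rewrite (le_lt_trans (_ : _ <= Num.max s1 s)) ?le_max ?lexx// ltrDl.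
have ss2 : s < s2 by rewrite (le_lt_trans (_ : _ <= Num.max s1 s)) ?le_max ?lexx ?orbT// ltrDl.
have rad : 0 < s2 - s / 2 by rewrite subr_gt0 (lt_trans _ ss2)// ltr_pdivrMr// ltr_pMr// ltr1n.
have sm : s2 - s / 2 < s2 by rewrite ltrBlDr ltrDl divr_gt0.
have ser z : `|z| <= s2 - s / 2 -> _ := fun h =>
  @gauss_weight_series W M s2 z mW WM (le_lt_trans h sm).
have [c0|[e e0 nz]] := pseries_zeros rad ser.
  have zb : `|s2 - s| <= s2 - s / 2.
    rewrite ger0_norm ?subr_ge0 ?(ltW ss2)// lerD2l lerN2 ler_pdivrMr// ler_peMr ?ler1n//; exact: ltW.
  have := ser _ zb; rewrite subKr => h.
  apply/esym; apply: (cvg_unique _ _ h) => //.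
  rewrite (_ : (fun _ => _) = (fun=> 0)); first exact: cvg_cst.
  by apply/funext => N; apply: big1 => n _; rewrite c0 mul0r.
pose z := Num.min (e / 2) (s2 - s1).
have z0 : 0 < z by rewrite lt_min divr_gt0// subr_gt0.
have := nz z; rewrite gtr0_norm// z0 (_ : z < e); last first.
  by rewrite gt_min ltr_pdivrMr// ltr_pMr// ltr1n.
rewrite zero ?eqxx; first by move=> /(_ isT).
by rewrite lerBrDr addrC -lerBrDr ge_min lexx orbT.
Qed.

End laplace.

(** * Expansions over cubes of exponents and Hermite polynomials *)

Section cubes.
Context {R : realType} {d : nat}.
Local Notation idx := {ffun 'I_d -> nat}.

Definition cube (N : nat) : seq idx :=
  [seq [ffun i => nat_of_ord (be i)] | be : {ffun 'I_d -> 'I_N}].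

Lemma cube_inj N : injective (fun be : {ffun 'I_d -> 'I_N} => [ffun i => nat_of_ord (be i)]).
Proof.
by move=> f g /ffunP fg; apply/ffunP => i; have := fg i; rewrite !ffunE => /val_inj.
Qed.

Lemma uniq_cube N : uniq (cube N).
Proof. by rewrite map_inj_uniq ?enum_uniq//; exact: cube_inj. Qed.

Lemma mem_cube N (al : idx) : (al \in cube N) = [forall i, (al i < N)%N].
Proof.
apply/mapP/forallP => [[be _ ->] i|h]; first by rewrite ffunE.
exists [ffun i => Ordinal (h i)]; first by rewrite mem_enum.
by apply/ffunP => i; rewrite !ffunE.
Qed.

Lemma sum_cube N (F : 'I_d -> nat -> R) :
  \sum_(al <- cube N) \prod_(i < d) F i (al i) = \prod_(i < d) \sum_(0 <= n < N) F i n.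
Proof.
under [RHS]eq_bigr do rewrite big_mkord.
rewrite bigA_distr_bigA big_map big_enum; apply: eq_bigr => be _.
by apply: eq_bigr => i _; rewrite ffunE.
Qed.

Lemma fsum_cube N (g : idx -> R) :
  (\sum_(al \in [set` cube N]) (g al)%:E = (\sum_(al <- cube N) g al)%:E)%E.
Proof. by rewrite -fsbig_seq ?uniq_cube// sumEFin. Qed.

Lemma le_sum_cube N M (g : idx -> R) : (forall al, 0 <= g al) -> (N <= M)%N ->
  \sum_(al <- cube N) g al <= \sum_(al <- cube M) g al.
Proof.
move=> g0 NM; rewrite -lee_fin -!fsum_cube.
apply: lee_fsum_nneg_subset; [exact: finite_seq|exact: finite_seq| |].
  move=> al; rewrite !inE /= !mem_cube => /forallP h; apply/forallP => i.
  exact: leq_trans NM.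
by move=> al _; rewrite lee_fin.
Qed.

(** Every finite set of exponents is contained in a cube. *)
Lemma esum_cube (g : idx -> R) (L : R) : (forall al, 0 <= g al) ->
  \sum_(al <- cube N) g al @[N --> \oo] --> L ->
  (\esum_(al in [set: idx]) (g al)%:E = L%:E)%E.
Proof.
move=> g0 gL.
have ndg : {homo (fun N => \sum_(al <- cube N) g al) : n m / (n <= m)%N >-> n <= m}.
  by move=> n m nm; exact: le_sum_cube.
apply/eqP; rewrite eq_le; apply/andP; split.
  apply: ge_ereal_sup => _ [A [fA _] <-].
  have /finite_seqP[s sA] := fA.
  pose N := (\max_(al <- s) \max_(i < d) al i).+1.
  apply: (@le_trans _ _ (\sum_(al \in [set` cube N]) (g al)%:E)%E).
    apply: lee_fsum_nneg_subset => //; first exact: finite_seq; last first.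
      by move=> al _; rewrite lee_fin.
    move=> al; rewrite sA !inE /= mem_cube => als; apply/forallP => i.
    rewrite ltnS (leq_trans (leq_bigmax i))//.
    by rewrite (@leq_bigmax_seq _ s xpredT (fun al : idx => \max_(i < d) al i)%N al).
  rewrite fsum_cube lee_fin.
  have := nondecreasing_cvgn_le ndg (cvgP _ gL) N.
  by rewrite (cvg_lim _ gL).
have h N : ((\sum_(al <- cube N) g al)%:E <= \esum_(al in [set: idx]) (g al)%:E)%E.
  by rewrite -fsum_cube; apply: esum_ge; exists [set` cube N] => //; split => //; exact: finite_seq.
have : L%:E = ereal_sup (range (fun N => (\sum_(al <- cube N) g al)%:E)).
  have nde : nondecreasing_seq (fun N => (\sum_(al <- cube N) g al)%:E).
    by move=> n m nm; rewrite lee_fin ndg.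
  have := ereal_nondecreasing_cvgn nde; apply: cvg_unique => //.
  by apply: cvg_EFin; [exact: nearW|exact: gL].
by move=> ->; apply: ge_ereal_sup => _ [N _ <-].
Qed.

(** The series is exhausted by cubes of exponents, because partial sums over
    cubes of a product family factor into one-variable partial sums. *)
Definition entire_at (f : 'rV[R]_d -> R) (x : 'rV[R]_d) (c : idx -> R) := forall h,
  (exists B, forall N, \sum_(al <- cube N) `|c al * monomial al h| <= B) /\
  \sum_(al <- cube N) c al * monomial al h @[N --> \oo] --> f (x + h).

Lemma entire_atB f1 f2 x c1 c2 : entire_at f1 x c1 -> entire_at f2 x c2 ->
  entire_at (fun y => f1 y - f2 y) x (fun al => c1 al - c2 al).
Proof.
move=> h1 h2 h; have [[B1 b1] l1] := h1 h; have [[B2 b2] l2] := h2 h; split.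
  exists (B1 + B2) => N; apply: le_trans (lerD (b1 N) (b2 N)).
  by rewrite -big_split/=; apply: ler_sum => al _; rewrite mulrBl ler_normB.
rewrite (_ : (fun N => _) = (fun N => \sum_(al <- cube N) c1 al * monomial al h -
    \sum_(al <- cube N) c2 al * monomial al h)); first exact: cvgB.
apply/funext => N; rewrite -sumrB; apply: eq_bigr => al _; by rewrite mulrBl.
Qed.

(** Positive and negative parts are half the sum and half the difference of the
    absolute value and the term, so their sums follow from those of both. *)
Lemma entire_at_analytic f x c : entire_at f x c -> analytic_at f x.
Proof.
move=> fc; exists c; apply: (filterS _ (@filterT _ (nbhs x) _)) => y _; have [[B hB] hL] := fc (y - x).
rewrite [x + _]addrC subrK in hL.
set r := fun al => c al * monomial al (y - x).
have ndr : {homo (fun N => \sum_(al <- cube N) `|r al|) : n m / (n <= m)%N >-> n <= m}.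
  move=> n m nm; exact: le_sum_cube.
have cA : cvgn (fun N => \sum_(al <- cube N) `|r al|).
  apply: nondecreasing_is_cvgn => //.
  by exists B => _ [N _ <-]; exact: hB.
pose A : R := limn (fun N => \sum_(al <- cube N) `|r al|).
have hA : \sum_(al <- cube N) `|r al| @[N --> \oo] --> A by exact: cA.
have sA : (\esum_(al in [set: idx]) (`|r al|)%:E = A%:E)%E by exact: esum_cube.
split; first by rewrite /summable/= sA ltry.
have mx (t : R) : Num.max t 0 = (`|t| + t) / 2.
  have [t0|t0] := leP 0 t; first by rewrite ger0_norm//; field.
  by rewrite ltr0_norm// addNr mul0r.
have -> : ((fun al => (r al)%:E)^\+ = fun al => ((`|r al| + r al) / 2)%:E)%E.
  by apply/funext => al; rewrite funeposE -EFin_max; congr EFin; exact: mx.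
have -> : ((fun al => (r al)%:E)^\- = fun al => ((`|r al| - r al) / 2)%:E)%E.
  apply/funext => al; rewrite funenegE -EFinN -EFin_max; congr EFin.
  by rewrite -normrN; exact: mx.
rewrite (esum_cube (L := (A + f y) / 2)); first last.
- rewrite (_ : (fun N => _) = (fun N => (\sum_(al <- cube N) `|r al| + \sum_(al <- cube N) r al) / 2)).
    by apply: cvgMl; apply: cvgD.
  by apply/funext => N; rewrite -big_split/= mulr_suml.
- by move=> al; rewrite divr_ge0// -lerBlDr sub0r -normrN ler_norm.
rewrite (esum_cube (L := (A - f y) / 2)); first last.
- rewrite (_ : (fun N => _) = (fun N => (\sum_(al <- cube N) `|r al| - \sum_(al <- cube N) r al) / 2)).
    by apply: cvgMl; apply: cvgB.
  by apply/funext => N; rewrite -sumrB mulr_suml.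
- by move=> al; rewrite divr_ge0// subr_ge0 ler_norm.
by rewrite -EFinB; congr EFin; field.
Qed.

End cubes.

Section hermite.
Context {R : realType}.
Implicit Types (a b h : R).

(** The coefficients of [expR (a * h - b * h ^+ 2)] as a power series in [h];
    for [b = 1] and [a = 2 * x] this is the Hermite polynomial at [x] divided by
    the factorial of [n]. *)
Definition hermite a b (n : nat) : R :=
  \sum_(0 <= j < n.+1 | (j.*2 <= n)%N) (- b) ^+ j / j`!%:R * (a ^+ (n - j.*2) / (n - j.*2)`!%:R).

(** The partial sums of the product of a power series in [h ^+ 2] and one in [h],
    ordered by total degree: pairs with [2 * j + l < N]. *)
Definition triangle (x y : nat -> R) N : R :=
  \sum_(0 <= n < N) \sum_(0 <= j < n.+1 | (j.*2 <= n)%N) x j * y (n - j.*2)%N.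

Lemma triangleE x y N :
  triangle x y N = \sum_(0 <= j < N) x j * \sum_(0 <= l < N - j.*2) y l.
Proof.
rewrite /triangle; transitivity (\sum_(0 <= n < N) \sum_(0 <= j < N | (j.*2 <= n)%N) x j * y (n - j.*2)%N).
  rewrite big_nat [RHS]big_nat; apply: eq_bigr => n /andP[_ nN].
  rewrite [RHS](big_cat_nat (n := n.+1))//= [X in _ + X]big_nat_cond [X in _ + X]big1 ?addr0//.
  move=> j /andP[/andP[nj _] jn]; exfalso; move: nj jn; rewrite -addnn; lia.
rewrite (exchange_big_dep xpredT)//=; apply: eq_bigr => j _.
rewrite mulr_sumr; have [jN|jN] := leqP j.*2 N.
  rewrite [LHS](big_cat_nat (n := j.*2))//= [X in X + _]big_nat_cond [X in X + _]big1 ?add0r; last first.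
    by move=> n /andP[/andP[_ nj] jn]; exfalso; move: nj jn; lia.
  rewrite -[X in \sum_(X <= _ < _ | _) _]add0n big_addn big_mkcond/=.
  by apply: eq_bigr => l _; rewrite leq_addl addnK.
rewrite [RHS]big_geq; last by lia.
rewrite big_nat_cond big1// => n /andP[/andP[_ nN] jn]; exfalso; lia.
Qed.

Lemma hermite_sum a b h N : \sum_(0 <= n < N) hermite a b n * h ^+ n =
  triangle (exp_coeff (- b * h ^+ 2)) (exp_coeff (a * h)) N.
Proof.
apply: eq_bigr => n _; rewrite /hermite mulr_suml; apply: eq_bigr => j jn.
rewrite /exp_coeff/= [(_ * h ^+ 2) ^+ j]exprMn [(a * h) ^+ _]exprMn -exprM mul2n.
have -> : h ^+ n = h ^+ j.*2 * h ^+ (n - j.*2) by rewrite -exprD subnKC.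
by ring.
Qed.

Lemma le_hermite_sum a b h N : 0 <= b ->
  \sum_(0 <= n < N) `|hermite a b n * h ^+ n| <=
  triangle (exp_coeff (b * h ^+ 2)) (exp_coeff `|a * h|) N.
Proof.
move=> b0; apply: ler_sum => n _; rewrite /hermite mulr_suml.
apply: le_trans (ler_norm_sum _ _ _) _; apply: ler_sum => j jn.
rewrite /exp_coeff/= !normrM !normrX !normrN (ger0_norm b0) [(_ * h ^+ 2) ^+ j]exprMn [(_ * `|h|) ^+ _]exprMn.
rewrite -[h ^+ 2]ger0_norm ?sqr_ge0// normrX -exprM mul2n.
have -> : `|h| ^+ n = `|h| ^+ j.*2 * `|h| ^+ (n - j.*2) by rewrite -exprD subnKC.
rewrite !normfV ![`|_`!%:R|]ger0_norm//.
by rewrite le_eqVlt; apply/orP; left; apply/eqP; ring.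
Qed.

Lemma triangle_le (x y : nat -> R) N : (forall j, 0 <= x j) -> (forall l, 0 <= y l) ->
  triangle x y N <= series x N * series y N.
Proof.
move=> x0 y0; rewrite triangleE /series/= mulr_suml; apply: ler_sum => j _.
apply: ler_wpM2l => //; rewrite [leRHS](big_cat_nat (n := (N - j.*2)%N)) ?leq_subr//=.
by rewrite lerDl sumr_ge0.
Qed.

(** Indices [j] and [l] below [N / 3] satisfy [2 * j + l < N]. *)
Lemma le_triangle (x y : nat -> R) N : (forall j, 0 <= x j) -> (forall l, 0 <= y l) ->
  series x (N %/ 3)%N * series y (N %/ 3)%N <= triangle x y N.
Proof.
move=> x0 y0; rewrite triangleE /series/= mulr_suml.
rewrite [leRHS](big_cat_nat (n := (N %/ 3)%N)) ?leq_div//=.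
apply: ler_wpDr; first by apply: sumr_ge0 => j _; rewrite mulr_ge0// sumr_ge0.
rewrite big_nat [leRHS]big_nat; apply: ler_sum => j /andP[_ jN].
apply: ler_wpM2l => //; rewrite [leRHS](big_cat_nat (n := (N %/ 3)%N))//=; last by lia.
by rewrite lerDl sumr_ge0.
Qed.

Lemma exp_coeff_norm (x : R) n : exp_coeff `|x| n = `|exp_coeff x n|.
Proof. by rewrite /exp_coeff/= normrM normrX normfV [`|n`!%:R|]ger0_norm. Qed.

Lemma hermite_bound a b h N : 0 <= b ->
  \sum_(0 <= n < N) `|hermite a b n * h ^+ n| <= expR (`|a| * `|h| + b * h ^+ 2).
Proof.
move=> b0; apply: le_trans (le_hermite_sum a h N b0) _.
have bh : 0 <= b * h ^+ 2 by rewrite mulr_ge0// sqr_ge0.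
apply: le_trans (triangle_le _ _ _) _.
- by move=> j; exact: exp_coeff_ge0.
- by move=> j; exact: exp_coeff_ge0.
rewrite addrC expRD -normrM; apply: ler_pM; rewrite ?ler_series_expR//.
  by apply: sumr_ge0 => i _; exact: exp_coeff_ge0.
by apply: sumr_ge0 => i _; exact: exp_coeff_ge0.
Qed.

(** The triangle of indices differs from the full square by terms whose absolute
    values sum to at most the difference of the squares of sides [N] and [N / 3],
    which tends to 0. *)
Lemma hermite_cvg a b h : \sum_(0 <= n < N) hermite a b n * h ^+ n @[N --> \oo] -->
  expR (a * h - b * h ^+ 2).
Proof.
under eq_fun do rewrite hermite_sum.
set x := exp_coeff (- b * h ^+ 2); set y := exp_coeff (a * h).
pose X := exp_coeff `|- b * h ^+ 2|; pose Y := exp_coeff `|a * h|.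
have X0 j : 0 <= X j by exact: exp_coeff_ge0.
have Y0 j : 0 <= Y j by exact: exp_coeff_ge0.
have prod_cvg (u v : R) : series (exp_coeff u) N * series (exp_coeff v) N @[N --> \oo] --> expR u * expR v.
  by apply: cvgM; exact: cvg_series_expR.
have tri N : `|series x N * series y N - triangle x y N| <= series X N * series Y N - triangle X Y N.
  rewrite !triangleE /series/= !mulr_suml -!sumrB.
  apply: le_trans (ler_norm_sum _ _ _) _; apply: ler_sum => j _.
  rewrite -!mulrBr normrM -exp_coeff_norm ler_wpM2l//.
  rewrite !(big_cat_nat (leq0n (N - j.*2)) (leq_subr _ _))/= !(addrC (\sum_(0 <= _ < _) _)) !addrK.
  apply: le_trans (ler_norm_sum _ _ _) _; apply: ler_sum => l _.
  by rewrite /Y exp_coeff_norm.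
have gap0 : series X N * series Y N - series X (N %/ 3)%N * series Y (N %/ 3)%N @[N --> \oo] --> 0.
  rewrite -(subrr (expR `|- b * h ^+ 2| * expR `|a * h|)).
  apply: cvgB; first exact: prod_cvg.
  apply: (@cvg_comp _ _ _ (fun N => (N %/ 3)%N) (fun N => series X N * series Y N) _ \oo).
    exact: cvg_divnr.
  exact: prod_cvg.
have diff0 : series x N * series y N - triangle x y N @[N --> \oo] --> 0.
  apply/norm_cvg0P; apply: (squeeze_cvgr _ (cvg_cst 0) gap0); apply: nearW => N.
  by rewrite normr_ge0/= (le_trans (tri N))// lerB// le_triangle.
have -> : expR (a * h - b * h ^+ 2) = expR (- b * h ^+ 2) * expR (a * h) - 0.
  by rewrite subr0 -expRD addrC mulNr.
rewrite (_ : (fun N => _) = (fun N => series x N * series y N -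
    (series x N * series y N - triangle x y N))).
  by apply: cvgB => //; exact: prod_cvg.
by apply/funext => N; rewrite subKr.
Qed.

End hermite.

(** * Analyticity of heat solutions in space *)

Section heat_entire.
Context {R : realType} {d : nat}.
Hypothesis d_gt0 : (0 < d)%N.
Local Notation V := 'rV[R]_d.
Local Notation BV := (borelV R d).
Local Notation LV := (lebesgue_type R d).
Local Notation leb := (lebesgue_Rd R d).
Local Notation idx := {ffun 'I_d -> nat}.

Lemma borel_lebesgue_fun (f : V -> R) :
  measurable_fun [set: BV] (f : BV -> R) -> measurable_fun [set: LV] (f : LV -> R).
Proof. by move=> mf; exact: (measurableT_comp mf (@measurable_id_lebesgue R d)). Qed.

Lemma measurable_gauss_lebesgue (s : R) (x : V) :
  measurable_fun [set: LV] (fun y : LV => expR (- (s * enorm (x - y) ^+ 2))).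
Proof.
apply: (borel_lebesgue_fun (f := fun y => expR (- (s * enorm (x - y) ^+ 2)))).
apply: measurableT_comp => //; apply: measurableT_comp => //.
apply: measurable_funM => //.
rewrite (_ : (fun _ => _) = (fun y : BV => \sum_(i < d) (x ord0 i - (y : V) ord0 i) ^+ 2)).
  apply: measurable_sum => i; apply: measurable_funX; apply: measurable_funB => //.
  exact: measurable_coord.
by apply/funext => y; rewrite sqr_enorm; apply: eq_bigr => i _; rewrite !mxE.
Qed.

(** Reduction of the constant function 1 to its radial average. *)
Lemma gauss_lebesgue_integrable (s : R) (x : V) : 0 < s ->
  leb.-integrable setT (fun y => (expR (- (s * enorm (x - y) ^+ 2)))%:E).
Proof.
move=> s0; apply/integrableP; split.
  by apply/measurable_EFinP; exact: measurable_gauss_lebesgue.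
have m1 : measurable_fun [set: LV] (cst 1 : LV -> R) by exact: measurable_cst.
have b1 (y : V) : 0 <= (cst 1 : V -> R) y <= 1 by rewrite /cst ler01 lexx.
have [fbar [A [mf fM _ _ fG]]] := radial_reduction d_gt0 x m1 b1.
have fb r : `|fbar r| <= 1 by have /andP[h1 h2] := fM r; rewrite ger0_norm.
have int := @gauss_integrable R d _ _ _ mf fb s0.
under eq_integral => y _ do rewrite gee0_abs ?lee_fin ?expR_ge0// -[expR _]mulr1.
rewrite (fG (fun r => expR (- (s * r ^+ 2)))).
- rewrite -(@fineK _ (\int[rho]_r _)%E) -?EFinM ?ltry//.
  exact: integrable_fin_num int.
- exact: measurable_gauss.
- by move=> r; exact: expR_ge0.
Qed.

Section expansion.
Variables (c t M : R) (w : V -> R) (x : V).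
Hypotheses (c_gt0 : 0 < c) (t_gt0 : 0 < t).
Hypotheses (mw : measurable_fun [set: LV] (w : LV -> R)) (wM : forall y, `|w y| <= M).

Let K := (Num.sqrt (4 * pi * c * t) ^+ d)^-1.
Let be := (4 * c * t)^-1.
Let al (y : V) (i : 'I_d) := - (2 * be * (x ord0 i - y ord0 i)).

Let K_ge0 : 0 <= K. Proof. by rewrite invr_ge0 exprn_ge0// sqrtr_ge0. Qed.
Let be_gt0 : 0 < be. Proof. by rewrite invr_gt0 !mulr_gt0. Qed.
Let M_ge0 : 0 <= M. Proof. exact: le_trans (wM 0). Qed.

Let base (y : V) := K * expR (- (be * enorm (x - y) ^+ 2)) * w y.
Let term (k : idx) (y : V) := base y * \prod_(i < d) hermite (al y i) be (k i).
Let dom (h y : V) :=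
  K * M * expR (3 * be * enorm h ^+ 2) * expR (- (be / 2 * enorm (x - y) ^+ 2)).

Let term_monomial k h y : term k y * monomial k h =
  base y * \prod_(i < d) (hermite (al y i) be (k i) * h ord0 i ^+ k i).
Proof. by rewrite /term -mulrA -big_split. Qed.

Let sum_term N h y : \sum_(k <- cube N) term k y * monomial k h =
  base y * \prod_(i < d) \sum_(0 <= n < N) hermite (al y i) be n * h ord0 i ^+ n.
Proof.
under eq_bigr do rewrite term_monomial.
by rewrite -mulr_sumr (sum_cube N (fun i n => hermite (al y i) be n * h ord0 i ^+ n)).
Qed.

Let sum_norm_term N h y :
  \sum_(k <- cube N) `|term k y * monomial k h| <= dom h y.
Proof.
under eq_bigr do rewrite term_monomial normrM normr_prod.
rewrite -mulr_sumr (sum_cube N (fun i n => `|hermite (al y i) be n * h ord0 i ^+ n|)).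
apply: (@le_trans _ _ (K * expR (- (be * enorm (x - y) ^+ 2)) * M *
    expR (\sum_(i < d) (`|al y i| * `|h ord0 i| + be * h ord0 i ^+ 2)))).
  apply: ler_pM => //.
  - by apply: prodr_ge0 => i _; apply: sumr_ge0.
  - rewrite /base normrM ger0_norm ?mulr_ge0 ?expR_ge0//.
    by rewrite ler_wpM2l ?mulr_ge0 ?expR_ge0.
  - rewrite expR_sum; apply: ler_prod => i _; rewrite sumr_ge0//=.
    by apply: hermite_bound; exact: ltW.
rewrite /dom [K * _ * M]mulrAC -[leLHS]mulrA -[leRHS]mulrA.
rewrite ler_wpM2l ?mulr_ge0// -!expRD ler_expR !sqr_enorm !mulr_sumr.
rewrite -!sumrN -!big_split/=; apply: ler_sum => i _; rewrite !mxE /al.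
rewrite normrN !normrM (gtr0_norm be_gt0) [`|2|]ger0_norm//.
set z := x ord0 i - y ord0 i; set q := h ord0 i.
have -> : z ^+ 2 = `|z| ^+ 2 by rewrite real_normK ?num_real.
have -> : q ^+ 2 = `|q| ^+ 2 by rewrite real_normK ?num_real.
rewrite -subr_ge0.
(* [2 * |z| * |q| <= |z| ^+ 2 / 2 + 2 * |q| ^+ 2]: half of the Gaussian factor
   absorbs the linear term *)
have -> : 3 * be * `|q| ^+ 2 - be / 2 * `|z| ^+ 2 -
    (- (be * `|z| ^+ 2) + (2 * be * `|z| * `|q| + be * `|q| ^+ 2)) =
    be / 2 * (`|z| - 2 * `|q|) ^+ 2 by field.
by rewrite mulr_ge0 ?sqr_ge0// divr_ge0// ltW.
Qed.

Let measurable_hermite i n : measurable_fun [set: BV] (fun y : BV => hermite (al y i) be n).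
Proof.
rewrite /hermite; under eq_fun do rewrite big_mkcond/=.
apply: measurable_sum => j; case: (j.*2 <= n)%N; last exact: measurable_cst.
apply: measurable_funM => //; apply: measurable_funM => //.
apply: measurable_funX; apply: measurableT_comp => //; apply: measurable_funM => //.
by apply: measurable_funB => //; exact: measurable_coord.
Qed.

Let measurable_term k : measurable_fun [set: LV] (term k : LV -> R).
Proof.
apply: measurable_funM.
  apply: measurable_funM; last exact: mw.
  apply: measurable_funM; first exact: measurable_cst.
  exact: measurable_gauss_lebesgue.
apply: (borel_lebesgue_fun (f := fun y => \prod_(i < d) hermite (al y i) be (k i))).
by apply: measurable_prod => i _; exact: measurable_hermite.
Qed.

Let integrable_dom h : leb.-integrable setT (EFin \o dom h).
Proof.
have be2 : 0 < be / 2 by rewrite divr_gt0.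
exact: (integrableZl measurableT (K * M * expR (3 * be * enorm h ^+ 2))
  (gauss_lebesgue_integrable x be2)).
Qed.

Let integrable_term k : leb.-integrable setT (EFin \o term k).
Proof.
apply: (le_integrable measurableT _ _ (integrable_dom (const_mx 1))).
  by apply/measurable_EFinP; exact: measurable_term.
move=> y _; rewrite /= lee_fin (le_trans _ (ler_norm _))//.
pose N := (\max_(i < d) k i).+1.
have kN : k \in cube N.
  by rewrite mem_cube; apply/forallP => i; rewrite ltnS; exact: leq_bigmax.
(* At [h = (1, ..., 1)] the term is one of those bounded together. *)
apply: le_trans (sum_norm_term N (const_mx 1) y).
rewrite (bigD1_seq k) ?uniq_cube//= (_ : monomial k _ = 1) ?mulr1 ?lerDl ?sumr_ge0//.
by rewrite /monomial big1// => i _; rewrite mxE expr1n.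
Qed.

Let integrable_termM k h : leb.-integrable setT (EFin \o (fun y => term k y * monomial k h)).
Proof. exact: (integrableZr measurableT (monomial k h) (integrable_term k)). Qed.

(** The Gaussian kernel at [x + h - y] is its value at [x - y] times a product of
    generating functions of Hermite polynomials in the coordinates of [h]; the
    series is integrated term by term. *)
Lemma heat_sol_entire_coeff : entire_at (fun z => heat_sol c w z t) x
  (fun k => \int[leb]_y term k y)%R.
Proof.
move=> h; split.
  exists (\int[leb]_y dom h y)%R => N.
  apply: (@le_trans _ _ (\sum_(k <- cube N) \int[leb]_y `|term k y * monomial k h|)%R).
    apply: ler_sum => k _.
    have -> : ((\int[leb]_y term k y) * monomial k h = \int[leb]_y (term k y * monomial k h))%R.
      by rewrite RintegralZr//; exact: integrable_term.
    exact: le_normr_Rintegral.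
  have in_ k : leb.-integrable setT (EFin \o (fun y => `|term k y * monomial k h|)).
    exact: (integrable_abse (integrable_termM k h)).
  rewrite -Rintegral_sum//; apply: le_Rintegral => //.
  rewrite (_ : EFin \o _ = fun y => (\sum_(k <- cube N) (`|term k y * monomial k h|)%:E)%E).
    by apply: (integrable_sum measurableT) => k _; exact: in_.
  by apply/funext => y; rewrite /= sumEFin.
rewrite (_ : (fun N => _) = (fun N => \int[leb]_y \sum_(k <- cube N) term k y * monomial k h)%R); last first.
  apply/funext => N; rewrite Rintegral_sum//; apply: eq_bigr => k _.
  by rewrite RintegralZr//; exact: integrable_term.
apply: (@Rintegral_dominated _ _ _ leb _ _ (dom h)); last 2 first.
- exact: integrable_dom.
- move=> N y; apply: le_trans (sum_norm_term N h y); exact: ler_norm_sum.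
- move=> N; apply: measurable_sum => k; apply: measurable_funM (measurable_cst _).
  exact: measurable_term.
- move=> y; under eq_fun do rewrite sum_term.
  have -> : heat_kernel c (x + h - y) t * w y =
      base y * \prod_(i < d) expR (al y i * h ord0 i - be * h ord0 i ^+ 2).
    rewrite /heat_kernel /base -/K [_ / (4 * _ * _)]mulrC -/be [RHS]mulrAC.
    congr (_ * _); rewrite -[RHS]mulrA; congr (_ * _).
    rewrite -expR_sum -expRD; congr expR.
    rewrite !sqr_enorm !mulr_sumr -!sumrN -big_split/=.
    by apply: eq_bigr => i _; rewrite !mxE /al; ring.
  apply: cvgMr; apply: cvg_big; first exact: mul_continuous.
  by move=> i _; exact: hermite_cvg.
Qed.

End expansion.

Lemma heat_sol_entire (c t M : R) (w : V -> R) (x : V) : 0 < c -> 0 < t ->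
  measurable_fun [set: LV] (w : LV -> R) -> (forall y, `|w y| <= M) ->
  exists k, entire_at (fun z => heat_sol c w z t) x k.
Proof. by move=> c0 t0 mw wM; eexists; exact: heat_sol_entire_coeff mw wM. Qed.

End heat_entire.

Section one_dim.
Context {R : realType}.

(** In dimension 1 the cubes of exponents are initial segments and the expansion
    is a power series converging on the whole line. *)
Lemma entire_at_zeros (f : 'rV[R]_1 -> R) (x : 'rV[R]_1) c : entire_at f x c ->
  (forall y, f y = 0) \/
  exists2 e, 0 < e & forall z, 0 < `|z| < e -> f (x + const_mx z) != 0.
Proof.
move=> fc.
have ser (z : R) : \sum_(0 <= n < N) c [ffun=> n] * z ^+ n @[N --> \oo] --> f (x + const_mx z).
  have [_] := fc (const_mx z); rewrite (_ : (fun N => _) =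
    (fun N => \sum_(0 <= n < N) c [ffun=> n] * z ^+ n))//.
  apply/funext => N; rewrite big_mkord big_map big_enum/=.
  rewrite (reindex (fun n : 'I_N => [ffun _ : 'I_1 => n])) /=; last first.
    exists (fun g : {ffun 'I_1 -> 'I_N} => g ord0) => [n _|g _]; first by rewrite ffunE.
    by apply/ffunP => i; rewrite ffunE [i]ord1.
  apply: eq_bigr => n _; rewrite /monomial big_ord1 !mxE !ffunE; congr (c _ * _).
  by apply/ffunP => i; rewrite !ffunE.
have [c0|[e e0 nz]] := pseries_zeros (f := fun z => f (x + const_mx z)) ltr01 (fun z _ => ser z).
  left=> y; have -> : y = x + const_mx ((y - x) ord0 ord0).
    by apply/rowP => i; rewrite [i]ord1 !mxE addrC subrK.
  have := ser ((y - x) ord0 ord0); rewrite (_ : (fun N => _) = (fun=> 0)).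
    by move=> h; apply/esym; apply: (cvg_unique _ _ h) => //; exact: cvg_cst.
  by apply/funext => N; apply: big1 => n _; rewrite c0 mul0r.
by right; exists e.
Qed.

End one_dim.

(** * The diffusive sign *)

Section coincidence.
Context {R : realType} {d : nat}.
Hypothesis d_gt0 : (0 < d)%N.
Local Notation V := 'rV[R]_d.
Local Notation LV := (lebesgue_type R d).
Local Notation rho := (@rho R d).

Lemma radial_avgN (f : V -> R) x r : radial_avg f x (- r) = radial_avg f x r.
Proof.
rewrite /radial_avg; case: ifP => _; last by rewrite normrN.
have -> : const_mx (- r) = - const_mx r :> V by apply/rowP => i; rewrite !mxE.
by rewrite opprK addrC.
Qed.

Lemma rho_conull_meets (N : set R) p q : measurable N -> rho N = 0%E ->
  0 <= p -> p < q -> exists2 r, p < r < q & ~ N r.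
Proof.
move=> mN N0 p0 pq; apply: contrapT => none.
pose m := (p + q) / 2.
have [pm mq] := midf_lt pq; rewrite -/m in pm mq.
have m0 : 0 < m by apply: le_lt_trans pm.
have : (rho `[m, q[ <= rho N)%E.
  apply: le_measure; rewrite ?inE//.
  move=> r /=; rewrite in_itv/= => /andP[mr rq]; apply: contrapT => Nr; apply: none.
  by exists r => //; rewrite rq (lt_le_trans pm).
rewrite N0 rho_itv ?m0// lee_fin subr_le0 leNgt => /negP; apply.
by rewrite ltrXn2r ?gtn_eqF// ?(ltW m0)// ltW// (lt_trans m0).
Qed.

(** A null set for [rho] contains no interval of positive radii, and negative
    radii are reached by symmetry. *)
Lemma even_zeros_dense (w : R -> R) (N : set R) : measurable N -> rho N = 0%E ->
  (forall r, w (- r) = w r) -> (forall r, 0 < r -> ~ N r -> w r = 0) ->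
  forall p q, p < q -> exists2 r, p < r < q & w r = 0.
Proof.
move=> mN N0 wE w0 p q pq.
have [q0|q0] := ltP 0 q.
  have mq : Num.max p 0 < q by rewrite gt_max pq.
  have m0 : 0 <= Num.max p 0 by rewrite le_max lexx orbT.
  have [r /andP[mr rq] Nr] := rho_conull_meets mN N0 m0 mq.
  move: mr; rewrite gt_max => /andP[pr r0].
  by exists r; [rewrite pr|exact: w0].
have Nq0 : 0 <= - q by rewrite oppr_ge0.
have qp : - q < - p by rewrite ltrN2.
have [r /andP[qr rp] Nr] := rho_conull_meets mN N0 Nq0 qp.
exists (- r); first by rewrite ltrNr rp ltrNl qr.
by rewrite wE; apply: w0 => //; exact: le_lt_trans qr.
Qed.

End coincidence.

Section one_sided.
Context {R : realType}.
Implicit Types (f g w : R -> R).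

Lemma left_continuous_zero w r : left_continuous_at w r ->
  (forall p q, p < q -> exists2 s, p < s < q & w s = 0) -> w r = 0.
Proof.
move=> wr dense; apply/eqP; apply: contrapT => /negP wr0.
have e0 : 0 < `|w r| by rewrite normr_gt0.
have /cvgrPdist_lt/(_ _ e0)[e /= e0' he] := wr.
have [s /andP[rs sr] ws] : exists2 s, r - e < s < r & w s = 0.
  by apply: dense; rewrite ltrBlDr ltrDl.
have := he s; rewrite /ball/= ws subr0 ltxx => h; apply: (notF (h _ sr)).
by rewrite gtr0_norm ?subr_gt0// ltrBlDr addrC -ltrBlDr.
Qed.

Lemma right_continuous_zero w r : right_continuous_at w r ->
  (forall p q, p < q -> exists2 s, p < s < q & w s = 0) -> w r = 0.
Proof.
move=> wr dense; apply/eqP; apply: contrapT => /negP wr0.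
have e0 : 0 < `|w r| by rewrite normr_gt0.
have /cvgrPdist_lt/(_ _ e0)[e /= e0' he] := wr.
have [s /andP[rs sr] ws] : exists2 s, r < s < r + e & w s = 0.
  by apply: dense; rewrite ltrDl.
have := he s; rewrite /ball/= ws subr0 ltxx => h; apply: (notF (h _ rs)).
by rewrite distrC gtr0_norm ?subr_gt0// ltrBlDr addrC.
Qed.

Lemma left_continuous_scale g k r : 0 < k -> left_continuous_at g (k * r) ->
  left_continuous_at (fun s => g (k * s)) r.
Proof.
move=> k0 gr; apply: (@cvg_comp _ _ _ (fun s => k * s) g _ (k * r)^'-); last exact: gr.
move=> A [e /= e0 he]; exists (e / k) => /=; first by rewrite divr_gt0.
move=> s /=; rewrite /ball/= => rs sr; apply: he; last by rewrite ltr_pM2l.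
by rewrite /ball/= -mulrBr normrM gtr0_norm// mulrC -ltr_pdivlMr.
Qed.

Lemma right_continuous_scale g k r : 0 < k -> right_continuous_at g (k * r) ->
  right_continuous_at (fun s => g (k * s)) r.
Proof.
move=> k0 gr; apply: (@cvg_comp _ _ _ (fun s => k * s) g _ (k * r)^'+); last exact: gr.
move=> A [e /= e0 he]; exists (e / k) => /=; first by rewrite divr_gt0.
move=> s /=; rewrite /ball/= => rs sr; apply: he; last by rewrite ltr_pM2l.
by rewrite /ball/= -mulrBr normrM gtr0_norm// mulrC -ltr_pdivlMr.
Qed.

Lemma not_discontinuous f r : ~ discontinuities f r ->
  left_continuous_at f r /\ right_continuous_at f r.
Proof.
move=> /contrapT fr; split.
  exact: (cvg_at_left_filter fr).
exact: (cvg_at_right_filter fr).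
Qed.

(** With one-sided continuity on a common side everywhere, a difference that
    vanishes on a dense set vanishes identically. *)
Lemma dense_zeros_eq0 f g k r : 0 < k ->
  (discontinuities f r -> left_continuous_at f r \/ right_continuous_at f r) ->
  (discontinuities g (k * r) ->
     left_continuous_at g (k * r) \/ right_continuous_at g (k * r)) ->
  (discontinuities f r -> discontinuities g (k * r) ->
     left_continuous_at f r /\ left_continuous_at g (k * r) \/
     right_continuous_at f r /\ right_continuous_at g (k * r)) ->
  (forall p q, p < q -> exists2 s, p < s < q & f s - g (k * s) = 0) ->
  f r - g (k * r) = 0.
Proof.
move=> k0 fside gside both dense.
have [[fl gl]|[fr gr]] : left_continuous_at f r /\ left_continuous_at g (k * r) \/
    right_continuous_at f r /\ right_continuous_at g (k * r).
  have [fd|/not_discontinuous[fl fr]] := pselect (discontinuities f r);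
    have [gd|/not_discontinuous[gl gr]] := pselect (discontinuities g (k * r)).
  - exact: both.
  - by have [?|?] := fside fd; [left|right].
  - by have [?|?] := gside gd; [left|right].
  - by left.
- apply: (@left_continuous_zero (fun s => f s - g (k * s))) => //.
  by apply: cvgB => //; exact: left_continuous_scale.
- apply: (@right_continuous_zero (fun s => f s - g (k * s))) => //.
  by apply: cvgB => //; exact: right_continuous_scale.
Qed.

End one_sided.

Section diffusive.
Context {R : realType} {d : nat}.
Hypothesis d_gt0 : (0 < d)%N.
Local Notation V := 'rV[R]_d.
Local Notation LV := (lebesgue_type R d).
Local Notation rho := (@rho R d).
Local Notation gw := (@gauss_weight R d).

Lemma bounded_fun_le (f : V -> R) : bounded_fun f -> exists M, forall y, `|f y| <= M.
Proof.
move=> [M [_ hM]]; exists (`|M| + 1) => y; apply: hM => //.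
by rewrite (le_lt_trans (ler_norm M))// ltrDl.
Qed.

Variables (a b k : R) (u0 v0 : V -> R).
Hypotheses (a_gt0 : 0 < a) (k_gt0 : 0 < k) (bE : b = a * k ^+ 2)
  (u0_ge0 : forall x, 0 <= u0 x) (v0_ge0 : forall x, 0 <= v0 x)
  (u0_bounded : bounded_fun u0) (v0_bounded : bounded_fun v0)
  (u0_meas : measurable_fun [set: LV] (u0 : LV -> R))
  (v0_meas : measurable_fun [set: LV] (v0 : LV -> R)).

Let b_gt0 : 0 < b. Proof. by rewrite bE mulr_gt0// exprn_gt0. Qed.

(** The dependence on time of the difference of the solutions at [x] is that of
    a Gaussian transform up to a positive factor, so signs can be read off from
    the transform. *)
Lemma difference_profile x : exists (W : R -> R) (M : R) (A : set R),
  [/\ measurable_fun setT W, forall r, `|W r| <= M, measurable A /\ rho A = 0%E,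
      forall r, 0 < r -> ~ A r -> W r = radial_avg u0 x r - radial_avg v0 x (k * r) &
      exists C : R -> R, forall t, 0 < t -> 0 < C t /\
        heat_sol a u0 x t - heat_sol b v0 x t = C t * gw W (4 * a * t)^-1].
Proof.
have [Mu uM] := bounded_fun_le u0_bounded; have [Mv vM] := bounded_fun_le v0_bounded.
have uM' y : 0 <= u0 y <= Mu by rewrite u0_ge0 (le_trans (ler_norm _) (uM y)).
have vM' y : 0 <= v0 y <= Mv by rewrite v0_ge0 (le_trans (ler_norm _) (vM y)).
have [W [A [mW WM A0 WA WE]]] :=
  heat_diff_radial d_gt0 x a_gt0 k_gt0 bE u0_meas uM' v0_meas vM'.
exists W, (Mu + Mv), A; split => //; eexists => t t0; split; last exact: WE.
rewrite mulr_gt0// ?cone_sphere_gt0// invr_gt0 exprn_gt0// sqrtr_gt0.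
by rewrite !mulr_gt0// pi_gt0.
Qed.

Lemma sgn_diff_eventually x sg t1 : 0 < t1 ->
  (forall t, 0 < t < t1 -> sgn_diff a b u0 v0 x t = sg) ->
  diffusive_sign_well_defined a b u0 v0 x /\ diffusive_sign a b u0 v0 x = sg.
Proof.
move=> t10 h.
have c : sgn_diff a b u0 v0 x t @[t --> 0^'+] --> sg.
  apply: cvg_near_cst; near=> t; apply: h; apply/andP; split; near: t.
    exact: nbhs_right_gt.
  exact: nbhs_right_lt.
by split; [apply: cvgP c|exact: cvg_lim c].
Unshelve. all: by end_near. Qed.

(** As [t] tends to 0 the parameter [1 / (4 * a * t)] of the transform tends to
    infinity, where the transform has a constant sign. *)
Lemma diffusive_sign_dichotomy x (w := fun r => radial_avg u0 x r - radial_avg v0 x (k * r)) :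
  sign_changes_locally_finite w ->
  exists sg t1 (N : set R), [/\ 0 < t1, measurable N /\ rho N = 0%E,
    forall t, 0 < t < t1 -> sgn_diff a b u0 v0 x t = sg,
    (forall r, w r = 0) -> sg = 0 &
    sg = 0 -> forall r, 0 < r -> ~ N r -> w r = 0].
Proof.
move=> fin; have [W [M [A [mW WM [mA A0] WA [C CE]]]]] := difference_profile x.
have mz := measurable_nz mW measurableT; rewrite setTI in mz.
have sgE t : 0 < t -> sgn_diff a b u0 v0 x t = Num.sg (gw W (4 * a * t)^-1).
  by move=> t0; have [C0 e] := CE t t0; rewrite /sgn_diff e sgrM gtr0_sg// mul1r.
have [W0|[sg [sg0 [s1 s10 hs]]]] := gauss_weight_sign d_gt0 mW WM mA A0 WA fin.
  exists 0, 1, (A `|` [set r | W r != 0]); split => //.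
  - by split; [exact: measurableU|exact: rho_setU_eq0].
  - move=> t /andP[t0 _]; rewrite sgE// gauss_weight_null// sgr0//.
  - move=> _ r r0 Nr; rewrite /w -WA//; last by move=> Ar; apply: Nr; left.
    by apply: contrapT => Wr; apply: Nr; right; exact/eqP.
exists sg, (4 * a * s1)^-1, set0; split.
- by rewrite invr_gt0 !mulr_gt0.
- by split => //; exact: measure0.
- move=> t /andP[t0 tt]; rewrite sgE//; apply: hs.
  rewrite -[s1]invrK lef_pV2 ?posrE ?invr_gt0 ?mulr_gt0//.
  apply: ltW; move: tt; rewrite !invfM; set q := s1^-1 => tt.
  by rewrite mulrC -ltr_pdivlMr ?mulr_gt0// mulrC invfM.
- move=> w0; have W0 : rho [set r | W r != 0] = 0%E.
    apply/eqP; rewrite eq_le measure_ge0 andbT.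
    have B0 : rho (A `|` `]-oo, 0]) = 0%E.
      apply: rho_setU_eq0 => //; apply: rho_neg => // r /=; by rewrite in_itv.
    rewrite -B0; apply: le_measure; rewrite ?inE//; first exact: measurableU.
    move=> r /= /negP Wr; have [r0|r0] := leP r 0; first by right; rewrite /= in_itv.
    by left; apply: contrapT => Ar; apply: Wr; rewrite WA// [X in X == _]w0.
  by rewrite -(hs s1 (lexx _)) gauss_weight_null// sgr0.
- by move=> sgz; rewrite sgz eqxx in sg0.
Qed.

(** The sign takes three values only, so a limit equal to 0 means that the
    solutions agree at [x] for small times; the transform then vanishes for large
    parameters, hence for all. *)
Lemma diffusive_sign0_eq x : diffusive_sign_well_defined a b u0 v0 x ->
  diffusive_sign a b u0 v0 x = 0 ->
  forall t, 0 < t -> heat_sol a u0 x t = heat_sol b v0 x t.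
Proof.
move=> wd; rewrite /diffusive_sign => ds0.
have c : sgn_diff a b u0 v0 x t @[t --> 0^'+] --> (0 : R).
  by rewrite -[X in _ --> X]ds0; exact: wd.
have /cvgrPdist_lt/(_ _ ltr01)[t1 /= t10 h] := c.
have [W [M [A [mW WM _ _ [C CE]]]]] := difference_profile x.
have z s : (4 * a * (t1 / 2))^-1 <= s -> gw W s = 0.
  move=> ss; have t20 : 0 < (4 * a * (t1 / 2))^-1 by rewrite invr_gt0 !mulr_gt0// divr_gt0.
  have s0 : 0 < s by apply: lt_le_trans ss.
  pose t := (4 * a * s)^-1.
  have t0 : 0 < t by rewrite invr_gt0 !mulr_gt0.
  have tt : t < t1.
    apply: (@le_lt_trans _ _ (t1 / 2)); last by rewrite ltr_pdivrMr// ltr_pMr// ltr1n.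
    rewrite /t invfM -ler_pdivlMl ?invr_gt0 ?mulr_gt0// invrK.
    by rewrite -[leRHS]invrK lef_pV2 ?posrE// invr_gt0 !mulr_gt0// divr_gt0.
  have := h t; rewrite /ball/= sub0r normrN gtr0_norm// => /(_ tt t0).
  have [C0 e] := CE t t0.
  rewrite sub0r normrN /sgn_diff e normr_sg.
  have -> : (4 * a * t)^-1 = s by rewrite /t; field; rewrite !gt_eqF.
  have [->//|nz] := eqVneq (gw W s) 0.
  by rewrite mulf_neq0 ?(gt_eqF C0)//= -[X in _ < X]/(1%:R) ltr_nat.
move=> t t0; have [_ e] := CE t t0; apply/eqP; rewrite -subr_eq0 e.
by rewrite (gauss_weight_zero_extends mW WM z) ?mulr0// invr_gt0 !mulr_gt0.
Qed.

Lemma difference_entire t x : 0 < t ->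
  exists c, entire_at (fun y => heat_sol a u0 y t - heat_sol b v0 y t) x c.
Proof.
move=> t0.
have [Mu uM] := bounded_fun_le u0_bounded; have [Mv vM] := bounded_fun_le v0_bounded.
have [cu hu] := heat_sol_entire d_gt0 x a_gt0 t0 u0_meas uM.
have [cv hv] := heat_sol_entire d_gt0 x b_gt0 t0 v0_meas vM.
by exists (fun al => cu al - cv al); exact: entire_atB.
Qed.

End diffusive.

Lemma entire_zeros_isolated (R : realType) (d : nat) (f : 'rV[R]_d -> R)
    (S : set 'rV[R]_d) : d = 1%N -> (forall x, exists c, entire_at f x c) ->
  (exists x, f x != 0) -> (forall x, S x -> f x = 0) -> S `<=` isolated S.
Proof.
move=> d1; subst d => fE [x1 fx1] Sf x Sx.
have [c fc] := fE x; have [f0|[e e0 nz]] := entire_at_zeros fc.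
  by rewrite f0 eqxx in fx1.
split; first exact: mem_set.
exists [set y : 'rV[R]_1 | `|x ord0 ord0 - y ord0 ord0| < e].
  have /cvgrPdist_lt/(_ _ e0) := @coord_continuous R 1 1 ord0 ord0 x; exact.
apply/seteqP; split => [y [xy Sy]|_ -> /=]; last by split => //; rewrite subrr normr0.
apply: contrapT => yx; pose z := (y - x) ord0 ord0.
have yE : y = x + const_mx z.
  by apply/rowP => i; rewrite [i]ord1 /z !mxE addrC subrK.
have : f (x + const_mx z) != 0.
  apply: nz; apply/andP; split.
    rewrite normr_gt0; apply/eqP => z0; apply: yx; rewrite yE z0.
    by apply/rowP => i; rewrite !mxE addr0.
  by move: xy; rewrite /= distrC /z !mxE.
by rewrite -yE Sf ?eqxx.
Qed.

Theorem lemma2p1 (R : realType) (d : nat) (d_gt0 : (0 < d)%N)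
    (a b T : R) (a_gt0 : 0 < a) (b_gt0 : 0 < b) (T_gt0 : 0 < T)
    (u0 v0 : 'rV[R]_d -> R)
    (u0_ge0 : forall x, 0 <= u0 x) (v0_ge0 : forall x, 0 <= v0 x)
    (u0_bounded : bounded_fun u0) (v0_bounded : bounded_fun v0)
    (u0_meas : measurable_fun [set: lebesgue_type R d] u0)
    (v0_meas : measurable_fun [set: lebesgue_type R d] v0)
    (u v : 'rV[R]_d -> R -> R)
    (u_sol : u = heat_sol a u0) (v_sol : v = heat_sol b v0)
    (xhat : 'rV[R]_d)
    (u0_cont : {for xhat, continuous u0}) (v0_cont : {for xhat, continuous v0})
    (u0v0 : u0 xhat = v0 xhat)
    (A1u : piecewise_continuous (radial_avg u0 xhat))
    (A1v : piecewise_continuous (radial_avg v0 xhat))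
    (A2u : forall r, discontinuities (radial_avg u0 xhat) r ->
       left_continuous_at (radial_avg u0 xhat) r \/
       right_continuous_at (radial_avg u0 xhat) r)
    (A2v : forall r, discontinuities (radial_avg v0 xhat) r ->
       left_continuous_at (radial_avg v0 xhat) r \/
       right_continuous_at (radial_avg v0 xhat) r)
    (k : R) (k_def : k = Num.sqrt (b / a))
    (w0bar : R -> R)
    (w0bar_def : w0bar =
       fun r => radial_avg u0 xhat r - radial_avg v0 xhat (k * r))
    (Z_locally_finite : sign_changes_locally_finite w0bar) :
  [/\ diffusive_sign_well_defined a b u0 v0 xhat,
      exists that, [/\ 0 < that, that <= T &
        forall t, 0 < t < that ->
          Num.sg (u xhat t - v xhat t) = diffusive_sign a b u0 v0 xhat],
      (forall r, w0bar r = 0) -> diffusive_sign a b u0 v0 xhat = 0,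
      (* at a common discontinuity, the one-sided continuity is on a common
         side; without this the implication fails *)
      (forall r, discontinuities (radial_avg u0 xhat) r ->
                 discontinuities (radial_avg v0 xhat) (k * r) ->
         left_continuous_at (radial_avg u0 xhat) r /\
         left_continuous_at (radial_avg v0 xhat) (k * r) \/
         right_continuous_at (radial_avg u0 xhat) r /\
         right_continuous_at (radial_avg v0 xhat) (k * r)) ->
      diffusive_sign a b u0 v0 xhat = 0 -> forall r, w0bar r = 0 &
      let S := [set x | diffusive_sign_well_defined a b u0 v0 x /\
                        diffusive_sign a b u0 v0 x = 0] in
      let uv_differ := exists x t, 0 < t < T /\ u x t <> v x t in
      (d = 1%N -> uv_differ -> S `<=` isolated S) /\
      ((2 <= d)%N -> exists V : set 'rV[R]_d,
         [/\ analytic_variety V, S `<=` V & uv_differ -> V <> setT])].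
Proof.
have k0 : 0 < k by rewrite k_def sqrtr_gt0 divr_gt0.
have bE : b = a * k ^+ 2.
  by rewrite k_def sqr_sqrtr ?divr_ge0 ?ltW// mulrC divfK// gt_eqF.
move: u_sol v_sol w0bar_def Z_locally_finite => -> -> -> fin.
have [sg [t1 [N [t10 [mN N0] sgE w0 sg0]]]] := diffusive_sign_dichotomy d_gt0 a_gt0 k0 bE
  u0_ge0 v0_ge0 u0_bounded v0_bounded u0_meas v0_meas fin.
have [wd ds] := sgn_diff_eventually t10 sgE.
split => //.
- exists (Num.min T t1); split; first by rewrite lt_min T_gt0.
    by rewrite ge_min lexx.
  move=> t /andP[t0]; rewrite lt_min => /andP[_ tt].
  by rewrite ds -(sgE t) ?t0.
- by move=> /w0 <-.
- move=> common; rewrite ds => /sg0 wN r.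
  apply: (dense_zeros_eq0 k0 (A2u r) (A2v (k * r)) (common r)).
  apply: (even_zeros_dense d_gt0 mN N0 _ wN) => s.
  by rewrite mulrN !radial_avgN.
move=> S differ.
have SE x t : 0 < t -> S x -> heat_sol a u0 x t - heat_sol b v0 x t = 0.
  move=> t0 [Swd Sds]; rewrite (diffusive_sign0_eq d_gt0 a_gt0 k0 bE u0_ge0 v0_ge0 u0_bounded v0_bounded
    u0_meas v0_meas Swd Sds t0).
  exact: subrr.
have ent t x : 0 < t -> exists c,
    entire_at (fun y => heat_sol a u0 y t - heat_sol b v0 y t) x c.
  exact: (difference_entire d_gt0 a_gt0 k0 bE u0_bounded v0_bounded u0_meas v0_meas).
split=> [d1 [x1 [t2 [/andP[t20 _] ne]]]|_].
  apply: (entire_zeros_isolated d1 (fun x => ent t2 x t20)).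
    by exists x1; rewrite subr_eq0; exact/eqP.
  by move=> x; exact: SE.
have [[x1 [t2 [/andP[t20 _] ne]]]|same] := pselect differ; last first.
  exists setT; split => // p; exists setT; split; first by split => //; exact: openT.
  exists 0, (fun=> fun=> 0); split; first by case.
  by move=> x _; split => // _ [].
exists [set x | heat_sol a u0 x t2 = heat_sol b v0 x t2]; split.
- move=> p; exists setT; split; first by split => //; exact: openT.
  exists 1%N, (fun _ y => heat_sol a u0 y t2 - heat_sol b v0 y t2); split.
    by move=> _ x _; have [c /entire_at_analytic] := ent t2 x t20.
  move=> x _; split=> /= [-> _|/(_ ord0)]; [exact: subrr|exact: subr0_eq].
- by move=> x /(SE _ _ t20); exact: subr0_eq.
- by move=> _ VT; apply: ne; have : [set: 'rV[R]_d] x1 by []; rewrite -VT.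
Qed.
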